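(* Let $x_0\in\mathcal U$ be a non-singular point of the system $\frac{dy}{dx}=A(x)y$. The following are equivalent: (a) There is a complete-decomposer linear symmetry in $\mathbf{sym}^1_X(\mathcal K)$. (b) The Galois group $\mathrm{Gal}(x_0,X)$ is conjugated (in $\mathrm{GL}(n,\mathbb C)$) to a subgroup of the group of diagonal matrices $(\mathbb C^* )^n\subset\mathrm{GL}(n,\mathbb C)$.
   Context: Let $\mathcal U$ be a nonempty connected open subset of $\mathbb{CP}_1$ with affine coordinate $x$. A function field $\mathcal K$ is a subfield of the field of meromorphic functions on $\mathcal U$ that contains the constants $\mathbb C$ and is closed under $\frac{d}{dx}$; fix one. Fix $n\ge 1$ and $A(x)=(a_{ij}(x))\in\mathfrak{gl}(n,\mathcal K)$, and consider the linear system $\frac{dy}{dx}=A(x)y$, $y=(y_1,\ldots,y_n)$, with associated meromorphic vector field on $\mathcal U\times\mathbb C^n$ $$X=\frac{\partial}{\partial x}+\sum_{i,j=1}^n a_{ij}(x)y_j\frac{\partial}{\partial y_i}.$$ The singularities of the system are the poles of $A(x)$; the point at infinity (if in $\mathcal U$) counts as a singularity if the system rewritten in the coordinate $t=1/x$ has a pole at $t=0$. Linear symmetries: $\mathbf{sym}^1_X(\mathcal K)$ is the set of vector fields $Y=\sum_{i,j}b_{ij}(x)y_j\frac{\partial}{\partial y_i}$ with $b_{ij}\in\mathcal K$ and $[X,Y]=0$; equivalently the matrix $B(x)=(b_{ij}(x))$ of $Y$ satisfies $\frac{dB}{dx}=[A(x),B]$. The Jordan canonical form of such a $B(x)$ does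 not depend on the point $x$. $Y$ is a complete-decomposer symmetry if all the eigenvalues of $B(x)$ are different (i.e. $B(x)$ has $n$ distinct eigenvalues). Galois group: for a finite-dimensional complex (algebraic) linear representation $\Psi:\mathrm{GL}(n,\mathbb C)\to\mathrm{GL}(E)$ with differential $\Psi':\mathfrak{gl}(n,\mathbb C)\to\mathrm{End}(E)$, the induced Lie--Vessiot system is $\frac{dv}{dx}=\Psi'(A(x))(v)$. A $\mathcal K$-rational solution is a solution $v(x)\in E\otimes_{\mathbb C}\mathcal K$. A $\mathcal K$-exponential pre-solution is an element $w(x)\in E\otimes_{\mathbb C}\mathcal K$ for which there is $b(x)\in\mathcal K$ with $\frac{dw}{dx}-\Psi'(A(x))(w)=-b(x)w$. For a non-singular point $x_0\in\mathcal U$, a matrix $\sigma\in\mathrm{GL}(n,\mathbb C)$ is Galoisian at $x_0$ if for every such representation $(E,\Psi)$: (a) $\Psi(\sigma)(v(x_0))=v(x_0)$ for every $\mathcal K$-rational solution $v(x)$ of the induced Lie--Vessiot system; (b) for every $\mathcal K$-exponential pre-solution $w(x)$ of the induced Lie--Vessiot system such that $w(x_0)$ is well defined, $\Psi(\sigma)(w(x_0))\in\mathbb C\,w(x_0)$. The Galoisian matrices at $x_0$ form the Galois group $\mathrm{Gal}(x_0,X)\subseteq\mathrm{GL}(n,\mathbb C)$. *)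

(* Defs.v *)
From mathcomp Require Import all_boot all_order all_algebra.
From mathcomp Require Import all_classical all_reals all_analysis.
From mathcomp Require Import complex.
From mathcomp Require mpoly.
Set Implicit Arguments.
Unset Strict Implicit.
Unset Printing Implicit Defensive.
Import Order.TTheory GRing.Theory Num.Theory.
Import numFieldNormedType.Exports.
Local Open Scope classical_set_scope.
Local Open Scope ring_scope.
Local Open Scope complex_scope.

(* [R[i]^o] is [R[i]] seen as a normed space over itself: the topology of the
   complex plane is attached to this alias. *)

Section Meromorphic.
Variable R : realType.

(* The Riemann sphere; [Some a] is the point x = a, [None] is infinity. *)
Definition CP1 : topologicalType := one_point_compactification R[i]^o.

(* x as a function of a local coordinate t centred at p: x = a + t at a finite
   point, x = 1/t at infinity.  Only the values at t != 0 are ever used, so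
   that x is finite. *)
Definition chart (p : CP1) (t : R[i]) : R[i] :=
  if p is Some a then a + t else t^-1.

(* [P] holds on U outside a closed discrete subset of U. *)
Definition generically (U : set CP1) (P : R[i] -> Prop) : Prop :=
  forall p, U p -> \forall t \near (0 : R[i]^o)^', P (chart p t).

(* Germs at t = 0 of functions defined for small t != 0.  [holo_germ] extends
   holomorphically to t = 0, [mero_germ] has at most a pole there, i.e. it has a
   convergent Laurent expansion with finite principal part. *)
Definition holo_germ (h : R[i] -> R[i]) : Prop :=
  exists c : nat -> R[i], \forall t \near (0 : R[i]^o)^',
    series (fun k => c k * t ^+ k : R[i]^o) @ \oo --> (h t : R[i]^o).

Definition mero_germ (h : R[i] -> R[i]) : Prop :=
  exists N : nat, holo_germ (fun t => t ^+ N * h t).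

(* A meromorphic function on U is represented by total functions of the affine
   coordinate, whose values at isolated points (in particular at poles) and
   outside U are irrelevant: two representatives define the same meromorphic
   function iff they agree generically on U. *)
Definition meromorphic (U : set CP1) (f : R[i] -> R[i]) : Prop :=
  forall p, U p -> mero_germ (fun t => f (chart p t)).

Definition has_value (f : R[i] -> R[i]) (p : CP1) (c : R[i]) : Prop :=
  (fun t : R[i]^o => f (chart p t) : R[i]^o) @ (0 : R[i]^o)^' --> (c : R[i]^o).

Definition ddx (f : R[i] -> R[i]) (x : R[i]) : R[i] :=
  derive1 (f : R[i] -> R[i]^o) x.

(* K is the set of all representatives of the elements of the function field;
   [0^-1 = 0], so closure under pointwise inverse is closure under inverses of
   nonzero meromorphic functions. *)
Record function_field (U : set CP1) (K : set (R[i] -> R[i])) : Prop := {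
  ff_mero : forall f, K f -> meromorphic U f;
  ff_eq : forall f g, K f -> generically U (fun x => f x = g x) -> K g;
  ff_const : forall c, K (fun _ => c);
  ff_sub : forall f g, K f -> K g -> K (fun x => f x - g x);
  ff_mul : forall f g, K f -> K g -> K (fun x => f x * g x);
  ff_inv : forall f, K f -> K (fun x => (f x)^-1);
  ff_ddx : forall f, K f -> K (ddx f) }.

Definition mx_over (K : set (R[i] -> R[i])) p q (M : R[i] -> 'M[R[i]]_(p, q)) :=
  forall i j, K (fun x => M x i j).

Definition mx_ddx p q (M : R[i] -> 'M[R[i]]_(p, q)) (x : R[i]) :
  'M[R[i]]_(p, q) := \matrix_(i, j) ddx (fun z => M z i j) x.

Definition mx_has_value p q (M : R[i] -> 'M[R[i]]_(p, q)) (x0 : CP1)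
  (M0 : 'M[R[i]]_(p, q)) : Prop :=
  forall i j, has_value (fun x => M x i j) x0 (M0 i j).

End Meromorphic.

Section System.
Variables (R : realType) (n : nat).
Implicit Types (A B : R[i] -> 'M[R[i]]_n) (U : set (CP1 R)).

(* Coefficient matrix of dy/dx = A y rewritten in the local coordinate t at p;
   at infinity dx = - dt / t^2. *)
Definition local_system A (p : CP1 R) (t : R[i]) : 'M[R[i]]_n :=
  if p is Some a then A (a + t) else - (t ^- 2) *: A t^-1.

Definition nonsingular U A (p : CP1 R) : Prop :=
  U p /\ forall i j, holo_germ (fun t => local_system A p t i j).

(* Vector fields on (an open subset of) C x C^n, by their components along
   d/dx and (d/dy_1, ..., d/dy_n). *)
Definition vfield := R[i] -> 'cV[R[i]]_n -> R[i] * 'cV[R[i]]_n.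

Definition vf_apply (Z : vfield) (g : R[i] -> 'cV[R[i]]_n -> R[i])
    (x : R[i]) (y : 'cV[R[i]]_n) : R[i] :=
  ddx (fun s => g (x + s * (Z x y).1) (y + s *: (Z x y).2)) 0.

Definition lie_bracket (Z W : vfield) : vfield := fun x y =>
  (vf_apply Z (fun a b => (W a b).1) x y - vf_apply W (fun a b => (Z a b).1) x y,
   \col_i (vf_apply Z (fun a b => (W a b).2 i 0) x y
           - vf_apply W (fun a b => (Z a b).2 i 0) x y)).

Definition system_vf A : vfield := fun x y => (1, A x *m y).
Definition linear_vf B : vfield := fun x y => (0, B x *m y).

Definition linear_symmetry U (K : set (R[i] -> R[i])) A B : Prop :=
  mx_over K B /\
  generically U
    (fun x => forall y, lie_bracket (system_vf A) (linear_vf B) x y = (0, 0)).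

(* B satisfies B' = [A, B], so its Jordan form is the same at all points where it
   is defined; the poles of B and irrelevant values of the representative are
   excluded by [generically]. *)
Definition complete_decomposer U B : Prop :=
  generically U (fun x => exists l : 'I_n -> R[i],
    injective l /\ forall i, eigenvalue (B x) (l i)).

(* Algebraic representations GL(n) -> GL(E) with E = C^m; the values of [Psi]
   on non-invertible matrices are irrelevant.  The matrix entries of [Psi g] are
   polynomials in the entries of g and 1 / det g. *)
Definition algebraic_rep m (Psi : 'M[R[i]]_n -> 'M[R[i]]_m) : Prop :=
  [/\ Psi 1%:M = 1%:M,
      forall g h, g \in unitmx -> h \in unitmx -> Psi (g *m h) = Psi g *m Psi h
    & forall i j, exists (p : mpoly.mpoly (n * n) R[i]) (k : nat),
        forall g, g \in unitmx ->
          Psi g i j = mpoly.meval (fun l => mxvec g 0 l) p / (\det g) ^+ k].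

(* Differential of Psi at the identity, evaluated at a. *)
Definition rep_diff m (Psi : 'M[R[i]]_n -> 'M[R[i]]_m) (a : 'M[R[i]]_n) :
  'M[R[i]]_m := mx_ddx (fun s => Psi (1%:M + s *: a)) 0.

Section Galois.
Variables (U : set (CP1 R)) (K : set (R[i] -> R[i])) (A : R[i] -> 'M[R[i]]_n).

Definition rational_solution m (Psi : 'M[R[i]]_n -> 'M[R[i]]_m)
    (v : R[i] -> 'cV[R[i]]_m) : Prop :=
  mx_over K v /\ generically U (fun x => mx_ddx v x = rep_diff Psi (A x) *m v x).

Definition exponential_presolution m (Psi : 'M[R[i]]_n -> 'M[R[i]]_m)
    (w : R[i] -> 'cV[R[i]]_m) : Prop :=
  mx_over K w /\ exists b, K b /\
    generically U
      (fun x => mx_ddx w x - rep_diff Psi (A x) *m w x = - b x *: w x).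

Definition Gal (x0 : CP1 R) : set 'M[R[i]]_n := [set sigma |
  sigma \in unitmx /\
  forall m (Psi : 'M[R[i]]_n -> 'M[R[i]]_m), algebraic_rep Psi ->
    (forall v v0, rational_solution Psi v -> mx_has_value v x0 v0 ->
       Psi sigma *m v0 = v0) /\
    (forall w w0, exponential_presolution Psi w -> mx_has_value w x0 w0 ->
       exists c, Psi sigma *m w0 = c *: w0)].

End Galois.
End System.

(* Main.v *)
Require Import Defs.
From HB Require Import structures.
From mathcomp Require Import all_boot all_order all_algebra all_fingroup.
From mathcomp Require Import all_classical all_reals all_analysis.
From mathcomp Require Import complex ring.
From mathcomp Require mpoly.
Import -(notations) mpoly.
Set Implicit Arguments.
Unset Strict Implicit.
Unset Printing Implicit Defensive.
Import Order.TTheory GRing.Theory Num.Theory.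
Import numFieldNormedType.Exports.
Local Open Scope classical_set_scope.
Local Open Scope ring_scope.

(** Let F be the fundamental matrix of the system at x0 with value 1 there, and let M
    be the field of germs at x0 of meromorphic functions, with the derivation d/dx;
    it contains the germs of K and the entries of F. A matrix B of germs satisfies
    B' = [A, B] if and only if B = F B0 F^-1 for a constant matrix B0, which is the
    value of B at x0 ([symmetry_conjugate], [conjugate_symmetry]).

    From a symmetry to the Galois group ([conjugate_of_symmetry]): a symmetry B, seen
    as a vector, is a rational solution of the system induced by the adjoint
    representation, so its value B0 at x0 is fixed by the conjugation by Galoisian
    matrices. If the eigenvalues of B are distinct, so are those of B0, and a matrix
    that commutes with B0 is diagonal in a basis of eigenvectors of B0.

    From the Galois group to a symmetry ([symmetry_of_conjugate]): let B0 have distinct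
    eigenvalues and be diagonal in the given basis, so that all Galoisian matrices
    commute with it. It is enough to show that the entries of B = F B0 F^-1 are in K;
    the identity theorem on the connected set U then extends to U the equation
    B' = [A, B] and the eigenvalues, known near x0. This is an instance of the Galois
    correspondence. Let G be the group of the invertible constant matrices s such that
    F s satisfies all the polynomial relations over K between the entries of F.

    - G consists of Galoisian matrices ([galois_rational], [galois_exponential]):
      a rational solution of an induced system is Psi(F) u with u constant, an
      exponential presolution is proportional to such a vector, and these facts are
      polynomial relations between the entries of F. So G commutes with B0.
    - After the substitution X = F Z, the M-span of the polynomial relations is stable
      under the derivation of coefficients, because F' = A F. Hence it is spanned by
      polynomials with constant coefficients ([stable_subspace_const]), whose
      invertible zeros are in G ([zero_galois_ideal]). By the Nullstellensatz the
      entries of det Z (Z B0 - B0 Z) are in the radical of the ideal of these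
      polynomials. The Nullstellensatz follows from a cardinality argument, because
      the complex numbers are uncountable ([nullstellensatz]).
    - Back in the variables X, each entry b of B has the following property: there are
      polynomials u and w over K with u(F) = b w(F), w(F) != 0, and a power of u - b w in
      the M-span of relations. Applying to the latter the K-linear functionals from M
      to K shows that b generates no proper extension of K, in characteristic zero
      ([functional_nilpotent], [mem_subfield_of_power]).

    The analysis is done with power series whose coefficients and remainders satisfy
    explicit geometric bounds ([expands]). They give the local solution F
    ([linear_system_solution]), the field of germs, and the isolation of zeros on which
    the identity theorem relies. *)

Local Notation "'Xv_ i" := (mpolyX _ (mnm1 i)) (at level 8, i at level 2).

(** * The Nullstellensatz over an uncountable field *)

Section Ideals.
Variable P : comNzRingType.
Implicit Types (I : set P) (h x : P).

Definition ideal I :=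
  [/\ I 0, forall p q, I p -> I q -> I (p + q) & forall p q, I q -> I (p * q)].

(** Equivalently, h is not in the radical of I. *)
Definition avoids I h := forall k, ~ I (h ^+ k).

Definition adjoin I x : set P := [set p | exists2 q, I q & exists r, p = q + r * x].

Lemma ideal_sum I (T : Type) (s : seq T) (Q : pred T) (f : T -> P) :
  ideal I -> (forall i, Q i -> I (f i)) -> I (\sum_(i <- s | Q i) f i).
Proof. by case=> I0 ID _ If; apply: big_ind. Qed.

Lemma ideal_adjoin I x : ideal I -> ideal (adjoin I x).
Proof.
case=> I0 ID IM; split.
- by exists 0 => //; exists 0; rewrite mul0r addr0.
- move=> p q [p1 Ip [rp ->]] [q1 Iq [rq ->]].
  exists (p1 + q1); first exact: ID.
  by exists (rp + rq); rewrite mulrDl addrACA.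
- move=> p q [q1 Iq [rq ->]]; exists (p * q1); first exact: IM.
  by exists (p * rq); rewrite mulrDr mulrA.
Qed.

Lemma sub_adjoin I x : I `<=` adjoin I x.
Proof. by move=> p Ip; exists p => //; exists 0; rewrite mul0r addr0. Qed.

Lemma mem_adjoin I x : ideal I -> adjoin I x x.
Proof. by case=> I0 _ _; exists 0 => //; exists 1; rewrite mul1r add0r. Qed.

Definition radical I : set P := [set p | exists k, I (p ^+ k)].

Lemma ideal_radical I : ideal I -> ideal (radical I).
Proof.
move=> idI; have [I0 ID IM] := idI; split; first by exists 1%N; rewrite expr1.
- move=> p q [k Ip] [l Iq]; exists (k + l)%N; rewrite exprDn.
  apply: ideal_sum => // i _; rewrite -mulr_natl; apply: (IM).
  have [ki|ik] := leqP l i.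
    by apply: (IM); rewrite -(subnK ki) exprD; apply: (IM).
  have kkl : (k <= k + l - i)%N by rewrite -addnBA 1?leq_addr // ltnW.
  rewrite mulrC; apply: (IM).
  by rewrite -(subnK kkl) exprD; apply: (IM).
- by move=> p q [k Iq]; exists k; rewrite exprMn; apply: (IM).
Qed.

End Ideals.

Section Nullstellensatz.
Variables (C : closedFieldType) (n : nat).
Local Notation P := (mpoly n C).
Implicit Types (I : set P) (h x : P).

Local Notation evp p x := ((map_poly (@mpolyC n C) p).[x]).

(** Polynomials of degree less than d have as many coefficients as there are
    monomials of degree less than d. *)
Lemma bounded_mpoly_dependent d (s : seq C) (q : C -> P) :
  (forall c, c \in s -> msize (q c) <= d)%N ->
  (#|{: bmultinom n d}| < size s)%N ->
  exists a : 'I_(size s) -> C, (exists i, a i != 0) /\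
    \sum_i a i *: q s`_i = 0.
Proof.
move=> qd sN; pose M := \matrix_(i < size s, j < #|{: bmultinom n d}|)
  mcoeff (bmnm (enum_val j)) (q s`_i).
have : kermx M != 0.
  rewrite kermx_eq0 /row_free; apply: contraTneq sN => <-.
  by rewrite -leqNgt rank_leq_col.
case/rowV0Pn=> v /sub_kermxP vM v0.
exists (fun i => v 0 i); split.
  apply/existsP; apply: contra_neqT v0 => /existsPn v0.
  by apply/rowP => i; rewrite mxE; apply/eqP; have := v0 i; rewrite negbK.
apply/mpolyP => m; rewrite mcoeff0 raddf_sum /=.
have [md|dm] := ltnP (mdeg m) d; last first.
  rewrite big1 // => i _; rewrite mcoeffZ memN_msupp_eq0 ?mulr0 //.
  apply: msize_mdeg_ge; apply: leq_trans dm; apply: qd; exact: mem_nth.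
move/rowP/(_ (enum_rank (BMultinom md))): vM; rewrite !mxE => vM.
rewrite -[RHS]vM; by apply: eq_bigr => i _; rewrite !mxE enum_rankK mcoeffZ.
Qed.

(** Modulo I, each factor x - r divides a power of h, so that the factors can be
    traded one by one for powers of h. *)
Lemma prod_roots_in_ideal I h x (s : seq C) (k : C -> nat) (q : C -> P) a :
  ideal I -> (forall c, I (h ^+ k c - q c * (x - mpolyC n c))) ->
  I (h ^+ a * \prod_(r <- s) (x - mpolyC n r)) -> exists b, I (h ^+ b).
Proof.
move=> [I0 ID IM] Iq; elim: s a => [|r s IHs] a.
  by rewrite big_nil mulr1; exists a.
rewrite big_cons => Ia; apply: (IHs (a + k r)%N).
set w := \prod_(j <- s) _ in Ia *.
have -> : h ^+ (a + k r) * w =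
    (h ^+ a * w) * (h ^+ k r - q r * (x - mpolyC n r))
    + q r * (h ^+ a * ((x - mpolyC n r) * w)) by rewrite exprD; ring.
by apply: (ID); apply: (IM).
Qed.

(** If no c works, then for each c the element x - c divides a power h ^ k of h
    modulo I, with some cofactor q. There are uncountably many c and countably
    many pairs (k, degree of q), so infinitely many c share the same pair; their
    cofactors live in a finite-dimensional space, so some of them are linearly
    dependent. Clearing the denominators x - c in this dependency gives a nonzero
    polynomial f in one variable with h ^ k * f(x) in I; f splits into linear
    factors, and [prod_roots_in_ideal] puts a power of h in I. *)
Lemma adjoin_point I h x : ~ countable [set: C] -> ideal I -> avoids I h ->
  exists c, avoids (adjoin I (x - mpolyC n c)) h.
Proof.
move=> Cunc idI avI; apply: contrapT => noc.
have [I0 ID IM] := idI.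
have [k kP] : {k : C -> nat & forall c, exists q, I (h ^+ k c - q * (x - mpolyC n c))}.
  apply: (@choice _ _ (fun c k => exists q, I (h ^+ k - q * (x - mpolyC n c)))) => c.
  apply: contrapT => nk; apply: noc; exists c => k [p Ip [r hk]].
  by apply: nk; exists k, r; rewrite hk addrK.
have [q qP] := choice kP.
have [kd inf] : exists kd : nat * nat,
    infinite_set [set c | k c = kd.1 /\ (msize (q c) <= kd.2)%N].
  apply: contrapT => fin; apply: Cunc.
  have -> : [set: C] = \bigcup_(kd in [set: nat * nat])
      [set c | k c = kd.1 /\ (msize (q c) <= kd.2)%N].
    by apply/seteqP; split=> // c _; exists (k c, msize (q c)).
  apply: bigcup_countable => [|kd _]; first exact: countableP.
  apply: finite_set_countable; apply: contrapT => inf.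
  by apply: fin; exists kd.
case: kd inf => k0 d /= inf.
have [B BA BN] := infinite_set_fset #|{: bmultinom n d}|.+1 inf.
pose s : seq C := finmap.enum_fset B.
have us : uniq s by exact: finmap.fset_uniq.
have sA c : c \in s -> k c = k0 /\ (msize (q c) <= d)%N by move=> cs; exact: BA.
have [a [[i0 ai0] aq]] : exists a : 'I_(size s) -> C, (exists i, a i != 0) /\
    \sum_i a i *: q s`_i = 0.
  by apply: (@bounded_mpoly_dependent d) => [c /sA[]|].
(* a i / (x - s_i) summed over i, times the product of the x - s_j *)
pose f : {poly C} := \sum_i a i *: \prod_(j < size s | j != i) ('X - (s`_j)%:P).
have f0 : f != 0.
  apply: contra_neq ai0 => f0.
  have : f.[s`_i0] = 0 by rewrite f0 horner0.
  rewrite horner_sum (bigD1 i0) //= [X in _ + X]big1 => [|i ii0]; last first.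
    rewrite hornerZ (bigD1 i0) 1?eq_sym //= hornerM hornerXsubC subrr mul0r.
    by rewrite mulr0.
  rewrite addr0 hornerZ => /eqP; rewrite mulf_eq0 => /orP[/eqP //|].
  rewrite horner_prod prodf_seq_eq0 => /hasP[j _] /andP[ji0].
  by rewrite hornerXsubC subr_eq0 nth_uniq // => /eqP/val_inj/esym/eqP; rewrite (negPf ji0).
have evf : evp f x =
    \sum_i a i *: \prod_(j < size s | j != i) (x - mpolyC n s`_j).
  rewrite rmorph_sum horner_sum; apply: eq_bigr => i _ /=.
  rewrite map_polyZ hornerZ mul_mpolyC rmorph_prod horner_prod; congr (_ *: _).
  by apply: eq_bigr => j _; rewrite /= rmorphB /= map_polyX map_polyC /= hornerXsubC.
have If : I (h ^+ k0 * evp f x).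
  have -> : h ^+ k0 * evp f x = \sum_i (a i *: \prod_(j < size s | j != i) (x - mpolyC n s`_j)) *
      (h ^+ k (s`_i) - q s`_i * (x - mpolyC n s`_i)).
    transitivity (h ^+ k0 * evp f x - (\prod_(j < size s) (x - mpolyC n s`_j))
       * \sum_i a i *: q s`_i); first by rewrite aq mulr0 subr0.
    rewrite evf mulr_sumr [X in _ - X]mulr_sumr -sumrB; apply: eq_bigr => i _.
    have [-> _] := sA _ (mem_nth 0 (ltn_ord i)).
    rewrite [X in _ - X * _](bigD1 i) //= -!mul_mpolyC; ring.
  by apply: ideal_sum => // i _; apply: (IM); apply: qP.
have [r fr] := closed_field_poly_normal f.
have : I (h ^+ k0 * \prod_(c <- r) (x - mpolyC n c)).
  have -> : h ^+ k0 * \prod_(c <- r) (x - mpolyC n c) =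
      mpolyC n (lead_coef f)^-1 * (h ^+ k0 * evp f x).
    rewrite [in evp f x]fr map_polyZ hornerZ rmorph_prod horner_prod mulrCA.
    rewrite [X in _ = _ * X]mulrA -mpolyCM mulVf ?lead_coef_eq0 // mpolyC1 mul1r.
    congr (_ * _).
    by apply: eq_bigr => j _; rewrite /= rmorphB /= map_polyX map_polyC /= hornerXsubC.
  exact: IM.
by move=> /(prod_roots_in_ideal idI qP)[b Ib]; apply: (avI b).
Qed.

Lemma sub_meval_in_ideal I (v : 'I_n -> C) (p : P) : ideal I ->
  (forall i, I ('Xv_i - mpolyC n (v i))) -> I (p - mpolyC n (meval v p)).
Proof.
move=> [I0 ID IM] Iv.
have prodI (p1 q1 : P) : I (p1 - mpolyC n (meval v p1)) ->
    I (q1 - mpolyC n (meval v q1)) -> I (p1 * q1 - mpolyC n (meval v (p1 * q1))).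
  move=> Ip Iq; rewrite mevalM mpolyCM.
  have -> : p1 * q1 - mpolyC n (meval v p1) * mpolyC n (meval v q1)
     = p1 * (q1 - mpolyC n (meval v q1))
       + mpolyC n (meval v q1) * (p1 - mpolyC n (meval v p1)) by ring.
  by apply: (ID); apply: (IM).
have cI c : I (mpolyC n c - mpolyC n (meval v (mpolyC n c))).
  by rewrite mevalC subrr.
elim/mpolyind: p => [|c m p _ _ IHp]; first by rewrite meval0 mpolyC0 subrr.
rewrite mevalD mpolyCD opprD addrACA; apply: (ID) => //.
rewrite -mul_mpolyC; apply: (prodI); first exact: cI.
rewrite mpolyXE_id; apply: (big_ind (fun r => I (r - mpolyC n (meval v r)))) => //.
  by rewrite -mpolyC1; apply: cI.
move=> i _; elim: (m i) => [|k IHk]; first by rewrite expr0 -mpolyC1; apply: cI.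
by rewrite exprS; apply: (prodI) => //; rewrite mevalXU; apply: Iv.
Qed.

(** Giving a value to the variables one after the other by [adjoin_point] leads
    to an ideal that still avoids h and contains all the X_i - v_i; such an ideal
    is the ideal of the point v. *)
Theorem nullstellensatz I h : ~ countable [set: C] -> ideal I -> avoids I h ->
  exists v : 'I_n -> C, (forall p, I p -> meval v p = 0) /\ meval v h != 0.
Proof.
move=> Cunc idI avI.
have [J [idJ avJ IJ JX]] : exists J, [/\ ideal J, avoids J h, I `<=` J &
    forall i, i \in enum 'I_n -> exists c, J ('Xv_i - mpolyC n c)].
  elim: (enum 'I_n) => [|i s [J [idJ avJ IJ JX]]]; first by exists I; split.
  have [c avc] := adjoin_point 'Xv_i Cunc idJ avJ.
  exists (adjoin J ('Xv_i - mpolyC n c)); split => //.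
  - exact: ideal_adjoin.
  - exact: subset_trans IJ (@sub_adjoin _ _ _).
  - move=> j; rewrite inE => /orP[/eqP ->|/JX[c' Jc']].
      by exists c; apply: mem_adjoin.
    by exists c'; apply: sub_adjoin.
have JX' i : exists c, J ('Xv_i - mpolyC n c) by apply: JX; rewrite mem_enum.
have [v vP] := choice JX'.
have [J0 JD JM] := idJ.
have Jev p : J p -> meval v p = 0.
  move=> Jp; apply/eqP; apply: contrapT => /negP ev0; apply: (avJ 0%N).
  have Jc : J (mpolyC n (meval v p)).
    have -> : mpolyC n (meval v p) = p + (-1) * (p - mpolyC n (meval v p)) by ring.
    by apply: (JD) => //; apply: (JM); apply: sub_meval_in_ideal.
  have := JM (mpolyC n (meval v p)^-1) _ Jc.
  by rewrite -mpolyCM mulVf // mpolyC1 expr0.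
exists v; split=> [p /IJ/Jev //|]; apply/eqP => h0; apply: (avJ 1%N).
by rewrite expr1; have := sub_meval_in_ideal h idJ vP; rewrite h0 mpolyC0 subr0.
Qed.

End Nullstellensatz.

(** * Subfields and their linear functionals *)

Section Subfields.
Variables (M : fieldType) (K : set M).

Record subfield : Prop := {
  sf1 : K 1;
  sfB : forall x y, K x -> K y -> K (x - y);
  sfM : forall x y, K x -> K y -> K (x * y);
  sfV : forall x, K x -> K x^-1 }.

Hypothesis Ksf : subfield.

Lemma sf0 : K 0.
Proof. by rewrite -(subrr 1); apply: (sfB Ksf) => //; apply: (sf1 Ksf). Qed.

Lemma sfN x : K x -> K (- x).
Proof. by move=> Kx; rewrite -sub0r; apply: (sfB Ksf) => //; apply: sf0. Qed.

Lemma sfD x y : K x -> K y -> K (x + y).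
Proof. by move=> Kx Ky; rewrite -[y]opprK; apply: (sfB Ksf) => //; apply: sfN. Qed.

Lemma sf_sum (T : Type) (s : seq T) (Q : pred T) (f : T -> M) :
  (forall i, Q i -> K (f i)) -> K (\sum_(i <- s | Q i) f i).
Proof. by move=> Kf; apply: big_ind => //; [exact: sf0|exact: sfD]. Qed.

Lemma sf_nat n : K n%:R.
Proof. by elim: n => [|n IHn]; [exact: sf0|rewrite -natr1; apply: sfD => //; apply: (sf1 Ksf)]. Qed.

Record functional (phi : M -> M) : Prop := {
  fl_K : forall x, K (phi x);
  flD : forall x y, phi (x + y) = phi x + phi y;
  flZ : forall k x, K k -> phi (k * x) = k * phi x }.

Lemma fl0 phi : functional phi -> phi 0 = 0.
Proof. by move=> fphi; rewrite -[in LHS](mul0r 0) flZ ?mul0r //; exact: sf0. Qed.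

Lemma fl_sum phi (T : Type) (s : seq T) (Q : pred T) (f : T -> M) :
  functional phi -> phi (\sum_(i <- s | Q i) f i) = \sum_(i <- s | Q i) phi (f i).
Proof.
move=> fphi; elim/big_rec2: _ => [|i y1 y2 _ <-]; first exact: fl0.
exact: flD.
Qed.

(** M is the direct sum of the line K x and of a maximal K-subspace W that does not
    contain x. *)
Lemma functional_exists x : x != 0 -> exists2 phi, functional phi & phi x = 1.
Proof.
move=> x0.
pose sub W := [/\ forall u v, W u -> W v -> W (u - v),
  forall k u, K k -> W u -> W (k * u) & ~ W x : Prop].
have [W [[WB WZ Wx] Wmax]] : exists W : set M, sub W /\
    forall V, W `<` V -> ~ sub V.
  apply: (@Zorn_bigcup M sub) => F Fsub Ftot; split.
  - move=> u v [U FU Uu] [V FV Vv].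
    have [UV|VU] := Ftot _ _ FU FV.
      by exists V => //; have [VB _ _] := Fsub _ FV; apply: VB => //; apply: UV.
    by exists U => //; have [UB _ _] := Fsub _ FU; apply: UB => //; apply: VU.
  - move=> k u Kk [U FU Uu]; exists U => //.
    by have [_ UZ _] := Fsub _ FU; apply: UZ.
  - by move=> [U FU Ux]; have [_ _] := Fsub _ FU; apply.
have W0 : W 0.
  apply: contrapT => W0; apply: (Wmax [set 0]); last first.
    split=> [u v -> ->|k u _ ->|/eqP]; rewrite ?subrr ?mulr0 //.
    by rewrite (negPf x0).
  split=> [u Wu|/(_ 0 erefl)//].
  by exfalso; apply: W0; rewrite -(subrr u); apply: WB.
have WD u v : W u -> W v -> W (u + v).
  by move=> Wu Wv; rewrite -[v]opprK -[- v]sub0r; do 2?apply: (WB).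
have decomp y : exists k, K k /\ W (y - k * x).
  apply: contrapT => nk; pose V := [set z | exists2 w, W w & exists2 k, K k & z = w + k * y].
  apply: (Wmax V); first split.
  - by move=> u Wu; exists u => //; exists 0; rewrite ?mul0r ?addr0 //; exact: sf0.
  - move=> VW; apply: nk; exists 0; split; first exact: sf0.
    rewrite mul0r subr0; apply: VW; exists 0 => //; exists 1; first exact: (sf1 Ksf).
    by rewrite mul1r add0r.
  - split.
    + move=> _ _ [w1 W1 [k1 K1 ->]] [w2 W2 [k2 K2 ->]].
      exists (w1 - w2); first exact: WB.
      by exists (k1 - k2); [exact: (sfB Ksf)|rewrite mulrBl opprD addrACA].
    + move=> k _ Kk [w Ww [l Kl ->]]; exists (k * w); first exact: WZ.
      by exists (k * l); [exact: (sfM Ksf)|rewrite mulrDr mulrA].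
    + move=> [w Ww [k Kk xE]]; apply: nk; exists k^-1; split; first exact: (sfV Ksf).
      have k0 : k != 0.
        by apply: contra_notN Wx => /eqP k0; rewrite xE k0 mul0r addr0.
      have -> : y - k^-1 * x = (- k^-1) * w.
        by rewrite xE mulrDr mulrA mulVf // mul1r; ring.
      by apply: WZ => //; apply: sfN; apply: (sfV Ksf).
have [phi phiP] := choice decomp.
have phi_uniq y k : K k -> W (y - k * x) -> phi y = k.
  move=> Kk Wk; have [Kp Wp] := phiP y; apply/eqP; rewrite -subr_eq0.
  apply: contra_notT Wx => d0.
  have -> : x = (phi y - k)^-1 * ((y - k * x) - (y - phi y * x)).
    have -> : (y - k * x) - (y - phi y * x) = (phi y - k) * x by ring.
    by rewrite mulrA mulVf // mul1r.
  by apply: WZ; [apply: (sfV Ksf); exact: (sfB Ksf)|exact: WB].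
exists phi; last by apply: phi_uniq; [exact: (sf1 Ksf)|rewrite mul1r subrr].
split=> [y|y z|k y Kk]; first by have [] := phiP y.
- have [Ky Wy] := phiP y; have [Kz Wz] := phiP z.
  apply: phi_uniq; first exact: sfD.
  have -> : y + z - (phi y + phi z) * x = (y - phi y * x) + (z - phi z * x) by ring.
  exact: WD.
- have [Ky Wy] := phiP y; apply: phi_uniq; first exact: (sfM Ksf).
  by rewrite -mulrA -mulrBr; apply: WZ.
Qed.

Definition polyK (p : {poly M}) := forall i, K p`_i.

Lemma polyK_mul_map phi p q : functional phi -> polyK q ->
  map_poly phi (p * q) = map_poly phi p * q.
Proof.
move=> fphi Kq; apply/polyP => i.
rewrite coef_map_id0 ?fl0 // coefM fl_sum // coefM; apply: eq_bigr => j _.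
by rewrite mulrC flZ // mulrC coef_map_id0 ?fl0.
Qed.

Lemma map_polyB_functional phi p q : functional phi ->
  map_poly phi (p - q) = map_poly phi p - map_poly phi q.
Proof.
move=> fphi; apply/polyP => i; rewrite coefB !coef_map_id0 ?fl0 // coefB flD //.
by rewrite -mulN1r flZ ?mulN1r //; apply: sfN; exact: (sf1 Ksf).
Qed.

(** Let mu be a monic polynomial over K of least degree vanishing at b; there is one,
    since a functional phi with phi 1 = 1 turns (T - b) ^ N into a nonzero polynomial
    over K. Let r be the remainder of (T - b) ^ N by mu. For each functional phi, applying phi to the
    coefficients of r gives a polynomial over K that vanishes at b and has degree
    less than mu, hence is zero; so r = 0. Thus mu divides (T - b) ^ N and is a
    power (T - b) ^ k, whose coefficient - k b of degree k - 1 is in K. *)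
Lemma mem_subfield_of_power b N : [pchar M] =i pred0 ->
  (forall phi, functional phi -> (map_poly phi (('X - b%:P) ^+ N)).[b] = 0) ->
  K b.
Proof.
move=> char0 phib.
have monN : ('X - b%:P) ^+ N \is monic by rewrite monic_exp ?monicXsubC.
have [phi1 fphi1 phi11] := functional_exists (oner_neq0 M).
pose root_size d := `[< exists2 p, polyK p & [/\ p != 0, root p b & size p = d] >].
have exd : exists d, root_size d.
  pose f := map_poly phi1 (('X - b%:P) ^+ N).
  exists (size f); apply/asboolP; exists f.
    by move=> i; rewrite /f coef_map_id0 ?fl0 //; exact: fl_K.
  split=> //; last by rewrite /root /f phib.
  apply: contra_neq (oner_neq0 M) => /polyP/(_ N).
  rewrite coef0 coef_map_id0 ?fl0 //.
  by have := monicP monN; rewrite lead_coefE size_exp_XsubC /= => ->; rewrite phi11.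
case: (ex_minnP exd) => d /asboolP[p0 Kp0 [p00 p0b sp0]] dmin.
pose mu := (lead_coef p0)^-1 *: p0.
have l0 : (lead_coef p0)^-1 != 0 by rewrite invr_eq0 lead_coef_eq0.
have Kmu : polyK mu.
  by move=> i; rewrite coefZ; apply: (sfM Ksf) => //; apply: (sfV Ksf); exact: Kp0.
have mu_monic : mu \is monic by rewrite monicE lead_coefZ mulVf ?lead_coef_eq0.
have mub : mu.[b] = 0 by rewrite hornerZ (rootP p0b) mulr0.
have smu : size mu = d by rewrite size_scale.
pose r := ('X - b%:P) ^+ N %% mu.
have r0 : r = 0.
  apply/polyP => i; rewrite coef0; apply/eqP; apply: contrapT => /negP ri0.
  have [phi fphi phir] := functional_exists ri0.
  have rE : r = ('X - b%:P) ^+ N - ('X - b%:P) ^+ N %/ mu * mu.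
    by rewrite [X in _ = X - _](divp_eq _ mu) addrAC subrr add0r.
  have phir0 : map_poly phi r != 0.
    apply: contra_neq (oner_neq0 M) => /polyP/(_ i).
    by rewrite coef0 coef_map_id0 ?fl0 // phir.
  have : (d <= size (map_poly phi r))%N.
    apply: dmin; apply/asboolP; exists (map_poly phi r).
      by move=> j; rewrite coef_map_id0 ?fl0 //; exact: fl_K.
    split=> //; rewrite /root {1}rE map_polyB_functional // polyK_mul_map //.
    by rewrite hornerD hornerN hornerM mub mulr0 subr0 phib.
  rewrite leqNgt => /negP; apply; apply: leq_ltn_trans (size_poly _ _) _.
  by rewrite -smu ltn_modp -size_poly_gt0 smu -sp0 size_poly_gt0.
have /dvdp_exp_XsubCP[k _] : mu %| ('X - b%:P) ^+ N by rewrite /dvdp -/r r0.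
rewrite eqp_monic ?monic_exp ?monicXsubC // => /eqP muE.
have k0 : k != 0%N.
  by apply: contra_eq_neq mub => k0; rewrite muE k0 expr0 hornerC oner_neq0.
have := Kmu k.-1; rewrite muE.
have -> : ('X - b%:P) ^+ k = \prod_(c <- nseq k b) ('X - c%:P).
  by rewrite big_nseq iter_mulr_1.
have := @coefPn_prod_XsubC _ (nseq k b); rewrite size_nseq => /(_ k0) ->.
rewrite big_nseq iter_addr_0 => Kb.
have kR : k%:R != 0 :> M by move/pcharf0P: char0 => ->.
have -> : b = - (k%:R)^-1 * - (b *+ k) by rewrite mulrNN -[b *+ k]mulr_natl mulKf.
by apply: (sfM Ksf) => //; apply: sfN; apply: (sfV Ksf); exact: sf_nat.
Qed.
End Subfields.

(** * Derivations and stable spaces of polynomials *)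

Section Derivations.
Variables (C M : fieldType) (iota : {rmorphism C -> M}) (d : M -> M).

Record derivation : Prop := {
  dD : forall x y, d (x + y) = d x + d y;
  dM : forall x y, d (x * y) = d x * y + x * d y;
  d_const : forall x, d x = 0 <-> exists c, x = iota c }.

Hypothesis dP : derivation.

Lemma d_iota c : d (iota c) = 0.
Proof. by apply: (proj2 (d_const dP _)); exists c. Qed.

Lemma d0 : d 0 = 0.
Proof. by rewrite -[in LHS](rmorph0 iota) d_iota. Qed.

Lemma d1 : d 1 = 0.
Proof. by rewrite -[in LHS](rmorph1 iota) d_iota. Qed.

Lemma d_sum (T : Type) (s : seq T) (Q : pred T) (f : T -> M) :
  d (\sum_(i <- s | Q i) f i) = \sum_(i <- s | Q i) d (f i).
Proof. by elim/big_rec2: _ => [|i y1 y2 _ <-]; [exact: d0|exact: (dD dP)]. Qed.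

Lemma d_ratio b y z : y != 0 -> d y = - b * y -> d z = - b * z -> d (y^-1 * z) = 0.
Proof.
move=> y0 dy dz; have dV : d y^-1 = b * y^-1.
  have := d1; rewrite -(mulVf y0) (dM dP) dy => /eqP.
  by rewrite addr_eq0 => /eqP E; apply: (mulIf y0); rewrite E; ring.
by rewrite (dM dP) dV dz; ring.
Qed.

Lemma d_mulmx p q r (X : 'M[M]_(p, q)) (Y : 'M[M]_(q, r)) :
  map_mx d (X *m Y) = map_mx d X *m Y + X *m map_mx d Y.
Proof.
apply/matrixP => i j; rewrite !mxE d_sum -big_split; apply: eq_bigr => k _.
by rewrite /= !mxE (dM dP).
Qed.

Lemma mx_const p q (X : 'M[M]_(p, q)) : map_mx d X = 0 ->
  exists X0, X = map_mx iota X0.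
Proof.
move=> X0; have /choice[f fP] i : exists r, forall j, X i j = iota (r j).
  have h j : exists c, X i j = iota c.
    by apply: (proj1 (d_const dP _)); move/matrixP/(_ i j): X0; rewrite !mxE.
  by have [f fP] := choice h; exists f.
by exists (\matrix_(i, j) f i j); apply/matrixP => i j; rewrite !mxE fP.
Qed.

Variable n : nat.
Local Notation P := (mpoly n M).

Definition coefwise_deriv (p q : P) := forall m, mcoeff m q = d (mcoeff m p).

Lemma coefwise_derivD p p' q q' : coefwise_deriv p p' -> coefwise_deriv q q' ->
  coefwise_deriv (p + q) (p' + q').
Proof. by move=> pp qq m; rewrite !mcoeffD pp qq (dD dP). Qed.

Lemma coefwise_derivM p p' q q' : coefwise_deriv p p' -> coefwise_deriv q q' ->
  coefwise_deriv (p * q) (p' * q + p * q').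
Proof.
move=> pp qq m.
rewrite mcoeffD !mcoeffM d_sum -big_split; apply: eq_bigr => k _ /=.
by rewrite pp qq (dM dP).
Qed.

Lemma coefwise_derivZ c p p' : coefwise_deriv p p' ->
  coefwise_deriv (c *: p) (d c *: p + c *: p').
Proof. by move=> pp m; rewrite mcoeffD !mcoeffZ (dM dP) pp. Qed.

Lemma coefwise_derivC c : coefwise_deriv (mpolyC n c) (mpolyC n (d c)).
Proof.
move=> m; rewrite !mcoeffC; case: eqP; rewrite ?mulr0 ?mulr1 //.
by rewrite d0.
Qed.

Lemma coefwise_derivX i : coefwise_deriv 'Xv_i 0.
Proof. by move=> m; rewrite mcoeff0 mcoeffX; case: eqP; rewrite ?d0 ?d1. Qed.

Lemma coefwise_deriv0 : coefwise_deriv 0 0.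
Proof. by move=> m; rewrite mcoeff0 d0. Qed.

Record subspace (V : set P) : Prop := {
  ss0 : V 0;
  ssD : forall p q, V p -> V q -> V (p + q);
  ssZ : forall c p, V p -> V (c *: p) }.

(** A space V of polynomials that is stable under the derivation of coefficients is
    spanned by its elements with constant coefficients, so a linear form E that
    kills the latter kills V. The reason: an element w of V of minimal support, with
    one coefficient equal to 1, has a derivative of smaller support, hence zero,
    and is constant; subtracting a multiple of w from p makes its support
    smaller. *)
Lemma stable_subspace_const (V : set P) (E : P -> M) : subspace V ->
  (forall p, V p -> exists2 q, V q & coefwise_deriv p q) ->
  (forall p q, E (p + q) = E p + E q) -> (forall c p, E (c *: p) = c * E p) ->
  (forall q : mpoly n C, V (map_mpoly iota q) -> E (map_mpoly iota q) = 0) ->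
  forall p, V p -> E p = 0.
Proof.
move=> [V0 VD VZ] Vd ED EZ Econst p.
have [k] := ubnP (size (msupp p)); elim: k p => // k IHk p; rewrite ltnS => pk Vp.
have [->|p0] := eqVneq p 0; first by rewrite -(scale0r 0) EZ mul0r.
pose small w := [/\ V w, w != 0 & {subset msupp w <= msupp p}].
have exw : exists N, `[< exists2 w, small w & size (msupp w) = N >].
  by exists (size (msupp p)); apply/asboolP; exists p => //; split.
case: (ex_minnP exw) => N /asboolP[w [Vw w0 wp] wN] Nmin.
have [m0 m0w] : exists m, m \in msupp w.
  move: w0; rewrite -msupp_eq0; case: (msupp w) => // m s _; exists m.
  exact: mem_head.
have {}m0w0 : mcoeff m0 w != 0 by rewrite -mcoeff_msupp.
pose w1 := (mcoeff m0 w)^-1 *: w.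
have w1p : {subset msupp w1 <= msupp p}.
  move=> m; rewrite mcoeff_msupp mcoeffZ => h; apply: wp; rewrite mcoeff_msupp.
  by apply: contra_neq h => ->; rewrite mulr0.
have m0p : m0 \in msupp p by apply: wp.
have smaller (u : P) : {subset msupp u <= msupp p} -> mcoeff m0 u = 0 ->
    (size (msupp u) < size (msupp p))%N.
  move=> up u0; apply: (@leq_ltn_trans (size (rem m0 (msupp p)))).
    apply: uniq_leq_size => // m mu; rewrite mem_rem_uniq // inE up // andbT.
    by apply: contraTneq mu => ->; rewrite mcoeff_msupp u0 eqxx.
  by rewrite size_rem // prednK //; case: (msupp p) m0p.
have w1ne : w1 != 0 by rewrite scaler_eq0 invr_eq0 (negPf m0w0).
have w1w m : mcoeff m w = 0 -> mcoeff m w1 = 0 by rewrite mcoeffZ => ->; rewrite mulr0.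
have [w2 Vw2 w12] := Vd _ (VZ (mcoeff m0 w)^-1 _ Vw).
have w20 : w2 = 0.
  apply/eqP; apply: contraT => w2ne.
  have w2w : {subset msupp w2 <= msupp w}.
    move=> m; rewrite !mcoeff_msupp w12; apply: contra_neq => /w1w ->; exact: d0.
  suff : (N <= size (msupp w2))%N.
    rewrite leqNgt => /negP; case; rewrite -wN.
    apply: (@leq_ltn_trans (size (rem m0 (msupp w)))).
      apply: uniq_leq_size => // m mu; rewrite mem_rem_uniq // inE w2w // andbT.
      apply: contraTneq mu => ->.
      by rewrite mcoeff_msupp w12 mcoeffZ mulVf // d1 eqxx.
    by rewrite size_rem // prednK //; case: (msupp w) m0w.
  apply: Nmin; apply/asboolP; exists w2 => //; split=> // m /w2w; exact: wp.
have [q w1q] : exists q, w1 = map_mpoly iota q.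
  have cst m : exists c, mcoeff m w1 = iota c.
    by apply: (proj1 (d_const dP _)); rewrite -w12 w20 mcoeff0.
  have [f fP] := choice cst.
  pose q := \sum_(m <- msupp w1) f m *: mpolyX C m.
  exists q; rewrite [w1 in LHS]mpolyE raddf_sum; apply: eq_bigr => m _.
  by rewrite /= map_mpolyZ map_mpolyX fP.
have Ew1 : E w1 = 0 by rewrite w1q; apply: Econst; rewrite -w1q; apply: VZ.
have -> : p = (p - mcoeff m0 p *: w1) + mcoeff m0 p *: w1 by rewrite subrK.
rewrite ED EZ Ew1 mulr0 addr0; apply: IHk; last first.
  by apply: VD => //; rewrite -scaleNr; do 2?apply: (VZ).
apply: leq_trans pk; apply: smaller; last first.
  by rewrite mcoeffB !mcoeffZ mulVf // mulr1 subrr.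
move=> m /msuppB_le; rewrite mem_cat => /orP[//|/msuppZ_le/msuppZ_le].
exact: wp.
Qed.
End Derivations.

(** * Polynomials in the entries of a matrix *)

Section MatrixPolynomials.
Variables (M : comNzRingType) (n : nat).
Local Notation P := (mpoly (n * n) M).

Definition evm (S : 'M[M]_n) (p : P) : M := meval (fun l => mxvec S 0 l) p.

HB.instance Definition _ S := GRing.RMorphism.copy (evm S) (meval (fun l => mxvec S 0 l)).

Definition generic_mx : 'M[P]_n := \matrix_(i, j) 'Xv_(mxvec_index i j).

Lemma evm_gmx S : map_mx (evm S) generic_mx = S.
Proof. by apply/matrixP => i j; rewrite !mxE /evm mevalXU mxvecE. Qed.

Lemma evmC S c : evm S (mpolyC _ c) = c.
Proof. exact: mevalC. Qed.

Lemma evm_map_mpolyC S p q (X : 'M[M]_(p, q)) : map_mx (evm S) (map_mx (@mpolyC _ M) X) = X.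
Proof. by apply/matrixP => i j; rewrite !mxE evmC. Qed.

Lemma evmZ S c p : evm S (c *: p) = c * evm S p.
Proof. exact: mevalZ. Qed.

End MatrixPolynomials.

(** The substitution X := T X in the matrix X of the variables. *)
HB.lock Definition lsub (M : comNzRingType) (n : nat) (T : 'M[M]_n)
    (p : mpoly (n * n) M) : mpoly (n * n) M :=
  comp_mpoly [tuple mxvec (map_mx (@mpolyC _ M) T *m generic_mx M n) 0 l | l < n * n] p.

Section LinearSubstitution.
Variables (M : comNzRingType) (n : nat).
Local Notation P := (mpoly (n * n) M).
Local Notation gmx := (generic_mx M n).

Lemma lsub_is_additive (T : 'M[M]_n) : zmod_morphism (lsub T).
Proof. by move=> p q; rewrite unlock raddfB. Qed.

HB.instance Definition _ T := GRing.isZmodMorphism.Build P P (lsub T) (lsub_is_additive T).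

Lemma lsub_is_multiplicative (T : 'M[M]_n) : monoid_morphism (lsub T).
Proof. by split=> [|p q]; rewrite unlock ?rmorph1 ?rmorphM. Qed.

HB.instance Definition _ T := GRing.isMonoidMorphism.Build P P (lsub T) (lsub_is_multiplicative T).

Lemma lsubZ (T : 'M[M]_n) c p : lsub T (c *: p) = c *: lsub T p.
Proof. rewrite unlock; exact: comp_mpolyZ. Qed.

Lemma lsubC (T : 'M[M]_n) c : lsub T (mpolyC _ c) = mpolyC _ c.
Proof. rewrite unlock; exact: comp_mpolyC. Qed.

Lemma lsub_gmx (T : 'M[M]_n) : map_mx (lsub T) gmx = map_mx (@mpolyC _ M) T *m gmx.
Proof.
apply/matrixP => i j; rewrite mxE [gmx i j]mxE unlock comp_mpolyXU.
by rewrite -tnth_nth tnth_mktuple mxvecE.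
Qed.

Lemma lsub_map_mpolyC (T : 'M[M]_n) p q (X : 'M[M]_(p, q)) :
  map_mx (lsub T) (map_mx (@mpolyC _ M) X) = map_mx (@mpolyC _ M) X.
Proof. by apply/matrixP => i j; rewrite !mxE lsubC. Qed.

Lemma evm_lsub (T S : 'M[M]_n) p : evm S (lsub T p) = evm (T *m S) p.
Proof.
rewrite /evm unlock comp_mpoly_meval; apply: meval_eq => l.
rewrite tnth_mktuple; case/mxvec_indexP: l => i j; rewrite !mxvecE !mxE.
rewrite raddf_sum; apply: eq_bigr => k _ /=.
by rewrite mevalM !mxE mevalC mevalXU mxvecE.
Qed.

Lemma lsubK (T1 T2 : 'M[M]_n) : T2 *m T1 = 1%:M -> cancel (lsub T2) (lsub T1).
Proof.
move=> T12; elim/mpolyind => [|c m p _ _ IHp]; first by rewrite !rmorph0.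
rewrite !rmorphD /= IHp !lsubZ; congr (_ *: _ + _).
rewrite mpolyXE_id !rmorph_prod; apply: eq_bigr => l _ /=.
rewrite !rmorphXn /=; congr (_ ^+ _); case/mxvec_indexP: l => i j.
have E : map_mx (lsub T1) (map_mx (lsub T2) gmx) = gmx.
  rewrite lsub_gmx (map_mxM (lsub T1)) lsub_map_mpolyC lsub_gmx mulmxA.
  by rewrite -(map_mxM (@mpolyC (n * n) M)) T12 map_mx1 mul1mx.
by move/matrixP/(_ i j): E; rewrite mxE [in X in X -> _]mxE [gmx i j]mxE.
Qed.
End LinearSubstitution.

Lemma evm_map (R S : comNzRingType) (f : {rmorphism R -> S}) n (s : 'M[R]_n) q :
  evm (map_mx f s) (map_mpoly f q) = f (evm s q).
Proof.
elim/mpolyind: q => [|c m p _ _ IHp]; first by rewrite !rmorph0.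
rewrite !rmorphD /= IHp map_mpolyZ map_mpolyX !evmZ rmorphM /=; congr (_ * _ + _).
rewrite /evm !mevalX rmorph_prod; apply: eq_bigr => i _.
by rewrite rmorphXn /= -map_mxvec mxE.
Qed.

(** * The Galois correspondence for a fundamental matrix *)

(** Since X = F Z, the left-hand side is det X ^ 2 (X B0 X^-1 - F B0 F') whenever
    det X is invertible, with F' inverse to F, and it vanishes when Z commutes
    with B0; the adjugates make this a polynomial identity. *)
Lemma conj_defect (Q : comNzRingType) n (X F F' Z B0 : 'M[Q]_n) :
  X = F *m Z -> Z = F' *m X ->
  \det X *: (X *m B0 *m \adj X) - \det X ^+ 2 *: (F *m B0 *m F') =
  \det F *: (F *m (\det Z *: (Z *m B0 - B0 *m Z)) *m \adj X).
Proof.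
move=> XE ZE.
have -> : \det X ^+ 2 *: (F *m B0 *m F') = \det X *: (F *m (B0 *m Z) *m \adj X).
  rewrite expr2 -scalerA; congr (_ *: _).
  have ZX : Z *m \adj X = \det X *: F' by rewrite ZE -mulmxA mul_mx_adj mul_mx_scalar.
  by rewrite mulmxA -[RHS]mulmxA ZX -scalemxAr.
rewrite -scalerBr -scalemxAr -scalemxAl scalerA -det_mulmx -XE.
by congr (_ *: _); rewrite mulmxBr mulmxBl [F *m (Z *m _)]mulmxA -XE.
Qed.

Section PicardVessiot.
Variables (C : closedFieldType) (M : fieldType) (iota : {rmorphism C -> M}).
Variables (d : M -> M) (K : set M).
Hypothesis dP : derivation iota d.
Hypothesis M_char0 : [pchar M] =i pred0.
Hypothesis C_uncountable : ~ countable [set: C].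
Hypothesis Ksf : subfield K.
Hypothesis Kiota : forall c, K (iota c).
Hypothesis Kd : forall x, K x -> K (d x).
Variables (n : nat) (A F : 'M[M]_n).
Hypothesis KA : forall i j, K (A i j).
Hypothesis Fu : F \in unitmx.
Hypothesis dF : map_mx d F = A *m F.
Local Notation P := (mpoly (n * n) M).
Local Notation gmx := (generic_mx M n).

(** The subfield K is a mere set, so the polynomials over K are singled out among
    those over M. *)
Definition polyoverK (p : P) := forall m, K (mcoeff m p).

(** The classical definition: right multiplication of the fundamental matrix F by s
    preserves the algebraic relations over K between the entries of F. *)
Definition differential_galois (s : 'M[C]_n) := s \in unitmx /\
  forall p, polyoverK p -> evm F p = 0 -> evm (F *m map_mx iota s) p = 0.

Lemma pKC c : K c -> polyoverK (mpolyC _ c).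
Proof. by move=> Kc m; rewrite mcoeffC; apply: (sfM Ksf) => //; apply: sf_nat. Qed.

Lemma pK0 : polyoverK 0.
Proof. by move=> m; rewrite mcoeff0; apply: sf0. Qed.

Lemma pKD p q : polyoverK p -> polyoverK q -> polyoverK (p + q).
Proof. by move=> Kp Kq m; rewrite mcoeffD; apply: sfD. Qed.

Lemma pKM p q : polyoverK p -> polyoverK q -> polyoverK (p * q).
Proof.
move=> Kp Kq m; rewrite mcoeffM; apply: sf_sum => // i _.
exact: (sfM Ksf).
Qed.

Lemma pKN p : polyoverK p -> polyoverK (- p).
Proof. by move=> Kp m; rewrite mcoeffN; apply: sfN. Qed.

Lemma pK1 : polyoverK 1.
Proof. by rewrite -mpolyC1; apply: pKC; exact: (sf1 Ksf). Qed.

Lemma pKX m : polyoverK (mpolyX M m).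
Proof. by move=> k; rewrite mcoeffX; apply: sf_nat. Qed.

Lemma pKZ c p : K c -> polyoverK p -> polyoverK (c *: p).
Proof. by move=> Kc Kp; rewrite -mul_mpolyC; apply: pKM => //; exact: pKC. Qed.

Lemma pK_sum (T : Type) (s : seq T) (Q : pred T) (f : T -> P) :
  (forall i, Q i -> polyoverK (f i)) -> polyoverK (\sum_(i <- s | Q i) f i).
Proof. by move=> Kf; apply: big_ind => //; [exact: pK0|exact: pKD]. Qed.

Lemma pK_mulmx p q r (X : 'M[P]_(p, q)) (Y : 'M[P]_(q, r)) :
  (forall i j, polyoverK (X i j)) -> (forall i j, polyoverK (Y i j)) ->
  forall i j, polyoverK ((X *m Y) i j).
Proof. by move=> KX KY i j; rewrite mxE; apply: pK_sum => k _; exact: pKM. Qed.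

Lemma pK_sign k : polyoverK ((-1) ^+ k).
Proof.
elim: k => [|k IHk]; first by rewrite expr0; exact: pK1.
by rewrite exprS; apply: pKM => //; apply: pKN; exact: pK1.
Qed.

Lemma pK_det k (X : 'M[P]_k) : (forall i j, polyoverK (X i j)) -> polyoverK (\det X).
Proof.
move=> KX; apply: pK_sum => s _; apply: pKM.
  exact: pK_sign.
by apply: (big_ind polyoverK) => [|p q|i _]; [exact: pK1|exact: pKM|exact: KX].
Qed.

Lemma pK_adj k (X : 'M[P]_k) : (forall i j, polyoverK (X i j)) ->
  forall i j, polyoverK ((\adj X) i j).
Proof.
move=> KX i j; rewrite mxE; apply: pKM; last by apply: pK_det => a b; rewrite !mxE.
exact: pK_sign.
Qed.

Lemma pK_gmx i j : polyoverK (gmx i j).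
Proof. by rewrite mxE; exact: pKX. Qed.

(** The polynomials over K are the K-algebra generated by the variables. *)
Lemma polyoverK_ind (Q : P -> Prop) : (forall c, K c -> Q (mpolyC _ c)) ->
  (forall i j, Q (gmx i j)) -> (forall p q, Q p -> Q q -> Q (p + q)) ->
  (forall p q, Q p -> Q q -> Q (p * q)) -> forall p, polyoverK p -> Q p.
Proof.
move=> QC QX QD QM; elim/mpolyind => [|c m p mp c0 IHp] Kp.
  by rewrite -mpolyC0; apply: QC; exact: sf0.
have pm : mcoeff m p = 0 by apply: memN_msupp_eq0.
have Kc : K c.
  by have := Kp m; rewrite mcoeffD mcoeffZ mcoeffX eqxx mulr1 pm addr0.
apply: (QD); last first.
  apply: IHp => k; have := Kp k; rewrite mcoeffD mcoeffZ mcoeffX.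
  by have [<-|_] := eqVneq m k; rewrite ?mulr0 ?add0r // pm => _; exact: sf0.
rewrite -mul_mpolyC; apply: (QM); first exact: QC.
have Q1 : Q 1 by rewrite -mpolyC1; apply: QC; exact: (sf1 Ksf).
rewrite mpolyXE_id; apply: (big_ind Q) => // l _.
elim: (m l) => [|k IHk]; first by rewrite expr0.
rewrite exprS; apply: (QM) => //; case/mxvec_indexP: l {IHk} => i j.
by have := QX i j; rewrite mxE.
Qed.

(** The polynomial p' is the image of p under the derivation of K[X] that extends d
    and maps X to A X. It is compatible with evaluation at F because F' = A F;
    after the substitution X = F Z it becomes the derivation of coefficients,
    because F' = A F makes Z constant. *)
Lemma polyoverK_deriv p : polyoverK p -> exists2 p', polyoverK p' &
  coefwise_deriv d (lsub F p) (lsub F p') /\ d (evm F p) = evm F p'.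
Proof.
move=> Kp; suff [] : polyoverK p /\ exists2 p', polyoverK p' &
  coefwise_deriv d (lsub F p) (lsub F p') /\ d (evm F p) = evm F p' by [].
move: p Kp; apply: polyoverK_ind => [c Kc|i j|p q|p q].
- split; first exact: pKC.
  exists (mpolyC _ (d c)); first by apply: pKC; exact: Kd.
  by rewrite !lsubC !evmC; split=> //; apply: (coefwise_derivC dP).
- split; first exact: pK_gmx.
  exists ((map_mx (@mpolyC _ M) A *m gmx) i j).
    by apply: pK_mulmx => [a b|]; [rewrite mxE; exact: pKC|exact: pK_gmx].
  split.
    have -> : lsub F (gmx i j) = (map_mx (@mpolyC _ M) F *m gmx) i j.
      by rewrite -lsub_gmx [RHS]mxE.
    have -> : lsub F ((map_mx (mpolyC (n * n) (R:=M)) A *m gmx) i j) =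
        \sum_k (d (F i k) *: gmx k j + F i k *: 0).
      transitivity ((map_mx (lsub F) (map_mx (mpolyC (n * n) (R:=M)) A *m gmx)) i j).
        by rewrite [RHS]mxE.
      rewrite (map_mxM (lsub F)) lsub_map_mpolyC lsub_gmx mulmxA.
      rewrite -(map_mxM (@mpolyC _ M)) -dF mxE; apply: eq_bigr => k _.
      by rewrite scaler0 addr0 -mul_mpolyC [_ i k]mxE [map_mx d F i k]mxE.
    rewrite mxE; elim/big_ind2: _ => [||k _].
    + apply: (coefwise_deriv0 dP).
    + by move=> *; apply: (coefwise_derivD dP).
    + rewrite [map_mx _ _ i k]mxE mul_mpolyC; apply: (coefwise_derivZ dP) => //.
      by rewrite mxE; apply: (coefwise_derivX dP).
  have evX : forall Y : 'M[P]_n, evm F (Y i j) = map_mx (evm F) Y i j.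
    by move=> Y; rewrite mxE.
  rewrite !evX (map_mxM (evm F)) evm_map_mpolyC evm_gmx -dF.
  by rewrite mxE.
- move=> [Kp [p' Kp' [dp ep]]] [Kq [q' Kq' [dq eq]]]; split; first exact: pKD.
  exists (p' + q'); first exact: pKD.
  rewrite !rmorphD /=; split; first exact: (coefwise_derivD dP).
  by rewrite (dD dP) ep eq.
- move=> [Kp [p' Kp' [dp ep]]] [Kq [q' Kq' [dq eq]]]; split; first exact: pKM.
  exists (p' * q + p * q'); first by apply: pKD; apply: pKM.
  rewrite !rmorphD !rmorphM /=; split; first exact: (coefwise_derivM dP).
  by rewrite (dM dP) ep eq.
Qed.

Inductive relation_span : P -> Prop :=
| relation_span0 : relation_span 0
| relation_spanD c p q : polyoverK p -> evm F p = 0 -> relation_span q ->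
    relation_span (c *: p + q).

(** A relation over K times a monomial is a relation over K. *)
Lemma relation_span_ideal : ideal (relation_span : set P).
Proof.
have spanD p q : relation_span p -> relation_span q -> relation_span (p + q).
  move=> sp sq; elim: sp => [|c p1 p2 Kp p0 _ IH]; first by rewrite add0r.
  by rewrite -addrA; apply: relation_spanD.
split=> //; first exact: relation_span0.
elim/mpolyind => [|c m p _ _ IHp] q sq.
  by rewrite mul0r; exact: relation_span0.
rewrite mulrDl; apply: spanD; last exact: IHp.
elim: sq => [|a p1 p2 Kp p0 _ IH]; first by rewrite mulr0; exact: relation_span0.
rewrite mulrDr -scalerAl -scalerAr scalerA; apply: relation_spanD => //.
  by apply: pKM => //; exact: pKX.
by rewrite rmorphM /= p0 mulr0.
Qed.

Lemma map_mpoly_functional (phi : {additive M -> M}) c p : functional K phi ->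
  polyoverK p -> map_mpoly phi (c *: p) = phi c *: p.
Proof.
move=> fphi Kp; apply/mpolyP => m; rewrite mcoeff_map_mpoly !mcoeffZ mulrC.
by rewrite (flZ fphi) // mulrC.
Qed.

(** A functional applied to the coefficients of an element of the span gives again a
    relation satisfied by F, since it only acts on the scalars of M. *)
Lemma functional_relation_span (phi : {additive M -> M}) p : functional K phi ->
  relation_span p -> evm F (map_mpoly phi p) = 0.
Proof.
move=> fphi; elim=> [|c p1 p2 Kp p0 _ IH]; first by rewrite raddf0 rmorph0.
by rewrite raddfD rmorphD /= IH addr0 map_mpoly_functional // evmZ p0 mulr0.
Qed.

(** Expand (u - b w) ^ N, apply phi to its coefficients and evaluate at F, where
    u = b w: the common factor w ^ N comes out, and what remains is phi applied to
    the coefficients of (T - b) ^ N, evaluated at b. *)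
Lemma functional_nilpotent (phi : {additive M -> M}) (u w : P) b N :
  functional K phi -> polyoverK u -> polyoverK w ->
  evm F w != 0 -> evm F u = b * evm F w ->
  relation_span ((u - b *: w) ^+ N) -> (map_poly phi (('X - b%:P) ^+ N)).[b] = 0.
Proof.
move=> fphi1 Ku Kw w0 uw sN.
pose c i := ((-1) ^+ i * b ^+ i) *+ 'C(N, i).
have KX k p : polyoverK p -> polyoverK (p ^+ k).
  by move=> Kp; elim: k => [|k IH]; rewrite ?expr0 ?exprS; [exact: pK1|exact: pKM].
have := functional_relation_span fphi1 sN.
have -> : (u - b *: w) ^+ N = \sum_(i < N.+1) c i *: (u ^+ (N - i) * w ^+ i).
  rewrite exprBn; apply: eq_bigr => i _; rewrite /c -!mul_mpolyC.
  by rewrite rmorphMn rmorphM !rmorphXn rmorphN rmorph1 /= exprMn; ring.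
have -> : evm F (map_mpoly phi (\sum_(i < N.+1) c i *: (u ^+ (N - i) * w ^+ i))) =
    \sum_(i < N.+1) phi (c i) * b ^+ (N - i) * evm F w ^+ N.
  rewrite (raddf_sum (map_mpoly phi)) (raddf_sum (evm F)).
  apply: eq_bigr => i _ /=.
  rewrite [map_mpoly _ _]map_mpoly_functional //; last by apply: pKM; exact: KX.
  rewrite evmZ rmorphM !rmorphXn /= uw exprMn -[_ * _ * _ ^+ i]mulrA -exprD.
  by rewrite subnK -1?ltnS // mulrA.
rewrite -mulr_suml => /eqP; rewrite mulf_eq0 expf_eq0 (negPf w0) andbF orbF.
move=> /eqP cb; rewrite -[RHS]cb.
have -> : ('X - b%:P) ^+ N = \sum_(i < N.+1) c i *: 'X^(N - i).
  rewrite exprBn; apply: eq_bigr => i _; rewrite /c -!mul_polyC.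
  by rewrite rmorphMn rmorphM !rmorphXn rmorphN rmorph1 /=; ring.
rewrite raddf_sum horner_sum; apply: eq_bigr => i _ /=.
rewrite -[b ^+ _]hornerXn -hornerZ; congr (_.[_]); apply/polyP => j.
by rewrite coef_map !coefZ coefXn; case: eqP; rewrite ?mulr1 ?mulr0 ?raddf0.
Qed.

Lemma mem_subfield_of_nilpotent (u w : P) b N : polyoverK u -> polyoverK w ->
  evm F w != 0 -> evm F u = b * evm F w ->
  relation_span ((u - b *: w) ^+ N) -> K b.
Proof.
move=> Ku Kw w0 uw sN; apply: (mem_subfield_of_power Ksf (N := N) M_char0).
move=> phi0 fphi.
pose phi : {additive M -> M} := HB.pack phi0
  (GRing.isNmodMorphism.Build M M phi0 (conj (fl0 Ksf fphi) (flD fphi))).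
exact: (functional_nilpotent (phi := phi) fphi Ku Kw w0 uw sN).
Qed.

Lemma relation_span1 p : polyoverK p -> evm F p = 0 -> relation_span p.
Proof.
by move=> Kp p0; rewrite -[p]scale1r -[_ *: _]addr0; apply: relation_spanD => //; exact: relation_span0.
Qed.

(** After the substitution X = F Z, the elements of the span of relations that have
    constant coefficients: they are the equations of the Galois group. *)
Let galois_ideal : set (mpoly (n * n) C) :=
  [set q | exists2 p, relation_span p & map_mpoly iota q = lsub F p].

Lemma lsubVK : cancel (lsub (invmx F)) (lsub F).
Proof. by apply: lsubK; rewrite mulVmx. Qed.

Lemma lsubKV : cancel (lsub F) (lsub (invmx F)).
Proof. by apply: lsubK; rewrite mulmxV. Qed.

Lemma galois_ideal_ideal : ideal galois_ideal.
Proof.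
have [R0 RD RM] := relation_span_ideal; split.
- by exists 0 => //; rewrite !rmorph0.
- move=> p q [p1 R1 E1] [p2 R2 E2]; exists (p1 + p2); first exact: RD.
  by rewrite !rmorphD /= E1 E2.
- move=> p q [p1 R1 E1]; exists (lsub (invmx F) (map_mpoly iota p) * p1); first exact: RM.
  by rewrite !rmorphM /= lsubVK E1.
Qed.

(** The span of relations, written in Z, is stable under the derivation of
    coefficients by [polyoverK_deriv]; so by [stable_subspace_const] it vanishes at
    the constant matrix s as soon as its constant elements do. *)
Lemma zero_galois_ideal (s : 'M[C]_n) : s \in unitmx ->
  (forall q, galois_ideal q -> evm s q = 0) -> differential_galois s.
Proof.
move=> su Gs; split=> // p Kp p0; rewrite -evm_lsub.
pose V v := exists2 p, relation_span p & v = lsub F p.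
have [R0 RD RM] := relation_span_ideal.
apply: (@stable_subspace_const _ _ iota d dP _ V).
- split.
  + by exists 0 => //; rewrite rmorph0.
  + move=> _ _ [p1 R1 ->] [p2 R2 ->]; exists (p1 + p2); first exact: RD.
    by rewrite rmorphD.
  + move=> c _ [p1 R1 ->]; exists (c *: p1); last by rewrite lsubZ.
    by rewrite -mul_mpolyC; exact: RM.
- move=> _ [q Rq ->]; elim: Rq => [|c p1 p2 Kp1 p10 R2 [q' [r Rr ->] dq]].
    exists 0; first by exists 0 => //; rewrite rmorph0.
    by rewrite rmorph0; apply: (coefwise_deriv0 dP).
  have [p1' Kp1' [dp1 ep1]] := polyoverK_deriv Kp1.
  exists (lsub F (d c *: p1 + (c *: p1' + r))).
    exists (d c *: p1 + (c *: p1' + r)) => //; apply: relation_spanD => //.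
    by apply: relation_spanD => //; rewrite -ep1 p10 (d0 dP).
  rewrite addrA !rmorphD /= !lsubZ; apply: (coefwise_derivD dP) => //.
  exact: (coefwise_derivZ dP).
- by move=> x y; rewrite rmorphD.
- by move=> x y; rewrite evmZ.
- move=> q [r Rr Er]; have /Gs q0 : galois_ideal q by exists r.
  transitivity (iota (evm s q)); last by rewrite q0 rmorph0.
  exact: evm_map.
- by exists p => //; apply: (relation_span1).
Qed.

(** The equations det Z (Z B0 - B0 Z) = 0 hold on the Galois group, so by the
    Nullstellensatz they hold in the radical of its ideal. Back in the variables
    X = F Z this says that det X X B0 adj(X) - det X ^ 2 B has entries in the radical
    of the span of relations, where B = F B0 F^-1; then
    [mem_subfield_of_nilpotent] applies to the entries of B. *)
Theorem fixed_by_galois (B0 : 'M[C]_n) :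
  (forall s, differential_galois s -> s *m B0 = B0 *m s) ->
  forall i j, K ((F *m map_mx iota B0 *m invmx F) i j).
Proof.
move=> commB i j; set B := F *m _ *m _.
pose Z0 : 'M[mpoly (n * n) C]_n := generic_mx C n.
pose h0 k l := (Z0 *m map_mx (@mpolyC _ C) B0 - map_mx (@mpolyC _ C) B0 *m Z0) k l * \det Z0.
(* the factor det Z0 discards the zeros that are not invertible *)
have h0_rad k l : exists N, galois_ideal (h0 k l ^+ N).
  apply: contrapT => noN.
  have av : avoids galois_ideal (h0 k l) by move=> N gN; apply: noN; exists N.
  have [v [vI]] := nullstellensatz C_uncountable galois_ideal_ideal av.
  pose s : 'M[C]_n := vec_mx (\row_i v i).
  have vs q : meval v q = evm s q.
    by apply: meval_eq => a; rewrite /s vec_mxK mxE.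
  have evZ0 : map_mx (evm s) Z0 = s by apply: evm_gmx.
  rewrite vs /h0 rmorphM /= -(det_map_mx (evm s)) evZ0 mulf_eq0 negb_or.
  move=> /andP[hs]; rewrite -unitfE => ds.
  have : differential_galois s.
    by apply: zero_galois_ideal => // q /vI; rewrite vs.
  move=> /commB sB; move: hs.
  have -> : evm s ((Z0 *m map_mx (@mpolyC _ C) B0 - map_mx (@mpolyC _ C) B0 *m Z0) k l) =
     (map_mx (evm s) (Z0 *m map_mx (@mpolyC _ C) B0 - map_mx (@mpolyC _ C) B0 *m Z0)) k l.
    by rewrite [RHS]mxE.
  rewrite (map_mxB (evm s)) !(map_mxM (evm s)) evZ0 !evm_map_mpolyC sB subrr.
  by rewrite mxE eqxx.
(* carry the equations back to the variables X = F Z over M *)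
pose X : 'M[P]_n := gmx; pose cF : 'M[P]_n := map_mx (@mpolyC _ M) F.
pose cB0 : 'M[P]_n := map_mx (@mpolyC _ M) (map_mx iota B0).
pose Z : 'M[P]_n := map_mx (@mpolyC _ M) (invmx F) *m X.
pose T := \det Z *: (Z *m cB0 - cB0 *m Z).
pose rad : set P := radical (relation_span : set P).
have rad_ideal : ideal rad by apply: ideal_radical; exact: relation_span_ideal.
have [rad0 radD radM] := rad_ideal.
have T_rad k l : rad (T k l).
  have [N [r Rr rE]] := h0_rad k l.
  pose f : {rmorphism mpoly (n * n) C -> P} := lsub (invmx F) \o map_mpoly iota.
  have fZ0 : map_mx f Z0 = Z.
    rewrite /Z -lsub_gmx; apply/matrixP => a c; rewrite [LHS]mxE [RHS]mxE /f /=.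
    by congr lsub; rewrite !mxE map_mpolyX.
  have fB0 : map_mx f (map_mx (@mpolyC _ C) B0) = cB0.
    by apply/matrixP => a c; rewrite !mxE /f /= map_mpolyC lsubC.
  have -> : T k l = f (h0 k l).
    rewrite /h0 (rmorphM f) -(det_map_mx f) fZ0 mulrC /T mxE; congr (_ * _).
    transitivity (map_mx f (Z0 *m map_mx (@mpolyC _ C) B0 - map_mx (@mpolyC _ C) B0 *m Z0) k l).
      by rewrite (map_mxB f) !(map_mxM f) fZ0 fB0.
    by rewrite [LHS]mxE.
  exists N; rewrite -rmorphXn /f /= rE lsubKV.
  exact: Rr.
have XE : X = cF *m Z.
  by rewrite /Z mulmxA /cF -(map_mxM (@mpolyC _ M)) mulmxV // map_mx1 mul1mx.
pose W := \det X *: (X *m cB0 *m \adj X).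
have WE : W - (\det X ^+ 2) *: map_mx (@mpolyC _ M) B = \det cF *: (cF *m T *m \adj X).
  have -> : map_mx (@mpolyC _ M) B = cF *m cB0 *m map_mx (@mpolyC _ M) (invmx F).
    by rewrite /B !(map_mxM (@mpolyC _ M)).
  exact: conj_defect.
have e_rad : rad (W i j - B i j *: \det X ^+ 2).
  have -> : W i j - B i j *: \det X ^+ 2 = (\det cF *: (cF *m T *m \adj X)) i j.
    rewrite -WE [RHS]mxE [X in _ = _ + X]mxE [X in _ = _ - X]mxE.
    by rewrite [map_mx _ B i j]mxE mulrC mul_mpolyC.
  rewrite mxE; apply: (radM); rewrite mxE; apply: ideal_sum => // l _.
  rewrite mulrC; apply: (radM); rewrite mxE; apply: ideal_sum => // k _.
  exact: radM.
have KX a c : polyoverK (X a c) by exact: pK_gmx.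
have Kdet : polyoverK (\det X) by exact: pK_det.
have [N RN] := e_rad.
apply: (@mem_subfield_of_nilpotent (W i j) (\det X ^+ 2) _ N) => //.
- rewrite mxE; apply: pKM => //; apply: pK_mulmx; last exact: pK_adj.
  apply: pK_mulmx => // a c; rewrite !mxE; apply: pKC; exact: Kiota.
- by rewrite expr2; apply: pKM.
- rewrite rmorphXn /= -(det_map_mx (evm F)) evm_gmx expf_neq0 //.
  by rewrite -unitfE -unitmxE.
have -> : evm F (W i j) = (map_mx (evm F) W) i j by rewrite [RHS]mxE.
rewrite /W (map_mxZ (evm F)) !(map_mxM (evm F)) map_mx_adj evm_map_mpolyC.
rewrite rmorphXn /= -(det_map_mx (evm F)) evm_gmx.
have -> : \adj F = \det F *: invmx F.
  by rewrite /invmx Fu scalerA divff ?scale1r // -unitfE -unitmxE.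
by rewrite -scalemxAr !mxE; ring.
Qed.

End PicardVessiot.

(** * Power series in a punctured disc *)

Section Expansions.
Variable C : numFieldType.
Implicit Types (c d : nat -> C) (h g : C -> C) (a b t : C) (P : C -> Prop).

Definition near0 P := \forall t \near 0^', P t.

Lemma near0P P : near0 P <->
  exists2 e : C, 0 < e & forall t, t != 0 -> `|t| < e -> P t.
Proof.
split=> [[e /= e0 H]|[e e0 H]].
  exists e => // t t0 te; apply: H => //=; rewrite sub0r normrN; exact: te.
exists e => //= t /=; rewrite sub0r normrN => te t0; exact: H.
Qed.

#[global] Instance near0_filter : ProperFilter near0.
Proof. exact: Proper_dnbhs_numFieldType. Qed.

Lemma near0_and P Q : near0 P -> near0 Q -> near0 (fun t => P t /\ Q t).
Proof. by move=> p q; apply: filterS2 p q => t; split. Qed.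

Lemma near0_imp P Q : (forall t, P t -> Q t) -> near0 P -> near0 Q.
Proof. by move=> PQ p; apply: filterS p. Qed.

Lemma near0_ex P : near0 P -> exists2 t, t != 0 & P t.
Proof.
move=> /near0P[e e0 H]; exists (e / 2); first by rewrite mulf_neq0 ?gt_eqF ?invr_eq0 ?pnatr_eq0.
apply: H; first by rewrite mulf_neq0 ?gt_eqF ?invr_eq0 ?pnatr_eq0.
rewrite gtr0_norm ?divr_gt0 // ltr_pdivrMr // mulr_natr mulr2n ltrDl //.
Qed.

Definition psum c t n : C := \sum_(k < n) c k * t ^+ k.

Lemma psumS c t n : psum c t n.+1 = psum c t n + c n * t ^+ n.
Proof. exact: big_ord_recr. Qed.

Lemma psum0 c t : psum c t 0 = 0.
Proof. exact: big_ord0. Qed.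

Definition coef_bound a c := 1 <= a /\ forall k, `|c k| <= a ^+ k.+1.

Definition tail_bound a c h := forall t, t != 0 -> a * `|t| <= 2^-1 ->
  forall n, `|h t - psum c t n| <= 2 * (a ^+ n.+1 * `|t| ^+ n).

(** h is the sum of the power series c near 0, except maybe at 0. One constant a
    bounds the coefficients and all the remainders, at all t != 0 with
    |t| <= 1 / (2 a): this form of convergence involves no limit and is
    easily transported through algebraic operations. *)
Definition expands c h := exists a, coef_bound a c /\ tail_bound a c h.

Lemma coef_bound_le a b c : a <= b -> coef_bound a c -> coef_bound b c.
Proof.
move=> ab [a1 ac]; split=> [|k]; first exact: le_trans ab.
apply: le_trans (ac k) _; apply: lerXn2r => //; rewrite nnegrE.
  exact: le_trans ler01 a1.
exact: le_trans ler01 (le_trans a1 ab).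
Qed.

Lemma tail_bound_le a b c h : 1 <= a -> a <= b -> tail_bound a c h -> tail_bound b c h.
Proof.
move=> a1 ab ta t t0 tb n.
have a0 : 0 <= a by exact: le_trans ler01 a1.
apply: le_trans (ta t t0 _ n) _.
  by apply: le_trans tb; apply: ler_wpM2r.
rewrite ler_pM2l // ler_wpM2r ?exprn_ge0 //.
by apply: lerXn2r => //; rewrite nnegrE // (le_trans a0).
Qed.

(** A larger constant a stands for a smaller disc. *)
Lemma expands_near c h (Q : C -> Prop) : expands c h -> near0 Q ->
  exists a, [/\ coef_bound a c, tail_bound a c h &
    forall t, t != 0 -> a * `|t| <= 2^-1 -> Q t].
Proof.
move=> [a [[a1 ac] at_]] /near0P[r r0 H].
have a0 : 0 <= a by exact: le_trans ler01 a1.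
have ab : a <= a + r^-1 by rewrite lerDl invr_ge0 ltW.
exists (a + r^-1); split.
- exact: coef_bound_le (conj a1 ac).
- exact: tail_bound_le at_.
move=> t t0 tb; apply: H => //.
have : r^-1 * `|t| <= 2^-1.
  by apply: le_trans tb; apply: ler_wpM2r => //; rewrite lerDr.
rewrite mulrC ler_pdivrMr // => /le_lt_trans; apply.
by rewrite gtr_pMl // invf_lt1 // ltr1n.
Qed.

Lemma expands_eq c h g : expands c h -> near0 (fun t => h t = g t) -> expands c g.
Proof.
move=> ch hg; have [a [ac at_ aE]] := expands_near ch hg.
exists a; split=> // t t0 ta n; rewrite -aE //; exact: at_.
Qed.

Lemma expands_common c h d g : expands c h -> expands d g ->
  exists a, [/\ coef_bound a c, tail_bound a c h, coef_bound a d & tail_bound a d g].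
Proof.
move=> [a [[a1 ac] at_]] [b [[b1 bd] bt]].
have a0 : 0 <= a by exact: le_trans ler01 a1.
have b0 : 0 <= b by exact: le_trans ler01 b1.
have ab : a <= a + b by rewrite lerDl.
have bb : b <= a + b by rewrite lerDr.
by exists (a + b); split; [exact: (coef_bound_le ab)|exact: (tail_bound_le _ ab)
  |exact: (coef_bound_le bb)|exact: (tail_bound_le _ bb)].
Qed.

(** The factor B is absorbed by replacing a with a B. *)
Lemma expands_weak (a B : C) c h : 1 <= a -> 1 <= B ->
  (forall k, `|c k| <= B * a ^+ k) ->
  (forall t, t != 0 -> a * `|t| <= 2^-1 -> forall n,
    `|h t - psum c t n| <= B * (a ^+ n * `|t| ^+ n)) -> expands c h.
Proof.
move=> a1 B1 ac at_.
have a0 : 0 <= a by exact: le_trans ler01 a1.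
have B0 : 0 <= B by exact: le_trans ler01 B1.
have aBa : a <= a * B by rewrite ler_peMr.
have BaB : B <= a * B by rewrite ler_peMl.
have aB0 : 0 <= a * B by exact: mulr_ge0.
have H k : B * a ^+ k <= (a * B) ^+ k.+1.
  rewrite exprS; apply: ler_pM => //; first exact: exprn_ge0.
  by apply: lerXn2r => //; rewrite nnegrE.
exists (a * B); split.
  by split=> [|k]; [exact: le_trans aBa|exact: le_trans (H k)].
move=> t t0 tb n.
apply: le_trans (at_ t t0 _ n) _.
  by apply: le_trans tb; apply: ler_wpM2r.
rewrite mulrA; apply: le_trans (_ : (a * B) ^+ n.+1 * `|t| ^+ n <= _).
  by apply: ler_wpM2r; [exact: exprn_ge0|exact: H].
by rewrite ler_peMl ?ler1n // mulr_ge0 ?exprn_ge0.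
Qed.

Lemma expands_cst (x : C) : expands (fun k => if k is 0%N then x else 0) (fun=> x).
Proof.
apply: (@expands_weak 1 (1 + `|x|)) => //; first by rewrite lerDl.
  by case=> [|k]; rewrite expr1n mulr1 ?normr0 ?lerDr // addr_ge0.
move=> t t0 tb [|n]; first by rewrite psum0 subr0 !expr0 !mulr1 lerDr.
rewrite /psum big_ord_recl big1 => [|i _]; last by rewrite mul0r.
rewrite addr0 expr0 mulr1 subrr normr0 mulr_ge0 ?addr_ge0 ?mulr_ge0 ?exprn_ge0 //.
Qed.

Lemma expandsN c h : expands c h -> expands (fun k => - c k) (fun t => - h t).
Proof.
move=> [a [[a1 ac] at_]]; exists a; split.
  by split=> // k; rewrite normrN.
move=> t t0 ta n; have -> : - h t - psum (fun k => - c k) t n = - (h t - psum c t n).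
  rewrite opprD; congr (_ - _); rewrite /psum -sumrN.
  by apply: eq_bigr => i _; rewrite mulNr.
by rewrite normrN; exact: at_.
Qed.

Lemma psumD c d t n : psum (fun k => c k + d k) t n = psum c t n + psum d t n.
Proof. by rewrite /psum -big_split; apply: eq_bigr => i _; rewrite mulrDl. Qed.

Lemma expandsD c h d g : expands c h -> expands d g ->
  expands (fun k => c k + d k) (fun t => h t + g t).
Proof.
move=> ch dg; have [a [[a1 ac] at_ [_ ad] dt]] := expands_common ch dg.
have a0 : 0 <= a by exact: le_trans ler01 a1.
apply: (@expands_weak a (4 * a)) => //.
- by rewrite (le_trans a1) // ler_peMl // ler1n.
- move=> k; apply: le_trans (ler_normD _ _) _.
  apply: le_trans (lerD (ac k) (ad k)) _.
  have -> : 4 * a * a ^+ k = 4 * a ^+ k.+1 by rewrite exprS mulrA.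
  have -> : a ^+ k.+1 + a ^+ k.+1 = 2 * a ^+ k.+1 by ring.
  by apply: ler_wpM2r; rewrite ?exprn_ge0 // ler_nat.
- move=> t t0 ta n; rewrite psumD opprD addrACA.
  apply: le_trans (ler_normD _ _) _.
  apply: le_trans (lerD (at_ t t0 ta n) (dt t t0 ta n)) _.
  by rewrite exprS le_eqVlt; apply/orP; left; apply/eqP; ring.
Qed.

Definition conv c d k : C := \sum_(i < k.+1) c i * d (k - i)%N.

Lemma psum_conv c d t n :
  psum (conv c d) t n = \sum_(k < n) c k * t ^+ k * psum d t (n - k).
Proof.
elim: n => [|n IHn]; first by rewrite psum0 big_ord0.
rewrite psumS IHn big_ord_recr /= subSnn psumS psum0 add0r.
rewrite /conv mulr_suml big_ord_recr /= subnn addrA; congr (_ + _); last first.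
  by rewrite expr0 mulr1; ring.
rewrite -big_split; apply: eq_bigr => k _ /=.
rewrite subSn 1?ltnW // psumS mulrDr; congr (_ + _).
have -> : t ^+ n = t ^+ k * t ^+ (n - k) by rewrite -exprD subnKC // ltnW.
by ring.
Qed.

Lemma expandsM c h d g : expands c h -> expands d g ->
  expands (conv c d) (fun t => h t * g t).
Proof.
move=> ch dg; have [a [[a1 ac] at_ [_ ad] dt]] := expands_common ch dg.
have a0 : 0 <= a by exact: le_trans ler01 a1.
have n2 k : k.+1%:R <= 2 ^+ k :> C by rewrite -natrX ler_nat ltn_expl.
have A0 : 0 <= 2 * a by rewrite mulr_ge0.
apply: (@expands_weak (2 * a) (4 * a ^+ 2)) => //.
- by rewrite (le_trans a1) // ler_peMl // ler1n.
- rewrite (le_trans (_ : 1 <= a ^+ 2)) ?exprn_ege1 // ler_peMl ?ler1n //.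
  exact: exprn_ge0.
- move=> k; apply: le_trans (ler_norm_sum _ _ _) _.
  apply: le_trans (_ : \sum_(i < k.+1) a ^+ k.+2 <= _).
    apply: ler_sum => i _; rewrite normrM.
    apply: le_trans (ler_pM _ _ (ac i) (ad _)) _ => //.
    by rewrite -exprD addSn addnS subnKC // -ltnS.
  have -> : 4 * a ^+ 2 * (2 * a) ^+ k = (4 * 2 ^+ k) * a ^+ k.+2.
    by rewrite exprMn -[k.+2]/(2 + k)%N exprD; ring.
  rewrite sumr_const card_ord -[_ *+ k.+1]mulr_natl.
  apply: ler_wpM2r; first exact: exprn_ge0.
  by apply: le_trans (n2 k) _; rewrite ler_peMl ?ler1n // exprn_ge0.
- move=> t t0 ta n.
  have ta' : a * `|t| <= 2^-1.
    by apply: le_trans ta; rewrite -mulrA ler_peMl ?ler1n // mulr_ge0.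
  have -> : h t * g t - psum (conv c d) t n =
      (h t - psum c t n) * g t + \sum_(k < n) c k * t ^+ k * (g t - psum d t (n - k)).
    rewrite psum_conv mulrBl -addrA; congr (_ + _); rewrite /psum mulr_suml.
    by rewrite -sumrN -sumrN -big_split; apply: eq_bigr => k _ /=; ring.
  have gt : `|g t| <= 2 * a.
    by have := dt t t0 ta' 0%N; rewrite psum0 subr0 expr1 expr0 mulr1.
  have tn0 : 0 <= a ^+ n.+2 * `|t| ^+ n by rewrite mulr_ge0 ?exprn_ge0.
  apply: le_trans (_ : 2 * (n.+2%:R * (a ^+ n.+2 * `|t| ^+ n)) <= _).
    apply: le_trans (ler_normD _ _) _.
    have -> : 2 * (n.+2%:R * (a ^+ n.+2 * `|t| ^+ n)) =
        2 * (a ^+ n.+1 * `|t| ^+ n) * (2 * a) + \sum_(k < n) 2 * (a ^+ n.+2 * `|t| ^+ n).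
      rewrite sumr_const card_ord -mulr_natl -addn2 natrD [in RHS]exprS.
      by rewrite !exprS; ring.
    apply: lerD; first by rewrite normrM; apply: ler_pM => //; exact: at_.
    apply: le_trans (ler_norm_sum _ _ _) _; apply: ler_sum => k _.
    rewrite !normrM normrX.
    have := ler_pM _ _ (ler_wpM2r (exprn_ge0 k (normr_ge0 t)) (ac k)) (dt t t0 ta' (n - k)%N).
    move=> /(_ (mulr_ge0 (normr_ge0 _) (exprn_ge0 _ (normr_ge0 _))) (normr_ge0 _)) /le_trans; apply.
    have -> : a ^+ n.+2 = a ^+ k.+1 * a ^+ (n - k).+1.
      by rewrite -exprD addSn addnS subnKC // ltnW.
    have -> : `|t| ^+ n = `|t| ^+ k * `|t| ^+ (n - k) by rewrite -exprD subnKC // ltnW.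
    by rewrite le_eqVlt; apply/orP; left; apply/eqP; ring.
  have -> : 4 * a ^+ 2 * ((2 * a) ^+ n * `|t| ^+ n) = 2 * (2 ^+ n.+1 * (a ^+ n.+2 * `|t| ^+ n)).
    by rewrite exprMn !exprS; ring.
  by rewrite ler_pM2l //; apply: ler_wpM2r.
Qed.

End Expansions.

Section SeriesCalculus.
Variable C : numFieldType.
Implicit Types (c d : nat -> C) (h g : C -> C) (a b t : C) (P : C -> Prop).
Hypothesis archi : forall x : C, exists n : nat, `|x| <= n%:R.
Hypothesis complete : forall u : nat -> C, (forall k, `|u k| <= 2^-1 ^+ k) ->
  exists l : C, series u @ \oo --> l.

Lemma half_pow_small (B e : C) : 0 <= B -> 0 < e -> exists N, B * 2^-1 ^+ N < e.
Proof.
move=> B0 e0; have [N BN] := archi (B / e); exists N.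
rewrite exprVn ltr_pdivrMr ?exprn_gt0 // mulrC -ltr_pdivrMr //.
apply: le_lt_trans (_ : N%:R < _); last by rewrite -natrX ltr_nat ltn_expl.
by apply: le_trans BN; rewrite ger0_norm // divr_ge0 // ltW.
Qed.

Lemma half_pow_le m n : (m <= n)%N -> 2^-1 ^+ n <= 2^-1 ^+ m :> C.
Proof.
move=> mn; rewrite !exprVn lef_pV2 ?posrE ?exprn_gt0 //.
by rewrite ler_weXn2l // ler1n.
Qed.

Lemma eq0_half_pow (B x : C) : 0 <= B -> (forall n, `|x| <= B * 2^-1 ^+ n) -> x = 0.
Proof.
move=> B0 H; apply/eqP; apply: contraT => x0.
have [|N] := @half_pow_small B `|x| B0; first by rewrite normr_gt0.
by move=> /(le_lt_trans (H N)); rewrite ltxx.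
Qed.

Lemma expands_mulX c h : expands c h ->
  expands (fun k => if k is k'.+1 then c k' else 0) (fun t => t * h t).
Proof.
move=> [a [[a1 ac] at_]]; have a0 : 0 <= a by exact: le_trans ler01 a1.
have a2 : 1 <= 2 * a by rewrite (le_trans a1) // ler_peMl // ler1n.
apply: (@expands_weak _ a (2 * a)) => //.
  case=> [|k]; first by rewrite normr0 expr0 mulr1 (le_trans ler01).
  by apply: le_trans (ac k) _; rewrite ler_peMl // exprn_ge0.
move=> t t0 ta [|n].
  have := at_ t t0 ta 0%N; rewrite !psum0 !subr0 !expr0 !mulr1 normrM expr1 => ht.
  apply: le_trans (ler_wpM2l (normr_ge0 t) ht) _.
  have -> : `|t| * (2 * a) = 2 * (a * `|t|) by ring.
  apply: le_trans (ler_wpM2l _ ta) _ => //.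
  by rewrite mulfV // pnatr_eq0.
have -> : psum (fun k => if k is k'.+1 then c k' else 0) t n.+1 = t * psum c t n.
  rewrite /psum big_ord_recl mul0r add0r mulr_sumr; apply: eq_bigr => i _ /=.
  by rewrite exprS mulrCA.
rewrite -mulrBr normrM; apply: le_trans (ler_wpM2l (normr_ge0 t) (at_ t t0 ta n)) _.
have -> : `|t| * (2 * (a ^+ n.+1 * `|t| ^+ n)) = 2 * (a ^+ n.+1 * `|t| ^+ n.+1).
  by rewrite [`|t| ^+ n.+1]exprS; ring.
apply: ler_wpM2r; first by rewrite mulr_ge0 // exprn_ge0.
by rewrite ler_peMr.
Qed.

Lemma expands_shift c h : expands c h ->
  expands (fun k => c k.+1) (fun t => (h t - c 0%N) / t).
Proof.
move=> [a [[a1 ac] at_]]; have a0 : 0 <= a by exact: le_trans ler01 a1.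
have a2 : 1 <= a ^+ 2 by rewrite exprn_ege1.
have aa : 0 <= a ^+ 2 by rewrite exprn_ge0.
apply: (@expands_weak _ a (2 * a ^+ 2)) => //.
- by rewrite (le_trans a2) // ler_peMl // ler1n.
- move=> k; apply: le_trans (ac _) _.
  rewrite -[k.+2]/(2 + k)%N exprD; apply: ler_wpM2r; first exact: exprn_ge0.
  by rewrite ler_peMl // ler1n.
move=> t t0 ta n.
have -> : (h t - c 0%N) / t - psum (fun k => c k.+1) t n = (h t - psum c t n.+1) / t.
  have -> : psum c t n.+1 = c 0%N + t * psum (fun k => c k.+1) t n.
    rewrite /psum big_ord_recl expr0 mulr1 mulr_sumr; congr (_ + _).
    by apply: eq_bigr => i _; rewrite exprS mulrCA.
  by field.
rewrite normrM normfV ler_pdivrMr ?normr_gt0 //; apply: le_trans (at_ t t0 ta _) _.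
rewrite le_eqVlt; apply/orP; left; apply/eqP.
by rewrite -[n.+2]/(2 + n)%N exprD [`|t| ^+ n.+1]exprS; ring.
Qed.

Lemma expands_shiftn c h m : expands c h -> (forall k, (k < m)%N -> c k = 0) ->
  expands (fun k => c (m + k)%N) (fun t => h t / t ^+ m).
Proof.
move=> ch; elim: m => [|m IHm] cm.
  apply: (expands_eq ch); apply: filterE => t; by rewrite expr0 divr1.
have := expands_shift (IHm (fun k km => cm k (ltnW km))).
rewrite addn0 cm // => H.
have -> : (fun k => c (m.+1 + k)%N) = (fun k => c (m + k.+1)%N).
  by apply/funext => k; rewrite addnS addSn.
apply: (expands_eq H); apply: filterE => t.
by rewrite subr0 exprSr invfM mulrA.
Qed.

Lemma expands_lim c h e : expands c h -> 0 < e ->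
  near0 (fun t => `|h t - c 0%N| < e).
Proof.
move=> [a [[a1 ac] at_]] e0; have a0 : 0 < a by exact: lt_le_trans ltr01 a1.
have K0 : 0 < 2 * a ^+ 2 by rewrite mulr_gt0 ?exprn_gt0.
pose r := (2 * a)^-1; have r0 : 0 < r by rewrite invr_gt0 mulr_gt0.
apply: (@near0_imp _ (fun t => t != 0 /\ (`|t| < r /\ `|t| < e / (2 * a ^+ 2)))).
  move=> t [t0 [/ltW tr te]].
  have ta : a * `|t| <= 2^-1.
    by apply: le_trans (ler_wpM2l (ltW a0) tr) _; rewrite /r invfM mulrC mulfVK // gt_eqF.
  have := at_ t t0 ta 1%N; rewrite psumS psum0 add0r expr0 mulr1 => /le_lt_trans; apply.
  by rewrite expr1 mulrA mulrC -ltr_pdivlMr.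
apply: near0_and; first by apply/near0P; exists 1.
by apply: near0_and; apply/near0P; [exists r|exists (e / (2 * a ^+ 2)) => //; rewrite divr_gt0].
Qed.

Lemma expands_neq0 c h : expands c h -> c 0%N != 0 -> near0 (fun t => h t != 0).
Proof.
move=> ch c0; have e0 : 0 < `|c 0%N| by rewrite normr_gt0.
apply: near0_imp (expands_lim ch e0) => t.
by apply: contraTneq => ->; rewrite sub0r normrN ltxx.
Qed.

Lemma expands0_eq0 c h : expands c h -> (forall k, c k = 0) -> near0 (fun t => h t = 0).
Proof.
move=> [a [[a1 ac] at_]] c0; have a0 : 0 < a by exact: lt_le_trans ltr01 a1.
apply/near0P; exists (2 * a)^-1; first by rewrite invr_gt0 mulr_gt0.
move=> t t0 /ltW tr.
have ta : a * `|t| <= 2^-1.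
  by apply: le_trans (ler_wpM2l (ltW a0) tr) _; rewrite invfM mulrC mulfVK // gt_eqF.
apply: (@eq0_half_pow (2 * a)); first by rewrite mulr_ge0 // ltW.
move=> n; have := at_ t t0 ta n; rewrite /psum big1 => [|i _]; last by rewrite c0 mul0r.
rewrite subr0 => /le_trans; apply.
rewrite exprS -mulrA mulrA -exprMn; apply: ler_wpM2l; first by rewrite mulr_ge0 // ltW.
by apply: lerXn2r; rewrite ?nnegrE ?invr_ge0 // mulr_ge0 // ltW.
Qed.

Lemma expands_order c h : expands c h ->
  (forall k, c k = 0) \/ exists m d g,
    [/\ expands d g, d 0%N != 0, near0 (fun t => h t = t ^+ m * g t) & c m != 0].
Proof.
move=> ch; have [c0|/existsNP[k0 /eqP ck0]] := pselect (forall k, c k = 0).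
  by left.
right.
have exk : exists k, c k != 0 by exists k0.
case: (ex_minnP exk) => m cm mmin.
exists m, (fun k => c (m + k)%N), (fun t => h t / t ^+ m); split=> //.
- apply: expands_shiftn => // k km; apply/eqP; apply: contraTT km => /mmin.
  by rewrite -leqNgt.
- by rewrite addn0.
- apply/near0P; exists 1 => // t t0 _; rewrite mulrC mulfVK //.
  by rewrite expf_neq0.
Qed.

Lemma expands_uniq c d h : expands c h -> expands d h -> c = d.
Proof.
move=> ch dh; apply/funext => k.
have := expandsD ch (expandsN dh); case/expands_order => [/(_ k)/eqP|].
  by rewrite subr_eq0 => /eqP.
move=> [m [e [g [eg e0 hg _]]]]; exfalso.
have [t t0 [hgt gt0]] := near0_ex (near0_and hg (expands_neq0 eg e0)).
by have := mulf_neq0 (expf_neq0 m t0) gt0; rewrite -hgt subrr eqxx.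
Qed.

Lemma expands_fun_uniq c h g : expands c h -> expands c g -> near0 (fun t => h t = g t).
Proof.
move=> ch cg; have := expands0_eq0 (expandsD ch (expandsN cg)).
move=> /(_ (fun k => subrr _)); apply: near0_imp => t /eqP.
by rewrite subr_eq0 => /eqP.
Qed.

(** The tail of the geometric series of ratio a |t| <= 1/2; the last factor makes
    the induction on p work. *)
Lemma psum_tail c t a (B : C) : 0 <= a -> 0 <= B -> (forall k, `|c k| <= B * a ^+ k) ->
  a * `|t| <= 2^-1 -> forall n p,
  `|psum c t (n + p) - psum c t n| <= 2 * B * (a ^+ n * `|t| ^+ n) * (1 - 2^-1 ^+ p).
Proof.
move=> a0 B0 cB ta n; elim=> [|p IHp].
  by rewrite addn0 subrr normr0 expr0 subrr mulr0.
rewrite addnS psumS addrAC; apply: le_trans (ler_normD _ _) _.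
apply: le_trans (lerD IHp (_ : _ <= B * (a ^+ n * `|t| ^+ n) * 2^-1 ^+ p)) _.
  rewrite normrM normrX; apply: le_trans (ler_wpM2r (exprn_ge0 _ (normr_ge0 _)) (cB _)) _.
  rewrite -!mulrA; apply: ler_wpM2l => //.
  have -> : a ^+ (n + p) * `|t| ^+ (n + p) = a ^+ n * (`|t| ^+ n * (a * `|t|) ^+ p).
    by rewrite !exprD exprMn; ring.
  do 2![apply: ler_wpM2l; first exact: exprn_ge0].
  by apply: lerXn2r; rewrite // nnegrE ?mulr_ge0 // invr_ge0.
rewrite le_eqVlt; apply/orP; left; apply/eqP; rewrite exprS.
by field.
Qed.

Lemma seriesE c t n : series (fun k => c k * t ^+ k) n = psum c t n.
Proof. by rewrite /series /= big_mkord. Qed.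

Lemma series_tail c t a (B l : C) : 0 <= a -> 0 <= B -> (forall k, `|c k| <= B * a ^+ k) ->
  a * `|t| <= 2^-1 -> series (fun k => c k * t ^+ k) @ \oo --> l ->
  forall n, `|l - psum c t n| <= 2 * B * (a ^+ n * `|t| ^+ n).
Proof.
move=> a0 B0 cB ta cl n; apply/ler_addgt0Pr => e e0.
have [N _ HN] := (cvgrPdist_lt _ _).1 cl e e0.
have := HN (n + N)%N (leq_addl _ _); rewrite /= seriesE => lN.
have -> : l - psum c t n = (psum c t (n + N) - psum c t n) + (l - psum c t (n + N)) by ring.
apply: le_trans (ler_normD _ _) _; apply: lerD (ltW lN).
apply: le_trans (psum_tail a0 B0 cB ta n N) _.
rewrite ler_piMr ?lerBlDr ?lerDl ?exprn_ge0 ?invr_ge0 //.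
by rewrite !mulr_ge0 ?exprn_ge0.
Qed.

Lemma expands_of_series c h a (B : C) : 1 <= a -> 1 <= B ->
  (forall k, `|c k| <= B * a ^+ k) ->
  near0 (fun t => series (fun k => c k * t ^+ k) @ \oo --> h t) -> expands c h.
Proof.
move=> a1 B1 cB /near0P[r r0 H].
have a0 : 0 <= a by exact: le_trans ler01 a1.
have B0 : 0 <= B by exact: le_trans ler01 B1.
have ab : a <= a + r^-1 by rewrite lerDl invr_ge0 ltW.
have cB' k : `|c k| <= B * (a + r^-1) ^+ k.
  apply: le_trans (cB k) _; apply: ler_wpM2l => //; apply: lerXn2r => //.
    by rewrite nnegrE (le_trans a0).
have a'1 : 1 <= a + r^-1 by exact: le_trans ab.
apply: (@expands_weak _ (a + r^-1) (2 * B)) => //.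
- by rewrite (le_trans B1) // ler_peMl // ler1n.
- move=> k; apply: le_trans (cB' k) _; apply: ler_wpM2r.
    by rewrite exprn_ge0 // (le_trans ler01).
  by rewrite ler_peMl // ler1n.
move=> t t0 tb n; apply: series_tail => //; first by rewrite (le_trans a0).
apply: H => //.
have : r^-1 * `|t| <= 2^-1.
  by apply: le_trans tb; apply: ler_wpM2r => //; rewrite lerDr.
rewrite mulrC ler_pdivrMr // => /le_lt_trans; apply.
by rewrite gtr_pMl // invf_lt1 // ltr1n.
Qed.

Lemma exists_expands c a (B : C) : 1 <= a -> 1 <= B ->
  (forall k, `|c k| <= B * a ^+ k) -> exists h, expands c h.
Proof.
move=> a1 B1 cB.
have a0 : 0 < a by exact: lt_le_trans ltr01 a1.
have B0 : 0 < B by exact: lt_le_trans ltr01 B1.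
have ex (t : C) : exists l : C, a * `|t| <= 2^-1 -> series (fun k => c k * t ^+ k) @ \oo --> l.
  have [ta|ta] := boolP (a * `|t| <= 2^-1); last by exists 0.
  have [|l cl] := @complete (fun k => B^-1 * (c k * t ^+ k)).
    move=> k; rewrite normrM normfV (gtr0_norm B0) [_^-1 * _]mulrC ler_pdivrMr // normrM normrX.
    apply: le_trans (ler_wpM2r (exprn_ge0 _ (normr_ge0 _)) (cB _)) _.
    rewrite -mulrA -exprMn mulrC; apply: ler_wpM2r; first exact: ltW.
    by apply: lerXn2r; rewrite ?nnegrE ?invr_ge0 // mulr_ge0 // ltW.
  exists (B * l) => _.
  have -> : series (fun k => c k * t ^+ k) = (fun n => B * series (fun k => B^-1 * (c k * t ^+ k)) n).
    apply/funext => n; rewrite /series /= mulr_sumr; apply: eq_bigr => k _.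
    by rewrite mulrA mulfV ?mul1r // gt_eqF.
  exact: cvgMr.
have [h hP] := choice ex; exists h; apply: (expands_of_series a1 B1 cB).
apply/near0P; exists (2 * a)^-1; first by rewrite invr_gt0 mulr_gt0.
move=> t t0 /ltW tr; apply: hP.
by apply: le_trans (ler_wpM2l (ltW a0) tr) _; rewrite invfM mulrC mulfVK // gt_eqF.
Qed.

(** Convergence at one point t != 0 bounds the c k t ^ k, which gives the geometric
    bound on the coefficients. *)
Lemma expands_of_cvg c h :
  near0 (fun t => series (fun k => c k * t ^+ k) @ \oo --> h t) -> expands c h.
Proof.
move=> H; have [t t0 ct] := near0_ex H.
have [B [B0 HB]] : exists B : C, 0 <= B /\ forall k, `|c k * t ^+ k| <= B.
  have u0 : (fun k => c k * t ^+ k) @ \oo --> (0 : C).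
    by apply: cvg_series_cvg_0; apply/cvg_ex; exists (h t).
  have [N _ HN] := (cvgrPdist_lt _ _).1 u0 1 ltr01.
  exists (1 + \sum_(k < N) `|c k * t ^+ k|); split.
    by apply: addr_ge0 => //; apply: sumr_ge0.
  move=> k; have [Nk|kN] := leqP N k.
    have := HN k Nk; rewrite /= sub0r normrN => /ltW/le_trans; apply.
    by rewrite lerDl sumr_ge0.
  rewrite (bigD1 (Ordinal kN)) //= addrCA lerDl addr_ge0 // sumr_ge0 //.
have t1 : 0 < `|t|^-1 by rewrite invr_gt0 normr_gt0.
apply: (@expands_of_series _ _ (1 + `|t|^-1) (1 + B)) => //; rewrite ?lerDl ?(ltW t1) //.
move=> k; have := HB k; rewrite normrM normrX -ler_pdivlMr ?exprn_gt0 ?normr_gt0 //.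
move=> /le_trans; apply; apply: ler_pM => //; rewrite ?invr_ge0 ?exprn_ge0 ?lerDr //.
rewrite -exprVn; apply: lerXn2r; rewrite ?nnegrE ?addr_ge0 ?(ltW t1) // lerDr.
exact: ler01.
Qed.

End SeriesCalculus.

(** The next term is a function of all the previous ones; the auxiliary L lists
    them. *)
Lemma strong_recursion (T : Type) (x0 : T) (f : nat -> (nat -> T) -> T) :
  (forall k X Y, (forall j, (j <= k)%N -> X j = Y j) -> f k X = f k Y) ->
  exists X, X 0%N = x0 /\ forall k, X k.+1 = f k X.
Proof.
move=> fP.
pose L := fix L k := if k is k'.+1 then rcons (L k') (f k' (nth x0 (L k'))) else [:: x0].
have sL k : size (L k) = k.+1 by elim: k => //= k IHk; rewrite size_rcons IHk.
have nL k j i : (j <= k)%N -> nth x0 (L (k + i)%N) j = nth x0 (L k) j.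
  move=> jk; elim: i => [|i IHi]; first by rewrite addn0.
  by rewrite addnS /= nth_rcons sL ltnS (leq_trans jk) ?leq_addr.
exists (fun k => nth x0 (L k) k); split=> // k.
rewrite /= nth_rcons sL ltnn eqxx; apply: fP => j jk.
by rewrite -(subnKC jk) nL.
Qed.

Section Recursion.
Variable C : numFieldType.
Implicit Types (c d : nat -> C) (h g : C -> C) (a b t : C) (P : C -> Prop).
Hypothesis archi : forall x : C, exists n : nat, `|x| <= n%:R.
Hypothesis complete : forall u : nat -> C, (forall k, `|u k| <= 2^-1 ^+ k) ->
  exists l : C, series u @ \oo --> l.

Lemma sum_half n : \sum_(k < n) 2^-1 ^+ k <= 2 :> C.
Proof.
have -> : \sum_(k < n) 2^-1 ^+ k = 2 - 2 * 2^-1 ^+ n :> C.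
  elim: n => [|n IHn]; first by rewrite big_ord0 expr0 mulr1 subrr.
  by rewrite big_ord_recr IHn /= exprS; field.
by rewrite lerBlDr lerDl mulr_ge0 // exprn_ge0 // invr_ge0.
Qed.

(** The majorant argument: if the A j grow at most like a ^ j, then X grows at most
    like b ^ k with b = 2 (m + 1) a, by induction on k. With lam k = 1 / (k + 1) this
    is the recursion for the power series solutions of X' = A X, and with lam k = 1
    the one for the inverse of a power series. *)
Lemma linear_recursion m p (A : nat -> 'M[C]_m) (lam : nat -> C) (X0 : 'M[C]_(m, p)) a :
  1 <= a -> (forall j i l, `|A j i l| <= a ^+ j.+1) -> (forall k, `|lam k| <= 1) ->
  exists X : nat -> 'M[C]_(m, p), [/\ X 0%N = X0,
    forall k, X k.+1 = lam k *: \sum_(j < k.+1) A j *m X (k - j)%N &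
    exists b B : C, [/\ 1 <= b, 1 <= B & forall k i l, `|X k i l| <= B * b ^+ k]].
Proof.
move=> a1 Aa lam1; have a0 : 0 <= a by exact: le_trans ler01 a1.
have [|X [XE XS]] := @strong_recursion _ X0
    (fun k X => lam k *: \sum_(j < k.+1) A j *m X (k - j)%N).
  move=> k X Y XY; congr (_ *: _); apply: eq_bigr => j _.
  by rewrite XY // leq_subr.
exists X; split=> //.
pose b := 2 * m.+1%:R * a.
pose B := 1 + \sum_i \sum_l `|X0 i l|.
have m1 : 1 <= m.+1%:R :> C by rewrite ler1n.
have b1 : 1 <= b.
  apply: (le_trans a1); rewrite ler_peMl //.
  by apply: (le_trans m1); rewrite ler_peMl ?ler1n // ler0n.
have b0 : 0 <= b by exact: le_trans ler01 b1.
have B1 : 1 <= B by rewrite lerDl; do 2?apply: sumr_ge0 => ? _.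
have B0 : 0 <= B by exact: le_trans ler01 B1.
exists b, B; split=> // k; have [n] := ubnP k; elim: n k => // n IHn [|k].
  move=> _ i l; rewrite XE expr0 mulr1 /B (bigD1 i) //= (bigD1 l) //=.
  by rewrite -!addrA [leRHS]addrCA lerDl !addr_ge0 //; do 2?apply: sumr_ge0 => ? _.
rewrite ltnS => kn i l; rewrite XS mxE normrM.
apply: le_trans (ler_pM _ _ (lam1 k) (lexx _)) _ => //; rewrite mul1r summxE.
apply: le_trans (ler_norm_sum _ _ _) _.
have step (j : 'I_k.+1) : `|(A j *m X (k - j)%N) i l| <= B * b ^+ k.+1 * (2^-1 * 2^-1 ^+ j).
  rewrite mxE; apply: le_trans (ler_norm_sum _ _ _) _.
  apply: le_trans (_ : \sum_(r < m) a ^+ j.+1 * (B * b ^+ (k - j)) <= _).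
    apply: ler_sum => r _; rewrite normrM; apply: ler_pM => //.
    by apply: IHn; apply: leq_trans kn; rewrite ltnS leq_subr.
  rewrite sumr_const card_ord -[_ *+ m]mulr_natl.
  have jk : (j <= k)%N by rewrite -ltnS.
  have -> : B * b ^+ k.+1 * (2^-1 * 2^-1 ^+ j) =
      (m.+1%:R ^+ j.+1) * (a ^+ j.+1 * (B * b ^+ (k - j))).
    have -> : b ^+ k.+1 = b ^+ j.+1 * b ^+ (k - j) by rewrite -exprD addSn subnKC.
    have -> : b ^+ j.+1 = 2 ^+ j.+1 * (m.+1%:R ^+ j.+1 * a ^+ j.+1) by rewrite /b !exprMn mulrA.
    have h2 : 2 ^+ j.+1 * (2^-1 * 2^-1 ^+ j) = 1 :> C.
      by rewrite -exprS -exprMn mulfV ?expr1n // pnatr_eq0.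
    have key (D x y u v w : C) : x * y = 1 ->
        D * (x * (u * w) * v) * y = u * (w * (D * v)).
      by move=> xy; transitivity ((x * y) * (u * (w * (D * v)))); [ring|rewrite xy mul1r].
    exact: key.
  apply: ler_wpM2r; first by rewrite !mulr_ge0 ?exprn_ge0.
  apply: (@le_trans _ _ m.+1%:R); first by rewrite ler_nat.
  by rewrite exprS ler_peMr ?ler0n // exprn_ege1.
apply: le_trans (ler_sum _ (fun j _ => step j)) _.
rewrite -mulr_sumr -mulr_sumr ler_piMr ?mulr_ge0 ?exprn_ge0 //.
by rewrite mulrC ler_pdivrMr // mul1r; exact: sum_half.
Qed.

Lemma expands_inv c h : expands c h -> c 0%N != 0 ->
  exists d, expands d (fun t => (h t)^-1).
Proof.
move=> ch c0; have [a [[a1 ac] _]] := ch.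
have a0 : 0 <= a by exact: le_trans ler01 a1.
have u1 : 1 <= 1 + `|c 0%N|^-1 by rewrite lerDl invr_ge0.
have [|||X [X0 XS [b [B [b1 B1 XB]]]]] := @linear_recursion 1 1
   (fun j => (- (c j.+1 / c 0%N))%:M) (fun=> 1) (c 0%N)^-1%:M (a ^+ 2 * (1 + `|c 0%N|^-1)).
- by rewrite mulr_ege1 // exprn_ege1.
- move=> j i l; rewrite !ord1 mxE eqxx mulr1n normrN normrM normfV.
  rewrite exprMn; apply: ler_pM; rewrite ?invr_ge0 //.
    apply: le_trans (ac _) _; rewrite -exprM; apply: ler_weXn2l => //.
    by rewrite mulnC muln2 -addnn addnS addSn ltnS ltnS leq_addr.
  by apply: (@le_trans _ _ (1 + `|c 0%N|^-1)); rewrite ?lerDr // ler_eXnr.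
- by move=> k; rewrite normr1.
pose d k := X k 0 0.
have [g dg] : exists g, expands d g.
  by apply: (exists_expands complete b1 B1) => k; exact: XB.
have convE : conv c d = (fun k => if k is 0%N then 1 else 0).
  apply/funext => -[|k]; rewrite /conv.
    by rewrite big_ord_recl big_ord0 addr0 /d X0 mxE eqxx mulr1n mulfV.
  rewrite big_ord_recl subn0 [d k.+1]/d XS scale1r summxE mulr_sumr -big_split.
  apply: big1 => j _ /=; rewrite mul_scalar_mx mxE /d /bump /= add1n subSS.
  by rewrite mulrA mulrN mulrCA mulfV // mulr1 mulNr addNr.
have := expandsM ch dg; rewrite convE => hg1.
have hg := expands_fun_uniq archi hg1 (expands_cst 1).
exists d; apply: (expands_eq dg).
apply: near0_imp (near0_and hg (expands_neq0 ch c0)) => t [hg' h0].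
by rewrite -[LHS]mul1r -(mulVf h0) -mulrA hg' mulr1.
Qed.

(** The second order remainder of t ^ k; the factor r ^ 2 avoids divisions. *)
Lemma power_remainder t s (r : C) k : 0 <= r -> `|t| <= r -> `|t + s| <= r ->
  `|(t + s) ^+ k - t ^+ k - s * (k%:R * t ^+ k.-1)| * r ^+ 2 <= `|s| ^+ 2 * (4 * r) ^+ k.
Proof.
move=> r0 tr tsr; elim: k => [|k IHk].
  by rewrite !expr0 subrr mul0r mulr0 subr0 normr0 mul0r mulr1 exprn_ge0.
have k4 : k%:R <= 4 ^+ k :> C by rewrite -natrX ler_nat ltnW // ltn_expl.
have -> : (t + s) ^+ k.+1 - t ^+ k.+1 - s * (k.+1%:R * t ^+ k) =
   (t + s) * ((t + s) ^+ k - t ^+ k - s * (k%:R * t ^+ k.-1)) + s ^+ 2 * (k%:R * t ^+ k.-1).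
  rewrite !exprS; case: k {IHk k4} => [|k]; first by rewrite !expr0; ring.
  by rewrite /= [t ^+ k.+1]exprS -[in k.+2%:R]natr1; ring.
apply: le_trans (ler_wpM2r _ (ler_normD _ _)) _; first exact: exprn_ge0.
rewrite mulrDl !normrM -mulrA.
apply: le_trans (lerD (ler_pM _ _ tsr IHk)
   (_ : _ <= `|s| ^+ 2 * (r ^+ k.+1 * 4 ^+ k))) _ => //.
- by rewrite mulr_ge0 // exprn_ge0.
- rewrite -[`|s| * `|s|]expr2 normrX -mulrA; apply: ler_wpM2l; first exact: exprn_ge0.
  rewrite normr_nat; case: k k4 {IHk} => [|k] k4.
    by rewrite !mul0r !mulr_ge0 ?exprn_ge0.
  rewrite /= -mulrA mulrC; apply: ler_pM => //.
    by rewrite mulr_ge0 ?exprn_ge0.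
  rewrite -[k.+2]addn2 exprD; apply: ler_wpM2r; first exact: exprn_ge0.
  by apply: lerXn2r.
have -> : `|s| ^+ 2 * (4 * r) ^+ k.+1 = `|s| ^+ 2 * (r ^+ k.+1 * 4 ^+ k) * 4.
  by rewrite exprMn [4 ^+ k.+1]exprSr; move: (4 ^+ k) (r ^+ k.+1) => x y; ring.
have -> : r * (`|s| ^+ 2 * (4 * r) ^+ k) = `|s| ^+ 2 * (r ^+ k.+1 * 4 ^+ k).
  by rewrite exprMn [r ^+ k.+1]exprS; move: (4 ^+ k) (r ^+ k) => x y; ring.
rewrite -[leLHS]mulr2n -[leLHS]mulr_natr; apply: ler_wpM2l; last by rewrite ler_nat.
by rewrite !mulr_ge0 ?exprn_ge0.
Qed.

Lemma is_derive_of_bound h t (D K r : C) : 0 <= K -> 0 < r ->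
  (forall s, s != 0 -> `|s| < r -> `|h (t + s) - h t - s * D| <= K * `|s| ^+ 2) ->
  is_derive t 1 h D.
Proof.
move=> K0 r0 H.
have cv : (fun s => s^-1 *: (h (s *: (1 : C) + t) - h t)) @ 0^' --> D.
  apply/cvgrPdist_lt => e e0.
  have K1 : 0 < K + 1 by rewrite ltr_wpDl.
  apply: (@near0_imp _ (fun s => s != 0 /\ (`|s| < r /\ `|s| < e / (K + 1)))).
    move=> s [s0 [sr se]].
    have -> : D - s^-1 *: (h (s *: (1 : C) + t) - h t) = - (s^-1 * (h (t + s) - h t - s * D)).
      rewrite -[s *: (1 : C)]/(s * 1) mulr1 [s + t]addrC -[s^-1 *: _]/(s^-1 * _).
      by field.
    rewrite normrN normrM normfV mulrC ltr_pdivrMr ?normr_gt0 //.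
    apply: le_lt_trans (H s s0 sr) _; rewrite expr2 mulrA.
    rewrite ltr_pM2r ?normr_gt0 // mulrC.
    apply: le_lt_trans (_ : `|s| * (K + 1) < e); first by rewrite ler_wpM2l // lerDl.
    by rewrite -ltr_pdivlMr.
  apply: near0_and; first by apply/near0P; exists 1.
  by apply: near0_and; apply/near0P; [exists r|exists (e / (K + 1)) => //; rewrite divr_gt0].
have dh : derivable h t 1 by apply/cvg_ex; exists D.
by split=> //; apply: cvg_lim.
Qed.

(** Termwise differentiation: the series of the second order remainders of the
    c k t ^ k converges and is O(s ^ 2), uniformly in the truncation order N; then N
    tends to infinity. *)
Lemma expands_deriv c h : expands c h -> exists2 g,
  expands (fun k => k.+1%:R * c k.+1) g & near0 (fun t => is_derive t 1 h (g t)).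
Proof.
move=> ch; have [a0 [[a01 a0c] _]] := ch.
have a00 : 0 <= a0 by exact: le_trans ler01 a01.
have [g dg] : exists g, expands (fun k => k.+1%:R * c k.+1) g.
  apply: (@exists_expands _ complete _ (2 * a0) (a0 ^+ 2)).
  - by rewrite (le_trans a01) // ler_peMl // ler1n.
  - by rewrite exprn_ege1.
  move=> k; rewrite normrM normr_nat exprMn mulrCA; apply: ler_pM => //.
    by rewrite -natrX ler_nat ltn_expl.
  by apply: le_trans (a0c _) _; rewrite -exprD.
exists g => //.
have [a [[a1 ac] at_ _ gt]] := expands_common ch dg.
have ap : 0 < a by exact: lt_le_trans ltr01 a1.
(* for |t + s| <= r the remainders decrease like (4 a r) ^ k = 2 ^ -k *)
pose r := (8 * a)^-1; have r0 : 0 < r by rewrite invr_gt0 mulr_gt0.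
have ar : a * r = 8^-1 by rewrite /r invfM mulrC mulfVK // gt_eqF.
have ar2 t : `|t| <= r -> a * `|t| <= 2^-1.
  move=> tr; apply: le_trans (ler_wpM2l (ltW ap) tr) _; rewrite ar.
  by rewrite lef_pV2 ?posrE // ler_nat.
apply/near0P; exists (r / 2); first by rewrite divr_gt0.
move=> t t0 tr2.
have tr : `|t| <= r.
  by apply: le_trans (ltW tr2) _; rewrite ler_pdivrMr // ler_peMr ?ler1n // ltW.
apply: (@is_derive_of_bound _ _ _ (2 * a / r ^+ 2) `|t|).
- by rewrite !mulr_ge0 ?invr_ge0 ?exprn_ge0 // ltW.
- by rewrite normr_gt0.
move=> s s0 st.
have ts0 : t + s != 0.
  apply: contraTneq st => ts; have -> : s = - t by apply/eqP; rewrite -addr_eq0 addrC ts.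
  by rewrite normrN ltxx.
have tsr : `|t + s| <= r.
  apply: le_trans (ler_normD _ _) _; apply: le_trans (lerD (ltW tr2) (ltW (lt_trans st tr2))) _.
  by have -> : r / 2 + r / 2 = r by field.
apply/ler_addgt0Pr => e e0.
have [|N HN] := @half_pow_small _ archi (2 * a * (2 + `|s|)) e _ e0.
  by rewrite !mulr_ge0 ?addr_ge0 // ltW.
have tail (f : C -> C) (u : nat -> C) x : tail_bound a u f -> x != 0 -> `|x| <= r ->
    forall n, `|f x - psum u x n| <= 2 * a * 2^-1 ^+ n.
  move=> fu x0 xr n; apply: le_trans (fu x x0 (ar2 x xr) n) _.
  rewrite exprS -mulrA mulrA -exprMn; apply: ler_wpM2l; first by rewrite mulr_ge0 // ltW.
  by apply: lerXn2r; rewrite ?nnegrE ?invr_ge0 ?mulr_ge0 // ?(ltW ap) // ar2.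
have -> : h (t + s) - h t - s * g t =
    \sum_(k < N.+1) c k * ((t + s) ^+ k - t ^+ k - s * (k%:R * t ^+ k.-1)) +
    ((h (t + s) - psum c (t + s) N.+1) - (h t - psum c t N.+1)
     - s * (g t - psum (fun k => k.+1%:R * c k.+1) t N)).
  have -> : \sum_(k < N.+1) c k * ((t + s) ^+ k - t ^+ k - s * (k%:R * t ^+ k.-1)) =
     psum c (t + s) N.+1 - psum c t N.+1 - s * psum (fun k => k.+1%:R * c k.+1) t N.
    have -> : psum (fun k => k.+1%:R * c k.+1) t N = \sum_(k < N.+1) c k * (k%:R * t ^+ k.-1).
      rewrite big_ord_recl /= mul0r mulr0 add0r; apply: eq_bigr => k _.
      by rewrite /= mulrCA mulrA.
    rewrite /psum mulr_sumr -!sumrB; apply: eq_bigr => k _; ring.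
  ring.
apply: le_trans (ler_normD _ _) _; apply: lerD.
  apply: le_trans (ler_norm_sum _ _ _) _.
  apply: le_trans (_ : \sum_(k < N.+1) (a * `|s| ^+ 2 / r ^+ 2) * 2^-1 ^+ k <= _).
    apply: ler_sum => k _; rewrite normrM.
    have := power_remainder k (ltW r0) tr tsr; rewrite -ler_pdivlMr ?exprn_gt0 // => pr.
    apply: le_trans (ler_pM _ _ (ac k) pr) _ => //.
    have -> : 2^-1 ^+ k = (4 * (a * r)) ^+ k by rewrite ar; congr (_ ^+ _); field.
    rewrite !exprMn exprS le_eqVlt; apply/orP; left; apply/eqP; ring.
  rewrite -mulr_sumr; have -> : 2 * a / r ^+ 2 * `|s| ^+ 2 = a * `|s| ^+ 2 / r ^+ 2 * 2 by ring.
  apply: ler_wpM2l; last exact: sum_half.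
  by rewrite !mulr_ge0 ?invr_ge0 ?exprn_ge0 // ltW.
apply: le_trans _ (ltW HN); apply: le_trans (ler_normB _ _) _.
have -> : 2 * a * (2 + `|s|) * 2^-1 ^+ N =
    (2 * a * 2^-1 ^+ N + 2 * a * 2^-1 ^+ N) + `|s| * (2 * a * 2^-1 ^+ N) by ring.
have hS : 2 * a * 2^-1 ^+ N.+1 <= 2 * a * 2^-1 ^+ N.
  by apply: ler_wpM2l; [rewrite mulr_ge0 // ltW|exact: half_pow_le].
apply: lerD.
  apply: le_trans (ler_normB _ _) _.
  by apply: lerD; apply: le_trans hS; apply: tail.
by rewrite normrM; apply: ler_wpM2l => //; apply: tail.
Qed.

End Recursion.

(** * Holomorphic and meromorphic germs *)

(** The properties of the complex numbers that the local theory relies on. *)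
Record completeField := CompleteField {
  cf_sort :> numClosedFieldType;
  cf_archi : forall x : cf_sort, exists n : nat, `|x| <= n%:R;
  cf_complete : forall u : nat -> cf_sort, (forall k, `|u k| <= 2^-1 ^+ k) ->
    exists l : cf_sort, series u @ \oo --> l;
  cf_uncountable : ~ countable [set: cf_sort] }.

Section Germs.
Variable C : completeField.
Implicit Types (h g f : C -> C) (t x y : C).
Let archi := @cf_archi C.
Let complete := @cf_complete C.

(** h extends holomorphically to 0, with value x. *)
Definition holov h x := exists2 c, expands c h & c 0%N = x.

Lemma holov_eq h g x : holov h x -> near0 (fun t => h t = g t) -> holov g x.
Proof. by move=> [c ch cx] hg; exists c => //; apply: expands_eq hg. Qed.

Lemma holov_cst x : holov (fun=> x) x.
Proof. by exists (fun k => if k is 0%N then x else 0) => //; apply: expands_cst. Qed.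

Lemma holovD h g x y : holov h x -> holov g y -> holov (fun t => h t + g t) (x + y).
Proof.
by move=> [c ch cx] [d dg dy]; exists (fun k => c k + d k); [apply: expandsD|rewrite cx dy].
Qed.

Lemma holovN h x : holov h x -> holov (fun t => - h t) (- x).
Proof. by move=> [c ch cx]; exists (fun k => - c k); [apply: expandsN|rewrite cx]. Qed.

Lemma holovM h g x y : holov h x -> holov g y -> holov (fun t => h t * g t) (x * y).
Proof.
move=> [c ch cx] [d dg dy]; exists (conv c d); first exact: expandsM.
by rewrite /conv big_ord_recl big_ord0 addr0 cx dy.
Qed.

Lemma holov_id : holov id 0.
Proof.
have := expands_mulX (expands_cst (1 : C)) => H.
exists (fun k => if k is k'.+1 then if k' is 0%N then 1 else 0 else 0) => //.
by apply: expands_eq H _; apply: filterE => t; rewrite mulr1.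
Qed.

Lemma holovX h x n : holov h x -> holov (fun t => h t ^+ n) (x ^+ n).
Proof.
move=> hx; elim: n => [|n IHn].
  by rewrite expr0; apply: holov_eq (holov_cst 1) _; apply: filterE => t; rewrite expr0.
rewrite exprS; apply: holov_eq (holovM hx IHn) _.
by apply: filterE => t; rewrite exprS.
Qed.

Lemma holov_sum (I : Type) (r : seq I) (P : pred I) (h : I -> C -> C) (x : I -> C) :
  (forall i, P i -> holov (h i) (x i)) ->
  holov (fun t => \sum_(i <- r | P i) h i t) (\sum_(i <- r | P i) x i).
Proof.
move=> hx; elim: r => [|i r IHr].
  by rewrite big_nil; apply: holov_eq (holov_cst 0) _; apply: filterE => t; rewrite big_nil.
rewrite big_cons; case: ifP => Pi.
  by apply: holov_eq (holovD (hx _ Pi) IHr) _; apply: filterE => t; rewrite big_cons Pi.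
by apply: holov_eq IHr _; apply: filterE => t; rewrite big_cons Pi.
Qed.

Lemma holov_prod (I : Type) (r : seq I) (P : pred I) (h : I -> C -> C) (x : I -> C) :
  (forall i, P i -> holov (h i) (x i)) ->
  holov (fun t => \prod_(i <- r | P i) h i t) (\prod_(i <- r | P i) x i).
Proof.
move=> hx; elim: r => [|i r IHr].
  by rewrite big_nil; apply: holov_eq (holov_cst 1) _; apply: filterE => t; rewrite big_nil.
rewrite big_cons; case: ifP => Pi.
  by apply: holov_eq (holovM (hx _ Pi) IHr) _; apply: filterE => t; rewrite big_cons Pi.
by apply: holov_eq IHr _; apply: filterE => t; rewrite big_cons Pi.
Qed.

Lemma holov_uniq h x y : holov h x -> holov h y -> x = y.
Proof. by move=> [c ch <-] [d dh <-]; rewrite (expands_uniq ch dh). Qed.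

Lemma holov_neq0 h x : holov h x -> x != 0 -> near0 (fun t => h t != 0).
Proof. by move=> [c ch <-]; exact: expands_neq0. Qed.

Lemma holov_cvg h x : holov h x -> h @ 0^' --> x.
Proof.
move=> [c ch cx]; apply/cvgrPdist_lt => e e0.
by apply: near0_imp (expands_lim ch e0) => t; rewrite cx distrC.
Qed.

Lemma holovV h x : holov h x -> x != 0 -> holov (fun t => (h t)^-1) x^-1.
Proof.
move=> hx x0; have hN := holov_neq0 hx x0; have [c ch cx] := hx.
have [|d dg] := expands_inv archi complete ch; first by rewrite cx.
suff <- : d 0%N = x^-1 by exists d.
have hg : holov (fun t => h t * (h t)^-1) (x * d 0%N) by apply: holovM; [|exists d].
have h1 : holov (fun t => h t * (h t)^-1) 1.
  by apply: holov_eq (holov_cst 1) _; apply: near0_imp hN => t h0; rewrite mulfV.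
by apply: (mulfI x0); rewrite (holov_uniq hg h1) mulfV.
Qed.

Definition holo h := exists c, expands c h.

Lemma holoE h : holo h <-> exists x, holov h x.
Proof. by split=> [[c ch]|[x [c ch _]]]; [exists (c 0%N), c|exists c]. Qed.

Lemma holov_holo h x : holov h x -> holo h.
Proof. by move=> [c]; exists c. Qed.

Lemma holo_eq h g : holo h -> near0 (fun t => h t = g t) -> holo g.
Proof. by move=> [c ch] hg; exists c; apply: expands_eq hg. Qed.

Lemma holoD h g : holo h -> holo g -> holo (fun t => h t + g t).
Proof. by move=> /holoE[x hx] /holoE[y gy]; apply/holoE; exists (x + y); apply: holovD. Qed.

Lemma holoM h g : holo h -> holo g -> holo (fun t => h t * g t).
Proof. by move=> /holoE[x hx] /holoE[y gy]; apply/holoE; exists (x * y); apply: holovM. Qed.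

Lemma holoN h : holo h -> holo (fun t => - h t).
Proof. by move=> /holoE[x hx]; apply/holoE; exists (- x); apply: holovN. Qed.

Lemma holo_cst x : holo (fun=> x).
Proof. by apply/holoE; exists x; apply: holov_cst. Qed.

Lemma holoX n : holo (fun t => t ^+ n).
Proof. exact: (holov_holo (holovX n holov_id)). Qed.

Lemma near0_neq0 : near0 (fun t => t != 0).
Proof. by apply/near0P; exists 1. Qed.

Lemma near0_open P : near0 P -> near0 (fun t => \forall s \near t, P s).
Proof.
move=> /near0P[e e0 H]; apply/near0P; exists e => // t t0 te.
have r1 : \forall s \near t, `|t - s| < `|t|.
  by apply: (nbhsx_ballx t `|t|); rewrite normr_gt0.
have r2 : \forall s \near t, `|t - s| < e - `|t|.
  by apply: (nbhsx_ballx t (e - `|t|)); rewrite subr_gt0.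
apply: filterS2 r1 r2 => s s1 s2; apply: H.
  by apply: contraTneq s1 => ->; rewrite subr0 ltxx.
have -> : s = t - (t - s) by rewrite opprB addrC subrK.
by apply: le_lt_trans (ler_normB _ _) _; rewrite addrC -ltrBrDr.
Qed.

Lemma near0_forall (I : finType) (P : I -> C -> Prop) :
  (forall i, near0 (P i)) -> near0 (fun t => forall i, P i t).
Proof.
move=> HP; have : near0 (fun t => forall i, i \in enum I -> P i t).
  elim: (enum I) => [|i r IHr]; first by apply: filterE.
  apply: near0_imp (near0_and (HP i) IHr) => t [Pi Pr] j.
  by rewrite inE => /orP[/eqP -> //|/Pr].
by apply: near0_imp => t Pt i; apply: Pt; rewrite mem_enum.
Qed.

Definition mero h := exists N, holo (fun t => t ^+ N * h t).

Lemma mero_eq h g : mero h -> near0 (fun t => h t = g t) -> mero g.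
Proof.
move=> [N hN] hg; exists N; apply: holo_eq hN _.
by apply: near0_imp hg => t ->.
Qed.

Lemma holo_mero h : holo h -> mero h.
Proof.
by exists 0%N; apply: holo_eq H _; apply: filterE => t; rewrite expr0 mul1r.
Qed.

Lemma mero_cst x : mero (fun=> x).
Proof. exact: holo_mero (holo_cst x). Qed.

Lemma mero_le h N m : holo (fun t => t ^+ N * h t) -> holo (fun t => t ^+ (m + N) * h t).
Proof.
move=> hN; apply: holo_eq (holoM (holoX m) hN) _.
by apply: filterE => t; rewrite mulrA exprD.
Qed.

Lemma meroD h g : mero h -> mero g -> mero (fun t => h t + g t).
Proof.
move=> [N hN] [m gm]; exists (m + N)%N.
have hh := mero_le m hN; have gg := mero_le N gm; rewrite addnC in gg.
by apply: holo_eq (holoD hh gg) _; apply: filterE => t; rewrite mulrDr.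
Qed.

Lemma meroN h : mero h -> mero (fun t => - h t).
Proof.
move=> [N hN]; exists N; apply: holo_eq (holoN hN) _.
by apply: filterE => t; rewrite mulrN.
Qed.

Lemma meroM h g : mero h -> mero g -> mero (fun t => h t * g t).
Proof.
move=> [N hN] [m gm]; exists (N + m)%N; apply: holo_eq (holoM hN gm) _.
by apply: filterE => t; rewrite exprD; ring.
Qed.

(** Laurent expansion: unless it vanishes, h is t ^ (m - N) times a unit. *)
Lemma mero_normal h : mero h -> near0 (fun t => h t = 0) \/
  exists m N g x, [/\ holov g x, x != 0 & near0 (fun t => h t = t ^+ m * g t / t ^+ N)].
Proof.
move=> [N [c ch]].
have hN t : t != 0 -> h t = t ^+ N * h t / t ^+ N by move=> t0; rewrite mulrC mulKf // expf_neq0.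
have [c0|[m [d [g [dg d0 hg cm]]]]] := expands_order ch.
  left; apply: near0_imp (near0_and near0_neq0 (expands0_eq0 archi ch c0)) => t [t0 h0].
  by rewrite hN // h0 mul0r.
right; exists m, N, g, (d 0%N); split=> //; first by exists d.
by apply: near0_imp (near0_and near0_neq0 hg) => t [t0 h0]; rewrite hN // h0.
Qed.

(** Zeros are isolated. *)
Lemma mero_eq0_or_neq0 h : mero h -> near0 (fun t => h t = 0) \/ near0 (fun t => h t != 0).
Proof.
move=> /mero_normal[h0|[m [N [g [x [gx x0 hg]]]]]]; [by left|right].
apply: near0_imp (near0_and near0_neq0 (near0_and hg (holov_neq0 gx x0))) => t [t0 [-> gt]].
by rewrite !mulf_neq0 ?invr_eq0 ?expf_neq0.
Qed.

Lemma meroV h : mero h -> mero (fun t => (h t)^-1).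
Proof.
move=> /mero_normal[h0|[m [N [g [x [gx x0 hg]]]]]].
  by apply: mero_eq (mero_cst 0) _; apply: near0_imp h0 => t ->; rewrite invr0.
exists m; apply: holo_eq (holoM (holoX N) (holov_holo (holovV gx x0))) _.
apply: near0_imp (near0_and near0_neq0 hg) => t [t0 ->].
have key (a b u : C) : a != 0 -> b * u = a * (a^-1 * u * b) by move=> a0; field.
by rewrite !invfM invrK; apply: key; rewrite expf_neq0.
Qed.

Definition der f t x := is_derive t 1 f x.

Lemma der_ddx f t x : der f t x -> derive1 f t = x.
Proof. by move=> [_ <-]; rewrite derive1E. Qed.

Lemma der_uniq f t x y : der f t x -> der f t y -> x = y.
Proof. by move=> /der_ddx <- /der_ddx. Qed.

Lemma der_near f g t x : (\forall s \near t, f s = g s) -> der f t x -> der g t x.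
Proof. exact: near_eq_is_derive. Qed.

Lemma der_ext f g t x : f =1 g -> der f t x -> der g t x.
Proof. by move=> /funext ->. Qed.

Lemma der_cst x t : der (fun=> x) t 0.
Proof. exact: is_derive_cst. Qed.

Lemma der_id t : der id t 1.
Proof. exact: is_derive_id. Qed.

Lemma derD f g t x y : der f t x -> der g t y -> der (fun s => f s + g s) t (x + y).
Proof. exact: is_deriveD. Qed.

Lemma derN f t x : der f t x -> der (fun s => - f s) t (- x).
Proof. exact: is_deriveN. Qed.

Lemma derM f g t x y : der f t x -> der g t y ->
  der (fun s => f s * g s) t (x * g t + f t * y).
Proof.
move=> fx gy; have := @is_deriveM _ _ f g t 1 x y fx gy.
by rewrite -[_ *: y]/(_ * y) -[_ *: x]/(_ * x) addrC [g t * x]mulrC.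
Qed.

Lemma derV f t x : f t != 0 -> der f t x -> der (fun s => (f s)^-1) t (- x / f t ^+ 2).
Proof.
move=> f0 [df <-]; split; first exact: derivableV.
by rewrite deriveV // -[_ *: _]/(_ * _) mulNr mulNr mulrC.
Qed.

Lemma derX t n : der (fun s => s ^+ n) t (n%:R * t ^+ n.-1).
Proof.
elim: n => [|n IHn]; first by rewrite mul0r; apply: der_ext (der_cst 1 t) => s; rewrite expr0.
have := derM (der_id t) IHn => H.
have -> : n.+1%:R * t ^+ n.+1.-1 = 1 * t ^+ n + t * (n%:R * t ^+ n.-1).
  case: n {IHn H} => [|n]; first by rewrite !expr0; ring.
  by rewrite /= [t ^+ n.+1]exprS -natr1; ring.
by apply: der_ext H => s; rewrite exprS.
Qed.

Lemma der_sum (I : Type) (r : seq I) (P : pred I) (f : I -> C -> C) (x : I -> C) t :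
  (forall i, P i -> der (f i) t (x i)) ->
  der (fun s => \sum_(i <- r | P i) f i s) t (\sum_(i <- r | P i) x i).
Proof.
move=> fx; elim: r => [|i r IHr].
  by rewrite big_nil; apply: der_ext (der_cst 0 t) => s; rewrite big_nil.
rewrite big_cons; case: ifP => Pi.
  by apply: der_ext (derD (fx _ Pi) IHr) => s; rewrite big_cons Pi.
by apply: der_ext IHr => s; rewrite big_cons Pi.
Qed.

Lemma holo_deriv f : holo f -> exists2 g, holo g & near0 (fun t => der f t (g t)).
Proof.
move=> [c cf]; have [g dg df] := expands_deriv archi complete cf; exists g => //.
by eexists; exact: dg.
Qed.

Lemma mero_deriv h : mero h -> exists2 g, mero g & near0 (fun t => der h t (g t)).
Proof.
move=> [N hN]; have [g gh dg] := holo_deriv hN.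
exists (fun t => g t / t ^+ N - (t ^+ N * h t) * (N%:R * t ^+ N.-1) / (t ^+ N) ^+ 2).
  have VX n : mero (fun t => (t ^+ n)^-1) by apply: meroV; apply: holo_mero; apply: holoX.
  apply: meroD; first by apply: meroM => //; apply: holo_mero.
  apply: meroN; apply: meroM; first apply: meroM.
  - exact: holo_mero.
  - by apply: meroM; [exact: mero_cst|apply: holo_mero; exact: holoX].
  - by apply: mero_eq (VX (N * 2)%N) _; apply: filterE => t; rewrite exprM.
apply: near0_imp (near0_and near0_neq0 (near0_and (near0_open near0_neq0) dg)).
move=> t [t0 [sn0 dgt]]; have tN0 : t ^+ N != 0 by rewrite expf_neq0.
have H := derM dgt (@derV (fun s => s ^+ N) t _ tN0 (derX t N)).
have -> : g t / t ^+ N - (t ^+ N * h t) * (N%:R * t ^+ N.-1) / (t ^+ N) ^+ 2 =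
  g t / t ^+ N + t ^+ N * h t * (- (N%:R * t ^+ N.-1) / (t ^+ N) ^+ 2) by ring.
apply: der_near H; apply: filterS sn0 => s s0.
by rewrite mulrC mulKf // expf_neq0.
Qed.

Lemma expandsZ c h x : expands c h -> expands (fun k => x * c k) (fun t => x * h t).
Proof.
move=> ch; have := expandsM (expands_cst x) ch.
suff -> : conv (fun k => if k is 0%N then x else 0) c = (fun k => x * c k) by [].
apply/funext => k; rewrite /conv big_ord_recl subn0 big1 ?addr0 // => i _.
by rewrite mul0r.
Qed.

(** If h' = 0 and t ^ N h expands as c, then t (t ^ N h)' = N t ^ N h, that is
    k c_k = N c_k for all k. *)
Lemma mero_der0 h : mero h -> near0 (fun t => der h t 0) -> exists x, near0 (fun t => h t = x).
Proof.
move=> [N [c ch]] dh.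
have [g dg gh] := expands_deriv archi complete ch.
have E : near0 (fun t => t * g t = N%:R * (t ^+ N * h t)).
  apply: near0_imp (near0_and dh gh) => t [dht ght].
  rewrite (der_uniq ght (derM (derX t N) dht)) mulr0 addr0.
  by case: (N) => [|k]; [rewrite !mul0r mulr0|rewrite exprS /=; ring].
have cE := expands_uniq (expands_eq (expands_mulX dg) E) (expandsZ N%:R ch).
have c0 k : k != N -> c k = 0.
  move=> kN; have /(congr1 (fun u => u k)) := cE; case: k kN => [|k] kN /eqP.
    rewrite eq_sym mulf_eq0 pnatr_eq0 => /orP[/eqP N0|/eqP //].
    by rewrite N0 in kN.
  rewrite -subr_eq0 -mulrBl mulf_eq0 => /orP[|/eqP //].
  by rewrite subr_eq0 eqr_nat (negPf kN).
have H := expands_shiftn ch (fun k kN => c0 k (negbT (ltn_eqF kN))).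
exists (c N); apply: near0_imp (near0_and near0_neq0 (expands_fun_uniq archi H _)).
  move=> t [t0 E']; transitivity (t ^+ N * h t / t ^+ N); last exact: E'.
  by rewrite mulrC mulKf // expf_neq0.
have -> : (fun k => c (N + k)%N) = (fun k => if k is 0%N then c N else 0).
  apply/funext => -[|k]; first by rewrite addn0.
  by apply: c0; rewrite -[X in _ != X]addn0 eqn_add2l.
exact: expands_cst.
Qed.

Lemma common_bound (I : finType) (c : I -> nat -> C) (h : I -> C -> C) :
  (forall i, expands (c i) (h i)) ->
  exists2 a : C, 1 <= a & forall i k, `|c i k| <= a ^+ k.+1.
Proof.
move=> ch; have [a aP] := choice ch.
have a1 i : 1 <= a i by have [[]] := aP i.
have a0 i : 0 <= a i by exact: le_trans ler01 (a1 i).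
exists (1 + \sum_i a i); first by rewrite lerDl sumr_ge0.
move=> i k; have [[_ ac] _] := aP i; apply: le_trans (ac k) _.
apply: lerXn2r; rewrite ?nnegrE ?addr_ge0 ?sumr_ge0 //.
by rewrite (bigD1 i) //= addrCA lerDl addr_ge0 // sumr_ge0.
Qed.

(** Solve for the coefficients of F by [linear_recursion], whose bound makes the
    series converge, and differentiate termwise. *)
Theorem linear_system_solution m (A : C -> 'M[C]_m) :
  (forall i j, holo (fun t => A t i j)) ->
  exists F : C -> 'M[C]_m, (forall i j, holov (fun t => F t i j) (i == j)%:R) /\
    near0 (fun t => forall i j, der (fun s => F s i j) t ((A t *m F t) i j)).
Proof.
move=> Ah; have {}Ah (ij : 'I_m * 'I_m) : holo (fun t => A t ij.1 ij.2) by [].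
have [c cA] := choice Ah.
have [a a1 ac] := common_bound cA.
have [|||X [X0 XS [b [B [b1 B1 XB]]]]] := @linear_recursion C m m
    (fun k => \matrix_(i, j) c (i, j) k) (fun k => k.+1%:R^-1) 1%:M a.
- exact: a1.
- by move=> k i j; rewrite mxE; exact: ac.
- by move=> k; rewrite normfV normr_nat invf_le1 ?ltr0n // ler1n.
have exF (ij : 'I_m * 'I_m) : exists h, expands (fun k => X k ij.1 ij.2) h.
  by apply: (exists_expands complete b1 B1) => k; exact: XB.
have [f fP] := choice exF.
exists (fun t => \matrix_(i, j) f (i, j) t); split.
  move=> i j; exists (fun k => X k i j); last by rewrite X0 mxE.
  by apply: expands_eq (fP (i, j)) _; apply: filterE => t; rewrite mxE.
have H (ij : 'I_m * 'I_m) : near0 (fun t => der (fun s => (\matrix_(i, j) f (i, j) s) ij.1 ij.2) t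
    ((A t *m \matrix_(i, j) f (i, j) t) ij.1 ij.2)).
  case: ij => i j /=; have [g dg df] := expands_deriv archi complete (fP (i, j)).
  have dg' : expands (fun k => \sum_l conv (c (i, l)) (fun k => X k l j) k) g.
    suff <- : (fun k => k.+1%:R * X k.+1 i j) =
       (fun k => \sum_l conv (c (i, l)) (fun k => X k l j) k) by [].
    apply/funext => k; rewrite XS mxE mulrA mulfV ?pnatr_eq0 // mul1r summxE.
    rewrite exchange_big; apply: eq_bigr => r _ /=; rewrite mxE.
    by apply: eq_bigr => l _; rewrite mxE.
  have sum_exp (r : seq 'I_m) : expands (fun k => \sum_(l <- r) conv (c (i, l)) (fun k => X k l j) k)
      (fun t => \sum_(l <- r) A t i l * f (l, j) t).
    elim: r => [|l r IHr].
      have -> : (fun k => \sum_(l <- [::]) conv (c (i, l)) (fun k0 => X k0 l j) k) =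
          (fun k => if k is 0%N then 0 else 0).
        by apply/funext => -[|k]; rewrite big_nil.
      by apply: expands_eq (expands_cst 0) _; apply: filterE => t; rewrite big_nil.
    have E := expandsD (expandsM (cA (i, l)) (fP (l, j))) IHr.
    have -> : (fun k => \sum_(l <- l :: r) conv (c (i, l)) (fun k0 => X k0 l j) k) =
        (fun k => conv (c (i, l)) (fun k0 => X k0 l j) k
            + \sum_(l <- r) conv (c (i, l)) (fun k0 => X k0 l j) k).
      by apply/funext => k; rewrite big_cons.
    by apply: expands_eq E _; apply: filterE => t; rewrite big_cons.
  apply: near0_imp (near0_and df (expands_fun_uniq archi dg' (sum_exp _))) => t [dft gE].
  have -> : (A t *m (\matrix_(i0, j0) f (i0, j0) t)) i j = g t.
    by rewrite gE mxE; apply: eq_bigr => l _; rewrite mxE.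
  by apply: der_ext dft => s; rewrite mxE.
by apply: near0_imp (near0_forall H) => t Ht i j; exact: (Ht (i, j)).
Qed.

End Germs.

(** * The field of meromorphic germs *)

Section GermField.
Local Open Scope quotient_scope.
Variable C : completeField.

(** Germs are classes of meromorphic functions modulo equality near 0; the value of a
    representative at any given point is meaningless. *)
Record merofun := MeroFun { mfun :> C -> C; mfunP : `[< mero mfun >] }.

HB.instance Definition _ := [isSub for mfun].
HB.instance Definition _ := [Choice of merofun by <:].

Definition eq_germ (f g : merofun) := `[< near0 (fun t => f t = g t) >].

Lemma eq_germ_equiv : equiv_class_of eq_germ.
Proof.
split=> [f|f g|g f h].
- by apply/asboolP; apply: filterE.
- by apply/asboolP/asboolP; apply: near0_imp => t ->.
- move=> /asboolP fg /asboolP gh; apply/asboolP.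
  by apply: near0_imp (near0_and fg gh) => t [-> ->].
Qed.

Canonical eq_germ_rel := EquivRelPack eq_germ_equiv.

Definition germ := {eq_quot eq_germ_rel}.
HB.instance Definition _ := Choice.on germ.
HB.instance Definition _ := EqQuotient.on germ.

Lemma mfun_mero (f : merofun) : mero f.
Proof. exact/asboolP/mfunP. Qed.

Definition mk_germ (f : C -> C) (fm : mero f) : germ := \pi_germ (MeroFun (asboolT fm)).
Definition germ_fun (x : germ) : C -> C := generic_quotient.repr x.

Lemma germ_mero x : mero (germ_fun x).
Proof. exact: mfun_mero. Qed.

Lemma germP x y : x = y <-> near0 (fun t => germ_fun x t = germ_fun y t).
Proof.
split=> [->|H]; first exact: filterE.
rewrite -[x]reprK -[y]reprK; apply/eqmodP; exact/asboolP.
Qed.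

Lemma mk_germE f (fm : mero f) : near0 (fun t => germ_fun (mk_germ fm) t = f t).
Proof.
have : generic_quotient.repr (mk_germ fm) = MeroFun (asboolT fm) %[mod germ] by rewrite reprK.
by move=> /eqmodP/asboolP.
Qed.

Definition germ_cst c := mk_germ (@mero_cst C c).
Definition germ_add x y := mk_germ (meroD (germ_mero x) (germ_mero y)).
Definition germ_opp x := mk_germ (meroN (germ_mero x)).
Definition germ_mul x y := mk_germ (meroM (germ_mero x) (germ_mero y)).
Definition germ_inv x := mk_germ (meroV (germ_mero x)).

Lemma germ_addE x y : near0 (fun t => germ_fun (germ_add x y) t = germ_fun x t + germ_fun y t).
Proof. exact: mk_germE. Qed.
Lemma germ_oppE x : near0 (fun t => germ_fun (germ_opp x) t = - germ_fun x t).
Proof. exact: mk_germE. Qed.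
Lemma germ_mulE x y : near0 (fun t => germ_fun (germ_mul x y) t = germ_fun x t * germ_fun y t).
Proof. exact: mk_germE. Qed.
Lemma germ_invE x : near0 (fun t => germ_fun (germ_inv x) t = (germ_fun x t)^-1).
Proof. exact: mk_germE. Qed.
Lemma germ_cstE c : near0 (fun t => germ_fun (germ_cst c) t = c).
Proof. exact: mk_germE. Qed.

Let n2 := @near0_and C.

Fact germ_addA : associative germ_add.
Proof.
move=> x y z; apply/germP; apply: near0_imp (n2 (n2 (germ_addE x (germ_add y z)) (germ_addE y z))
  (n2 (germ_addE (germ_add x y) z) (germ_addE x y))) => t [[-> ->] [-> ->]].
exact: addrA.
Qed.

Fact germ_addC : commutative germ_add.
Proof.
move=> x y; apply/germP; apply: near0_imp (n2 (germ_addE x y) (germ_addE y x)) => t [-> ->].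
exact: addrC.
Qed.

Fact germ_add0 : left_id (germ_cst 0) germ_add.
Proof.
move=> x; apply/germP; apply: near0_imp (n2 (germ_addE (germ_cst 0) x) (germ_cstE 0)) => t [-> ->].
exact: add0r.
Qed.

Fact germ_addN : left_inverse (germ_cst 0) germ_opp germ_add.
Proof.
move=> x; apply/germP; apply: near0_imp (n2 (germ_addE (germ_opp x) x) (n2 (germ_oppE x) (germ_cstE 0))).
by move=> t [-> [-> ->]]; exact: addNr.
Qed.

HB.instance Definition _ := GRing.isZmodule.Build germ germ_addA germ_addC germ_add0 germ_addN.

Fact germ_mulA : associative germ_mul.
Proof.
move=> x y z; apply/germP; apply: near0_imp (n2 (n2 (germ_mulE x (germ_mul y z)) (germ_mulE y z))
  (n2 (germ_mulE (germ_mul x y) z) (germ_mulE x y))) => t [[-> ->] [-> ->]].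
exact: mulrA.
Qed.

Fact germ_mulC : commutative germ_mul.
Proof.
move=> x y; apply/germP; apply: near0_imp (n2 (germ_mulE x y) (germ_mulE y x)) => t [-> ->].
exact: mulrC.
Qed.

Fact germ_mul1 : left_id (germ_cst 1) germ_mul.
Proof.
move=> x; apply/germP; apply: near0_imp (n2 (germ_mulE (germ_cst 1) x) (germ_cstE 1)) => t [-> ->].
exact: mul1r.
Qed.

Fact germ_mulDl : left_distributive germ_mul germ_add.
Proof.
move=> x y z; apply/germP; apply: near0_imp (n2 (n2 (germ_mulE (germ_add x y) z) (germ_addE x y))
  (n2 (germ_addE (germ_mul x z) (germ_mul y z)) (n2 (germ_mulE x z) (germ_mulE y z)))).
by move=> t [[-> ->] [-> [-> ->]]]; exact: mulrDl.
Qed.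

Fact germ_1neq0 : germ_cst 1 != 0 :> germ.
Proof.
apply/eqP => /germP H; have [t _ [[H1 H2] H3]] := near0_ex (n2 (n2 H (germ_cstE 1)) (germ_cstE 0)).
by move: H1; rewrite H2 H3 => /eqP; rewrite oner_eq0.
Qed.

HB.instance Definition _ := GRing.Zmodule_isComNzRing.Build germ
  germ_mulA germ_mulC germ_mul1 germ_mulDl germ_1neq0.

Fact germ_mulV (x : germ) : x != 0 -> germ_mul (germ_inv x) x = 1.
Proof.
move=> x0; have [h0|hN] := mero_eq0_or_neq0 (germ_mero x).
  case/eqP: x0; apply/germP; apply: near0_imp (n2 h0 (germ_cstE 0)) => t [-> h]; exact: esym.
apply/germP; apply: near0_imp (n2 hN (n2 (germ_mulE (germ_inv x) x) (n2 (germ_invE x) (germ_cstE 1)))).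
by move=> t [x0t [-> [-> ->]]]; exact: mulVf.
Qed.

Fact germ_inv0 : germ_inv (0 : germ) = 0.
Proof.
apply/germP; apply: near0_imp (n2 (germ_invE 0) (germ_cstE 0)) => t [-> h].
by rewrite [germ_fun 0 t]h invr0.
Qed.

HB.instance Definition _ := GRing.ComNzRing_isField.Build germ germ_mulV germ_inv0.

Fact germ_cst_zmod : zmod_morphism germ_cst.
Proof.
move=> c d; apply/germP.
apply: near0_imp (n2 (germ_cstE (c - d)) (n2 (germ_addE (germ_cst c) (germ_opp (germ_cst d)))
   (n2 (germ_cstE c) (n2 (germ_oppE (germ_cst d)) (germ_cstE d))))).
by move=> t [-> [E [cE [oE dE]]]]; rewrite [RHS]E cE oE dE.
Qed.

Fact germ_cst_monoid : monoid_morphism germ_cst.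
Proof.
split=> // c d; apply/germP.
apply: near0_imp (n2 (germ_cstE (c * d)) (n2 (germ_mulE (germ_cst c) (germ_cst d))
   (n2 (germ_cstE c) (germ_cstE d)))).
by move=> t [-> [E [cE dE]]]; rewrite [RHS]E cE dE.
Qed.

HB.instance Definition _ := GRing.isZmodMorphism.Build C germ germ_cst germ_cst_zmod.
HB.instance Definition _ := GRing.isMonoidMorphism.Build C germ germ_cst germ_cst_monoid.

Lemma germ_char0 : [pchar germ] =i pred0.
Proof. by move=> p; rewrite (fmorph_pchar germ_cst) pchar_num. Qed.

Definition represents (x : germ) f := near0 (fun t => germ_fun x t = f t).

Lemma represents_exists f : mero f -> exists x, represents x f.
Proof. by move=> fm; exists (mk_germ fm); apply: mk_germE. Qed.

Lemma represents_eq x f g : represents x f -> near0 (fun t => f t = g t) -> represents x g.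
Proof. by move=> xf fg; apply: near0_imp (n2 xf fg) => t [-> ->]. Qed.

Lemma represents_uniq x y f g : represents x f -> represents y g ->
  near0 (fun t => f t = g t) -> x = y.
Proof. by move=> xf yg fg; apply/germP; apply: near0_imp (n2 xf (n2 yg fg)) => t [-> [-> ->]]. Qed.

Lemma represents_fun_uniq x f g : represents x f -> represents x g -> near0 (fun t => f t = g t).
Proof. by move=> xf xg; apply: near0_imp (n2 xf xg) => t [<- <-]. Qed.

Lemma represents_cst c : represents (germ_cst c) (fun=> c).
Proof. exact: germ_cstE. Qed.

Lemma representsD x y f g : represents x f -> represents y g ->
  represents (x + y) (fun t => f t + g t).
Proof. by move=> xf yg; apply: near0_imp (n2 xf (n2 yg (germ_addE x y))) => t [<- [<- ->]]. Qed.

Lemma representsN x f : represents x f -> represents (- x) (fun t => - f t).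
Proof. by move=> xf; apply: near0_imp (n2 xf (germ_oppE x)) => t [<- ->]. Qed.

Lemma representsM x y f g : represents x f -> represents y g ->
  represents (x * y) (fun t => f t * g t).
Proof. by move=> xf yg; apply: near0_imp (n2 xf (n2 yg (germ_mulE x y))) => t [<- [<- ->]]. Qed.

Lemma representsV x f : represents x f -> represents x^-1 (fun t => (f t)^-1).
Proof. by move=> xf; apply: near0_imp (n2 xf (germ_invE x)) => t [<- ->]. Qed.

Lemma represents_sum (I : Type) (r : seq I) (P : pred I) (x : I -> germ) (f : I -> C -> C) :
  (forall i, P i -> represents (x i) (f i)) ->
  represents (\sum_(i <- r | P i) x i) (fun t => \sum_(i <- r | P i) f i t).
Proof.
move=> xf; elim: r => [|i r IHr].
  rewrite big_nil; apply: represents_eq (represents_cst 0) _.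
  by apply: filterE => t; rewrite big_nil.
rewrite big_cons; case: ifP => Pi.
  apply: represents_eq (representsD (xf i Pi) IHr) _.
  by apply: filterE => t; rewrite big_cons Pi.
by apply: represents_eq IHr _; apply: filterE => t; rewrite big_cons Pi.
Qed.

Lemma represents_prod (I : Type) (r : seq I) (P : pred I) (x : I -> germ) (f : I -> C -> C) :
  (forall i, P i -> represents (x i) (f i)) ->
  represents (\prod_(i <- r | P i) x i) (fun t => \prod_(i <- r | P i) f i t).
Proof.
move=> xf; elim: r => [|i r IHr].
  rewrite big_nil; apply: represents_eq (represents_cst 1) _.
  by apply: filterE => t; rewrite big_nil.
rewrite big_cons; case: ifP => Pi.
  apply: represents_eq (representsM (xf i Pi) IHr) _.
  by apply: filterE => t; rewrite big_cons Pi.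
by apply: represents_eq IHr _; apply: filterE => t; rewrite big_cons Pi.
Qed.

Lemma representsX x f k : represents x f -> represents (x ^+ k) (fun t => f t ^+ k).
Proof.
move=> xf; elim: k => [|k IHk].
  by rewrite expr0; apply: represents_eq (represents_cst 1) _; apply: filterE => t; rewrite expr0.
rewrite exprS; apply: represents_eq (representsM xf IHk) _.
by apply: filterE => t; rewrite exprS.
Qed.

(** Derivations u d/dt: in the coordinate t of a point of the sphere, d/dx has this
    form. *)
Variable u : germ.

Lemma germ_deriv_exists (x : germ) : exists y : germ,
  near0 (fun t => der (germ_fun x) t (germ_fun y t)).
Proof.
have [g gm dg] := mero_deriv (germ_mero x); exists (mk_germ gm).
by apply: near0_imp (n2 dg (mk_germE gm)) => t [H ->].
Qed.

Definition germ_ddt (x : germ) : germ := sval (cid (germ_deriv_exists x)).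
Definition germ_deriv (x : germ) : germ := u * germ_ddt x.

(** Functions equal near 0 have equal derivatives near 0, by [near0_open]. *)
Lemma represents_ddt x f g : represents x f -> near0 (fun t => der f t (g t)) ->
  represents (germ_ddt x) g.
Proof.
rewrite /germ_ddt; case: cid => y /= yx xf fg.
apply: near0_imp (n2 (near0_open xf) (n2 yx fg)) => t [xft [yt gt]].
by apply: der_uniq gt; apply: der_near yt.
Qed.

Lemma der_represents x f g : represents x f -> represents (germ_ddt x) g ->
  near0 (fun t => der f t (g t)).
Proof.
move=> xf; rewrite /germ_ddt; case: cid => y /= yx yg.
apply: near0_imp (n2 (near0_open xf) (n2 yx yg)) => t [xft [yt <-]].
exact: der_near yt.
Qed.

Hypothesis u0 : u != 0.

Lemma germ_derivation : derivation germ_cst germ_deriv.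
Proof.
have rep x : represents x (germ_fun x) by apply: filterE.
have drep x := der_represents (rep x) (rep (germ_ddt x)).
split=> [x y|x y|x].
- rewrite /germ_deriv -mulrDr; congr (_ * _).
  apply: (represents_uniq (rep _) (representsD (rep _) (rep _))).
  apply: (represents_fun_uniq (rep _)); apply: (represents_ddt (representsD (rep x) (rep y))).
  by apply: near0_imp (n2 (drep x) (drep y)) => t [dx dy]; exact: derD.
- rewrite /germ_deriv -mulrA [X in _ + X]mulrCA -mulrDr; congr (_ * _).
  apply: (represents_uniq (rep _) (representsD (representsM (rep _) (rep _)) (representsM (rep _) (rep _)))).
  apply: (represents_fun_uniq (rep _)); apply: (represents_ddt (representsM (rep x) (rep y))).
  by apply: near0_imp (n2 (drep x) (drep y)) => t [dx dy]; exact: derM.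
- split=> [/eqP|[c ->]].
    rewrite mulf_eq0 (negPf u0) => /eqP dx0.
    have d0 : near0 (fun t => der (germ_fun x) t 0).
      have := drep x; rewrite dx0 => H.
      by apply: near0_imp (n2 H (germ_cstE 0)) => t [Ht <-].
    have [c xc] := mero_der0 (germ_mero x) d0.
    by exists c; apply: (represents_uniq (rep x) (represents_cst c)).
  rewrite /germ_deriv; suff -> : germ_ddt (germ_cst c) = 0 by rewrite mulr0.
  apply: (represents_uniq (rep _) (represents_cst 0)).
  apply: (represents_fun_uniq (rep _)); apply: (represents_ddt (represents_cst c)).
  by apply: filterE => t; exact: der_cst.
Qed.

End GermField.

(** * Differentiating algebraic representations *)

Section Calculus.
Variable C : completeField.
Implicit Types (h g f : C -> C) (t x y : C).

Lemma der_comp f g t x y : der f t x -> der g (f t) y -> der (fun s => g (f s)) t (y * x).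
Proof.
move=> [df fx] [dg gy].
have Df : differentiable f t by apply/derivable1_diffP.
have Dg : differentiable g (f t) by apply/derivable1_diffP.
have Dgf : differentiable (g \o f) t by exact: differentiable_comp.
split; first by apply/derivable1_diffP.
rewrite deriveE // diff_comp //=.
have E1 : 'd f t (1 : C) = x by rewrite -deriveE.
have E2 : 'd g (f t) (1 : C) = y by rewrite -deriveE.
have E3 := linearZ_LR ('d g (f t)) x 1.
apply: (etrans (congr1 ('d g (f t)) (etrans E1 (esym (mulr1 x))))).
by apply: (etrans E3); rewrite E2; exact: mulrC.
Qed.

Lemma der_continuous f t x : der f t x -> {for t, continuous f}.
Proof. by move=> [df _]; apply: differentiable_continuous; apply/derivable1_diffP. Qed.

Lemma der_neq0 f t x : der f t x -> f t != 0 -> \forall s \near t, f s != 0.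
Proof.
move=> /der_continuous fc f0.
have : \forall y \near f t, y != 0.
  apply: (@filterS _ _ _ (fun y => `|f t - y| < `|f t|)); last first.
    by apply: (nbhsx_ballx (f t) `|f t|); rewrite normr_gt0.
  by move=> y; apply: contraTneq => ->; rewrite subr0 ltxx.
exact: fc.
Qed.

(** The charts of the sphere, for an abstract field. *)
Definition gchart (p : option C) t := if p is Some a then a + t else t^-1.

(** The factor such that d/dx = gunit p t d/dt. *)
Definition gunit (p : option C) t := if p is Some a then 1 else - t ^+ 2.

Definition gcoord (p : option C) x := if p is Some a then x - a else x^-1.

Lemma gchartK p : cancel (gchart p) (gcoord p).
Proof. by case: p => [a|] t /=; [rewrite addrC addKr|rewrite invrK]. Qed.

Lemma gcoordK p : cancel (gcoord p) (gchart p).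
Proof. by case: p => [a|] t /=; [rewrite addrC subrK|rewrite invrK]. Qed.

Lemma gcoord_der p t : t != 0 -> der (gcoord p) (gchart p t) (gunit p t).
Proof.
case: p => [a|] t0 /=.
  by have := derD (der_id (a + t)) (derN (der_cst a (a + t))); rewrite oppr0 addr0.
have := derV (f := id) (_ : t^-1 != 0) (der_id t^-1).
by rewrite invr_eq0 => /(_ t0); rewrite exprVn invrK mulN1r.
Qed.

Lemma gchart_der (p : option C) f t x : t != 0 ->
  der (fun s => f (gchart p s)) t x -> der f (gchart p t) (gunit p t * x).
Proof.
move=> t0 fx; have di := gcoord_der p t0.
have fx' : der (fun s => f (gchart p s)) (gcoord p (gchart p t)) x by rewrite gchartK.
have := der_comp di fx'; rewrite mulrC => H.
by apply: der_ext H => y; rewrite gcoordK.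
Qed.

Variable n : nat.
Implicit Types (phi psi : 'M[C]_n -> C) (gam : C -> 'M[C]_n) (X a : 'M[C]_n).

Definition mxder m k (G : C -> 'M[C]_(m, k)) t (D : 'M[C]_(m, k)) :=
  forall i j, der (fun s => G s i j) t (D i j).

(** Differentiability of phi along curves at X, with a derivative that only depends
    on the tangent vector. It stands for differentiability in several variables, and
    it is clearly stable under algebraic operations. *)
Definition has_jet phi X := forall a, exists d, forall gam t,
  gam t = X -> mxder gam t a -> der (fun s => phi (gam s)) t d.

Lemma has_jet_cst c X : has_jet (fun=> c) X.
Proof. by move=> a; exists 0 => gam t _ _; exact: der_cst. Qed.

Lemma has_jet_entry i j X : has_jet (fun Y => Y i j) X.
Proof. by move=> a; exists (a i j) => gam t _; apply. Qed.

Lemma has_jetD phi psi X : has_jet phi X -> has_jet psi X -> has_jet (fun Y => phi Y + psi Y) X.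
Proof.
move=> hp hs a; have [d dP] := hp a; have [e eP] := hs a.
by exists (d + e) => gam t gt ga; apply: derD; [exact: dP|exact: eP].
Qed.

Lemma has_jetM phi psi X : has_jet phi X -> has_jet psi X -> has_jet (fun Y => phi Y * psi Y) X.
Proof.
move=> hp hs a; have [d dP] := hp a; have [e eP] := hs a.
exists (d * psi X + phi X * e) => gam t gt ga; rewrite -gt.
by apply: derM; [exact: dP|exact: eP].
Qed.

Lemma has_jetV phi X : phi X != 0 -> has_jet phi X -> has_jet (fun Y => (phi Y)^-1) X.
Proof.
move=> p0 hp a; have [d dP] := hp a.
exists (- d / phi X ^+ 2) => gam t gt ga; rewrite -gt.
by apply: (derV (f := fun s => phi (gam s))); [rewrite gt|exact: dP].
Qed.

Lemma has_jet_ext phi psi X : phi =1 psi -> has_jet phi X -> has_jet psi X.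
Proof. by move=> /funext ->. Qed.

Lemma has_jetX phi X k : has_jet phi X -> has_jet (fun Y => phi Y ^+ k) X.
Proof.
move=> hp; elim: k => [|k IHk]; first by apply: has_jet_ext (has_jet_cst 1 X).
by apply: has_jet_ext (has_jetM hp IHk) => Y; rewrite exprS.
Qed.

Lemma has_jet_sum (I : Type) (r : seq I) (P : pred I) (phi : I -> 'M[C]_n -> C) X :
  (forall i, has_jet (phi i) X) -> has_jet (fun Y => \sum_(i <- r | P i) phi i Y) X.
Proof.
move=> hp; elim: r => [|i r IHr].
  by apply: has_jet_ext (has_jet_cst 0 X) => Y; rewrite big_nil.
have [Pi|Pi] := boolP (P i).
  by apply: has_jet_ext (has_jetD (hp i) IHr) => Y; rewrite big_cons Pi.
by apply: has_jet_ext IHr => Y; rewrite big_cons (negPf Pi).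
Qed.

Lemma has_jet_prod (I : Type) (r : seq I) (P : pred I) (phi : I -> 'M[C]_n -> C) X :
  (forall i, has_jet (phi i) X) -> has_jet (fun Y => \prod_(i <- r | P i) phi i Y) X.
Proof.
move=> hp; elim: r => [|i r IHr].
  by apply: has_jet_ext (has_jet_cst 1 X) => Y; rewrite big_nil.
have [Pi|Pi] := boolP (P i).
  by apply: has_jet_ext (has_jetM (hp i) IHr) => Y; rewrite big_cons Pi.
by apply: has_jet_ext IHr => Y; rewrite big_cons (negPf Pi).
Qed.

Lemma has_jet_det X : has_jet (fun Y => \det Y) X.
Proof.
apply: has_jet_sum => s; apply: has_jetM; first exact: has_jet_cst.
by apply: has_jet_prod => i; exact: has_jet_entry.
Qed.

Lemma has_jet_evm (p : mpoly (n * n) C) X : has_jet (fun Y => evm Y p) X.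
Proof.
apply: (@has_jet_ext (fun Y => \sum_(m <- msupp p) mcoeff m p * \prod_i (mxvec Y 0 i) ^+ m i)).
  by move=> Y; rewrite /evm mevalE.
apply: has_jet_sum => m; apply: has_jetM; first exact: has_jet_cst.
apply: has_jet_prod => l; apply: has_jetX; case/mxvec_indexP: l => i j.
by apply: has_jet_ext (has_jet_entry i j X) => Y; rewrite mxvecE.
Qed.

(** The definition of [algebraic_rep], for an abstract field. *)
Definition alg_rep m (Psi : 'M[C]_n -> 'M[C]_m) : Prop :=
  [/\ Psi 1%:M = 1%:M,
      forall g h : 'M[C]_n, g \in unitmx -> h \in unitmx -> Psi (g *m h) = Psi g *m Psi h
    & forall i j, exists (p : mpoly (n * n) C) (k : nat),
        forall g : 'M[C]_n, g \in unitmx ->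
          Psi g i j = meval (fun l => mxvec g 0 l) p / (\det g) ^+ k].

Definition grep_diff m (Psi : 'M[C]_n -> 'M[C]_m) (a : 'M[C]_n) : 'M[C]_m :=
  \matrix_(i, j) derive1 (fun s => Psi (1%:M + s *: a) i j) 0.

Lemma mxder_unit gam t a : mxder gam t a -> gam t \in unitmx ->
  \forall s \near t, gam s \in unitmx.
Proof.
rewrite unitmxE unitfE => ga g0; have [d dP] := has_jet_det (gam t) a.
by apply: filterS (der_neq0 (dP gam t erefl ga) g0) => s; rewrite unitmxE unitfE.
Qed.

Lemma alg_rep_jet m (Psi : 'M[C]_n -> 'M[C]_m) i j X : alg_rep Psi -> X \in unitmx ->
  has_jet (fun Y => Psi Y i j) X.
Proof.
move=> [_ _ /(_ i j)[p [k Pp]]] Xu.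
have H : has_jet (fun Y => evm Y p / (\det Y) ^+ k) X.
  apply: has_jetM; first exact: has_jet_evm.
  apply: has_jetV; first by rewrite expf_neq0 // -unitfE -unitmxE.
  by apply: has_jetX; exact: has_jet_det.
move=> a; have [d dP] := H a; exists d => gam t gt ga.
apply: (der_near _ (dP gam t gt ga)).
have := mxder_unit ga; rewrite gt => /(_ Xu); apply: filterS => s su.
by rewrite Pp.
Qed.

Lemma mxder_line a : mxder (fun s => 1%:M + s *: a) 0 a.
Proof.
move=> i j; have := derD (der_cst (1%:M i j : C) 0) (derM (der_id 0) (der_cst (a i j) 0)).
rewrite add0r mul1r mul0r addr0; apply: der_ext => s.
by rewrite !mxE.
Qed.

Lemma alg_rep_der m (Psi : 'M[C]_n -> 'M[C]_m) gam t a : alg_rep Psi ->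
  gam t = 1%:M -> mxder gam t a -> mxder (fun s => Psi (gam s)) t (grep_diff Psi a).
Proof.
move=> rP g1 ga i j; have [d dP] := alg_rep_jet i j rP (unitmx1 _ _) a.
have := dP _ 0 _ (mxder_line a); rewrite scale0r addr0 => /(_ erefl) /der_ddx E.
by rewrite mxE E; apply: dP.
Qed.

Lemma mxder_mulr m k l (G : C -> 'M[C]_(m, k)) t D (X : 'M[C]_(k, l)) : mxder G t D ->
  mxder (fun s => G s *m X) t (D *m X).
Proof.
move=> GD i j; rewrite mxE.
apply: (@der_ext _ (fun s => \sum_r G s i r * X r j)) => [s|]; first by rewrite mxE.
apply: der_sum => r _; have := derM (GD i r) (der_cst (X r j) t).
by rewrite mulr0 addr0.
Qed.

(** Psi(F(s)) = Psi(F(s) F(t)^-1) Psi(F(t)) reduces the derivative of Psi at F(t) to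
    its derivative at 1. *)
Lemma alg_rep_system m (Psi : 'M[C]_n -> 'M[C]_m) (F : C -> 'M[C]_n) t a : alg_rep Psi ->
  F t \in unitmx -> mxder F t (a *m F t) ->
  mxder (fun s => Psi (F s)) t (grep_diff Psi a *m Psi (F t)).
Proof.
move=> rP Fu FD.
have gD : mxder (fun s => F s *m invmx (F t)) t a.
  by have := mxder_mulr (invmx (F t)) FD; rewrite -mulmxA mulmxV // mulmx1.
have g1 : F t *m invmx (F t) = 1%:M by rewrite mulmxV.
have gu : F t *m invmx (F t) \in unitmx by rewrite g1 unitmx1.
have H := mxder_mulr (Psi (F t)) (alg_rep_der rP g1 gD).
move=> i j; apply: der_near (H i j); apply: filterS (mxder_unit gD gu) => s su.
by have [_ PM _] := rP; rewrite -PM // -mulmxA mulVmx // mulmx1.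
Qed.

Lemma grep_diffZ m (Psi : 'M[C]_n -> 'M[C]_m) c a : alg_rep Psi ->
  grep_diff Psi (c *: a) = c *: grep_diff Psi a.
Proof.
move=> rP; have H : mxder (fun s => Psi (1%:M + (c * s) *: a)) 0 (c *: grep_diff Psi a).
  move=> i j; rewrite mxE mulrC.
  have dc : der (fun s => c * s) 0 c.
    by have := derM (der_cst c 0) (der_id 0); rewrite mul0r add0r mulr1.
  apply: (der_comp (f := fun s => c * s) (g := fun s => Psi (1%:M + s *: a) i j) dc).
  rewrite mulr0; apply: (alg_rep_der rP); first by rewrite scale0r addr0.
  exact: mxder_line.
apply/matrixP => i j; rewrite [LHS]mxE; apply: der_ddx.
by apply: der_ext (H i j) => s; rewrite scalerA mulrC.
Qed.

End Calculus.

(** * Matrices of germs *)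

Section MatrixGerms.
Variable C : completeField.
Local Notation M := (germ C).
Local Notation iota := (@germ_cst C).

Definition mxrep m n (X : 'M[M]_(m, n)) (f : C -> 'M[C]_(m, n)) :=
  forall i j, represents (X i j) (fun t => f t i j).

Lemma mxrep_near m n (X : 'M[M]_(m, n)) f : mxrep X f ->
  near0 (fun t => forall i j, germ_fun (X i j) t = f t i j).
Proof.
move=> Xf; have H (ij : 'I_m * 'I_n) : near0 (fun t => germ_fun (X ij.1 ij.2) t = f t ij.1 ij.2).
  exact: Xf.
by apply: near0_imp (near0_forall H) => t Ht i j; exact: (Ht (i, j)).
Qed.

Lemma mxrep_exists m n (f : C -> 'M[C]_(m, n)) : (forall i j, mero (fun t => f t i j)) ->
  exists X : 'M[M]_(m, n), mxrep X f.
Proof.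
move=> fm; have H (ij : 'I_m * 'I_n) : exists x : M, represents x (fun t => f t ij.1 ij.2).
  exact: represents_exists.
have [X XP] := choice H; exists (\matrix_(i, j) X (i, j)) => i j; rewrite mxE.
exact: (XP (i, j)).
Qed.

Lemma mxrep_eq m n (X : 'M[M]_(m, n)) f g : mxrep X f -> near0 (fun t => f t = g t) -> mxrep X g.
Proof. by move=> Xf fg i j; apply: represents_eq (Xf i j) _; apply: near0_imp fg => t ->. Qed.

Lemma mxrep_uniq m n (X Y : 'M[M]_(m, n)) f g : mxrep X f -> mxrep Y g ->
  near0 (fun t => f t = g t) -> X = Y.
Proof.
move=> Xf Yg fg; apply/matrixP => i j; apply: (represents_uniq (Xf i j) (Yg i j)).
by apply: near0_imp fg => t ->.
Qed.

Lemma mxrep_fun_uniq m n (X : 'M[M]_(m, n)) f g : mxrep X f -> mxrep X g ->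
  near0 (fun t => f t = g t).
Proof.
move=> /mxrep_near Xf /mxrep_near Xg; apply: near0_imp (near0_and Xf Xg) => t [ft gt].
by apply/matrixP => i j; rewrite -ft -gt.
Qed.

Lemma mxrep_mul m n p (X : 'M[M]_(m, n)) (Y : 'M[M]_(n, p)) f g :
  mxrep X f -> mxrep Y g -> mxrep (X *m Y) (fun t => f t *m g t).
Proof.
move=> Xf Yg i j; rewrite mxE.
apply: (represents_eq (f := fun t => \sum_k f t i k * g t k j)); last first.
  by apply: filterE => t; rewrite mxE.
by apply: represents_sum => k _; apply: representsM.
Qed.

Lemma mxrep_sub m n (X Y : 'M[M]_(m, n)) f g :
  mxrep X f -> mxrep Y g -> mxrep (X - Y) (fun t => f t - g t).
Proof.
move=> Xf Yg i j; rewrite !mxE.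
apply: (represents_eq (representsD (Xf i j) (representsN (Yg i j)))).
by apply: filterE => t; rewrite !mxE.
Qed.

Lemma mxrep_scale m n (X : 'M[M]_(m, n)) f x h :
  represents x h -> mxrep X f -> mxrep (x *: X) (fun t => h t *: f t).
Proof.
move=> xh Xf i j; rewrite mxE; apply: (represents_eq (representsM xh (Xf i j))).
by apply: filterE => t; rewrite mxE.
Qed.

Lemma mxrep_cst m n (B : 'M[C]_(m, n)) : mxrep (map_mx iota B) (fun=> B).
Proof. by move=> i j; rewrite mxE; exact: represents_cst. Qed.

Lemma represents_det n (X : 'M[M]_n) f : mxrep X f -> represents (\det X) (fun t => \det (f t)).
Proof.
move=> Xf; apply: represents_sum => s _; apply: representsM; last first.
  by apply: represents_prod => i _; exact: Xf.
have := represents_cst ((-1) ^+ s : C); rewrite rmorphXn rmorphN1.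
exact.
Qed.

Lemma mxrep_unit n (X : 'M[M]_n) f : mxrep X f -> near0 (fun t => f t \in unitmx) -> X \in unitmx.
Proof.
move=> Xf fu; rewrite unitmxE unitfE; apply/eqP => d0.
have H := represents_det Xf; rewrite d0 in H.
have [t _ [[H1 H2] H3]] := near0_ex (near0_and (near0_and H (represents_cst (0 : C))) fu).
by move: H3; rewrite unitmxE unitfE -H1 -[0]/(iota 0) H2 eqxx.
Qed.

Lemma mxrep_inv n (X : 'M[M]_n) f : mxrep X f -> near0 (fun t => f t \in unitmx) ->
  mxrep (invmx X) (fun t => invmx (f t)).
Proof.
move=> Xf fu; have Xu := mxrep_unit Xf fu.
have H : mxrep ((\det X)^-1 *: \adj X) (fun t => (\det (f t))^-1 *: \adj (f t)).
  apply: mxrep_scale; first exact/representsV/represents_det.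
  move=> i j; rewrite mxE /cofactor.
  apply: (represents_eq (f := fun t => (-1) ^+ (j + i) * \det (row' j (col' i (f t))))); last first.
    by apply: filterE => t; rewrite [in RHS]mxE.
  apply: representsM.
    by have := represents_cst ((-1) ^+ (j + i) : C); rewrite rmorphXn rmorphN1; exact.
  apply: represents_det => a b; rewrite !mxE; apply: represents_eq (Xf _ _) _.
  by apply: filterE => t; rewrite !mxE.
rewrite /invmx Xu; apply: mxrep_eq H _.
by apply: near0_imp fu => t ->.
Qed.

Lemma represents_evm n (X : 'M[M]_n) f (q : mpoly (n * n) C) : mxrep X f ->
  represents (evm X (map_mpoly iota q)) (fun t => evm (f t) q).
Proof.
move=> Xf; elim/mpolyind: q => [|c m q _ _ IHq].
  rewrite !rmorph0; apply: represents_eq (represents_cst 0) _.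
  by apply: filterE => t; rewrite rmorph0.
rewrite !rmorphD /=.
apply: represents_eq (representsD (_ : represents _ (fun t => evm (f t) (c *: mpolyX C m))) IHq) _; last first.
  by apply: filterE => t; rewrite rmorphD.
rewrite map_mpolyZ map_mpolyX evmZ.
apply: represents_eq (representsM (represents_cst c) (_ : represents _ (fun t => \prod_i (mxvec (f t) 0 i) ^+ m i))) _; last first.
  by apply: filterE => t; rewrite evmZ /evm mevalX.
rewrite /evm mevalX; apply: represents_prod => l _; apply: representsX.
case/mxvec_indexP: l => i j; rewrite mxvecE; apply: represents_eq (Xf i j) _.
by apply: filterE => t; rewrite mxvecE.
Qed.

Definition mxholov m n (f : C -> 'M[C]_(m, n)) (f0 : 'M[C]_(m, n)) :=
  forall i j, holov (fun t => f t i j) (f0 i j).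

Lemma mxholov_mul m n p (f : C -> 'M[C]_(m, n)) (g : C -> 'M[C]_(n, p)) f0 g0 :
  mxholov f f0 -> mxholov g g0 -> mxholov (fun t => f t *m g t) (f0 *m g0).
Proof.
move=> ff gg i j; rewrite mxE.
apply: (holov_eq (h := fun t => \sum_k f t i k * g t k j)); last first.
  by apply: filterE => t; rewrite mxE.
by apply: holov_sum => k _; apply: holovM.
Qed.

Lemma mxholov_cst m n (B : 'M[C]_(m, n)) : mxholov (fun=> B) B.
Proof. by move=> i j; exact: holov_cst. Qed.

Lemma holov_det n (f : C -> 'M[C]_n) f0 : mxholov f f0 -> holov (fun t => \det (f t)) (\det f0).
Proof.
move=> ff; apply: holov_sum => s _; apply: holovM; first exact: holov_cst.
by apply: holov_prod => i _; exact: ff.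
Qed.

Lemma mxholov_unit n (f : C -> 'M[C]_n) f0 : mxholov f f0 -> f0 \in unitmx ->
  near0 (fun t => f t \in unitmx).
Proof.
move=> ff; rewrite unitmxE unitfE => f0u.
by apply: near0_imp (holov_neq0 (holov_det ff) f0u) => t; rewrite unitmxE unitfE.
Qed.

Lemma holov_evm n (f : C -> 'M[C]_n) f0 (q : mpoly (n * n) C) : mxholov f f0 ->
  holov (fun t => evm (f t) q) (evm f0 q).
Proof.
move=> ff; rewrite /evm mevalE.
apply: (holov_eq (h := fun t => \sum_(m <- msupp q) mcoeff m q * \prod_i (mxvec (f t) 0 i) ^+ m i)); last first.
  by apply: filterE => t; rewrite mevalE.
apply: holov_sum => m _; apply: holovM; first exact: holov_cst.
apply: holov_prod => l _; apply: holovX; case/mxvec_indexP: l => i j; rewrite mxvecE.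
by apply: holov_eq (ff i j) _; apply: filterE => t; rewrite mxvecE.
Qed.

Lemma alg_rep_holov n m (Psi : 'M[C]_n -> 'M[C]_m) (f : C -> 'M[C]_n) f0 : alg_rep Psi ->
  mxholov f f0 -> f0 \in unitmx -> mxholov (fun t => Psi (f t)) (Psi f0).
Proof.
move=> [_ _ PP] ff f0u i j; have [p [k Pp]] := PP i j.
have fu := mxholov_unit ff f0u.
rewrite Pp //; apply: (holov_eq (h := fun t => evm (f t) p / \det (f t) ^+ k)).
  apply: holovM; first exact: holov_evm.
  apply: holovV; first by apply: holovX; exact: holov_det.
  by rewrite expf_neq0 // -unitfE -unitmxE.
by apply: near0_imp fu => t /Pp ->.
Qed.

Lemma mxholov_cvg_uniq m n (f g : C -> 'M[C]_(m, n)) (f0 g0 : 'M[C]_(m, n)) : mxholov f f0 ->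
  (forall i j, (fun t => g t i j) @ 0^' --> (g0 : 'M[C]_(m, n)) i j) ->
  near0 (fun t => f t = g t) -> g0 = f0.
Proof.
move=> ff gg fg; apply/matrixP => i j.
have fc := holov_cvg (ff i j).
have fc' : (fun t => g t i j) @ 0^' --> f0 i j.
  apply: cvg_trans fc; apply: near_eq_cvg.
  by apply: near0_imp fg => t ->.
by apply: cvg_unique (gg i j) fc'; exact: norm_hausdorff.
Qed.

End MatrixGerms.

(** * The system at a nonsingular point *)

Lemma mul_numerator (R : fieldType) (x y z r : R) : r != 0 ->
  x * (y * z) = z * r * (y / r * x).
Proof. by move=> r0; field. Qed.

Lemma mulr_minor (R : comNzRingType) (a b x y z : R) :
  a * (z * x) - b * (z * y) = z * (a * x - b * y).
Proof. ring. Qed.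

Section LocalGalois.
Variable C : completeField.
Local Notation M := (germ C).
Local Notation iota := (@germ_cst C).
Variables (p : option C) (K : set (C -> C)).

(** The part of the axioms of a function field that concerns the point p. *)
Record local_function_field : Prop := {
  lf_mero : forall f, K f -> mero (fun t => f (gchart p t));
  lf_const : forall c, K (fun=> c);
  lf_sub : forall f g, K f -> K g -> K (fun x => f x - g x);
  lf_mul : forall f g, K f -> K g -> K (fun x => f x * g x);
  lf_inv : forall f, K f -> K (fun x => (f x)^-1);
  lf_ddx : forall f, K f -> K (fun x => derive1 f x) }.

Hypothesis Kff : local_function_field.

Definition germs_of : set M :=
  [set x | exists2 f, K f & represents x (fun t => f (gchart p t))].

Lemma germs_of_subfield : subfield germs_of.
Proof.
split.
- by exists (fun=> 1); [exact: lf_const|exact: represents_cst].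
- move=> x y [f Kf xf] [g Kg yg]; exists (fun x => f x - g x); first exact: lf_sub.
  by apply: representsD => //; exact: representsN.
- move=> x y [f Kf xf] [g Kg yg]; exists (fun x => f x * g x); first exact: lf_mul.
  exact: representsM.
- move=> x [f Kf xf]; exists (fun x => (f x)^-1); first exact: lf_inv.
  exact: representsV.
Qed.

Lemma germs_of_cst c : germs_of (iota c).
Proof. by exists (fun=> c); [exact: lf_const|exact: represents_cst]. Qed.

Lemma gunit_mero : mero (gunit p).
Proof.
rewrite /gunit; case: p => [a|]; first exact: mero_cst.
by apply: meroN; apply: holo_mero; exact: holoX.
Qed.

(** The germ by which d/dt is multiplied to get d/dx at p. *)
Definition ugerm : M := mk_germ gunit_mero.

Lemma ugermE : represents ugerm (gunit p).
Proof. exact: mk_germE. Qed.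

Lemma gunit_neq0 t : t != 0 -> gunit p t != 0.
Proof. by rewrite /gunit; case: p => [a|] t0; rewrite ?oner_eq0 // oppr_eq0 expf_neq0. Qed.

Lemma ugerm_neq0 : ugerm != 0.
Proof.
apply/eqP => u0; have H := ugermE; rewrite u0 in H.
have [t t0 [H1 H2]] := near0_ex (near0_and H (represents_cst (0 : C))).
have := gunit_neq0 t0; rewrite -H1.
by rewrite [germ_fun 0 t]H2 eqxx.
Qed.

Local Notation d := (germ_deriv ugerm).
Let dP : derivation iota d := germ_derivation ugerm_neq0.

Lemma ddx_near f x : represents x (fun t => f (gchart p t)) ->
  represents (d x) (fun t => derive1 f (gchart p t)) /\
  near0 (fun t => der f (gchart p t) (derive1 f (gchart p t))).
Proof.
move=> xf; have rep (y : M) : represents y (germ_fun y) by apply: filterE.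
have H := der_represents xf (rep (germ_ddt x)).
have D : near0 (fun t => der f (gchart p t) (gunit p t * germ_fun (germ_ddt x) t)).
  by apply: near0_imp (near0_and (@near0_neq0 C) H) => t [t0 Ht]; exact: gchart_der.
split; last by apply: near0_imp D => t Dt; rewrite (der_ddx Dt).
apply: represents_eq (representsM ugermE (rep (germ_ddt x))) _.
by apply: near0_imp D => t Dt; rewrite (der_ddx Dt).
Qed.

Lemma germs_of_deriv x : germs_of x -> germs_of (d x).
Proof.
move=> [f Kf xf]; exists (derive1 f); first exact: lf_ddx.
by have [] := ddx_near xf.
Qed.

Lemma mxrep_over m k (v : C -> 'M[C]_(m, k)) : (forall i j, K (fun x => v x i j)) ->
  exists2 V : 'M[M]_(m, k), mxrep V (fun t => v (gchart p t)) &
  forall i j, germs_of (V i j).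
Proof.
move=> Kv; have [V VP] : exists V : 'M[M]_(m, k), mxrep V (fun t => v (gchart p t)).
  by apply: mxrep_exists => i j; exact: (lf_mero Kff (Kv i j)).
by exists V => // i j; exists (fun x => v x i j).
Qed.

Definition gmx_ddx m k (v : C -> 'M[C]_(m, k)) x : 'M[C]_(m, k) :=
  \matrix_(i, j) derive1 (fun z => v z i j) x.

Lemma mxrep_ddx m k (V : 'M[M]_(m, k)) (v : C -> 'M[C]_(m, k)) :
  mxrep V (fun t => v (gchart p t)) ->
  mxrep (map_mx d V) (fun t => gmx_ddx v (gchart p t)).
Proof.
move=> Vv i j; rewrite mxE; have [H _] := @ddx_near (fun x => v x i j) _ (Vv i j).
by apply: represents_eq H _; apply: filterE => t; rewrite mxE.
Qed.

Variable n : nat.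
Variable A : C -> 'M[C]_n.
Hypothesis KA : forall i j, K (fun x => A x i j).

Definition glocal_system t : 'M[C]_n :=
  if p is Some a then A (a + t) else - (t ^- 2) *: A t^-1.

Lemma glocal_systemE t : t != 0 -> gunit p t *: glocal_system t = A (gchart p t).
Proof.
rewrite /gunit /glocal_system /gchart; case: p => [a|] t0; first by rewrite scale1r.
by rewrite scalerA mulrNN mulfV ?scale1r // expf_neq0.
Qed.

Variable F : C -> 'M[C]_n.
Hypothesis F1 : mxholov F 1%:M.
Hypothesis FD : near0 (fun t => mxder F t (glocal_system t *m F t)).

Lemma F_unit : near0 (fun t => F t \in unitmx).
Proof. exact: (mxholov_unit F1 (unitmx1 _ _)). Qed.

(** In the field of germs the system has the form F' = A F for the derivation d/dx,
    also at infinity. *)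
Lemma fundamental_germs : exists AM FM : 'M[M]_n,
  [/\ mxrep AM (fun t => A (gchart p t)), mxrep FM F, FM \in unitmx,
      forall i j, germs_of (AM i j) & map_mx d FM = AM *m FM].
Proof.
have [AM AMP AMK] := mxrep_over KA.
have [FM FMP] : exists FM : 'M[M]_n, mxrep FM F.
  by apply: mxrep_exists => i j; apply: holo_mero; apply: holov_holo (F1 i j).
exists AM, FM; split=> //; first exact: mxrep_unit FMP F_unit.
apply: (mxrep_uniq (f := fun t => gunit p t *: (glocal_system t *m F t))) (mxrep_mul AMP FMP) _.
  move=> i j; rewrite mxE; apply: represents_eq (representsM ugermE _) _; last first.
  - by apply: filterE => t; rewrite mxE.
  - apply: (represents_ddt (FMP i j)).
    by apply: near0_imp FD => t Ft; exact: Ft.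
by apply: near0_imp (@near0_neq0 C) => t t0; rewrite scalemxAl glocal_systemE.
Qed.

Variables AM FM : 'M[M]_n.
Hypothesis AMP : mxrep AM (fun t => A (gchart p t)).
Hypothesis FMP : mxrep FM F.
Hypothesis FMu : FM \in unitmx.
Hypothesis AMK : forall i j, germs_of (AM i j).
Hypothesis dFM : map_mx d FM = AM *m FM.

(** The matrix Y = F^-1 B F is constant, since deriving F Y = B F gives
    A F Y + F Y' = A B F. *)
Lemma symmetry_conjugate (BM : 'M[M]_n) : map_mx d BM = AM *m BM - BM *m AM ->
  exists B0, BM = FM *m map_mx iota B0 *m invmx FM.
Proof.
move=> dB; have [Y FY] : exists Y, FM *m Y = BM *m FM.
  by exists (invmx FM *m BM *m FM); rewrite !mulmxA mulmxV // mul1mx.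
have dY : map_mx d Y = 0.
  have := congr1 (map_mx d) FY; rewrite !(d_mulmx dP) dB dFM mulmxBl.
  rewrite -!mulmxA FY => E; have {}E : FM *m map_mx d Y = 0.
    by apply: (addrI (AM *m (BM *m FM))); rewrite E addr0 subrK.
  by rewrite -[map_mx d Y]mul1mx -(mulVmx FMu) -mulmxA E mulmx0.
have [B0 YB] := mx_const dP dY; exists B0.
by rewrite -YB FY mulmxK.
Qed.

Lemma conjugate_symmetry B0 : let BM := FM *m map_mx iota B0 *m invmx FM in
  map_mx d BM = AM *m BM - BM *m AM.
Proof.
move=> BM; have FY : BM *m FM = FM *m map_mx iota B0 by rewrite /BM mulmxKV.
move: BM FY => BM FY.
have dB0 : map_mx d (map_mx iota B0) = 0.
  by apply/matrixP => i j; rewrite !mxE; exact: (d_iota dP).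
have := congr1 (map_mx d) FY; rewrite !(d_mulmx dP) dB0 mulmx0 addr0 dFM => E.
apply: (can_inj (mulmxK FMu)); rewrite mulmxBl -[AM *m BM *m FM]mulmxA FY.
by rewrite -[BM *m AM *m FM]mulmxA [AM *m (FM *m _)]mulmxA -E addrK.
Qed.

Section Representation.
Variables (m : nat) (Psi : 'M[C]_n -> 'M[C]_m).
Hypothesis rP : alg_rep Psi.

Lemma rep_data : exists (P : 'I_m -> 'I_m -> mpoly (n * n) C) (k : 'I_m -> 'I_m -> nat),
  forall i j (g : 'M[C]_n), g \in unitmx -> Psi g i j = evm g (P i j) / \det g ^+ k i j.
Proof.
have [_ _ PP] := rP.
have H (ij : 'I_m * 'I_m) : exists pk : mpoly (n * n) C * nat, forall g : 'M[C]_n, g \in unitmx ->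
    Psi g ij.1 ij.2 = evm g pk.1 / \det g ^+ pk.2.
  by have [q [k Pq]] := PP ij.1 ij.2; exists (q, k).
have [pk pkP] := choice H.
by exists (fun i j => (pk (i, j)).1), (fun i j => (pk (i, j)).2) => i j g gu; rewrite (pkP (i, j)).
Qed.

Variables (P : 'I_m -> 'I_m -> mpoly (n * n) C) (k : 'I_m -> 'I_m -> nat).
Hypothesis PsiP : forall i j (g : 'M[C]_n), g \in unitmx ->
  Psi g i j = evm g (P i j) / \det g ^+ k i j.

(** Psi extended to matrices of germs, through its polynomial formulas. *)
Definition PsiM (X : 'M[M]_n) : 'M[M]_m :=
  \matrix_(i, j) (evm X (map_mpoly iota (P i j)) / \det X ^+ k i j).

Lemma PsiM_rep X f : mxrep X f -> near0 (fun t => f t \in unitmx) ->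
  mxrep (PsiM X) (fun t => Psi (f t)).
Proof.
move=> Xf fu i j; rewrite mxE.
apply: (represents_eq (f := fun t => evm (f t) (P i j) / \det (f t) ^+ k i j)).
  apply: representsM; first exact: represents_evm.
  by apply: representsV; apply: representsX; exact: represents_det.
by apply: near0_imp fu => t /PsiP ->.
Qed.

Variable D : nat.
Hypothesis kD : forall i j, (k i j <= D)%N.

(** The numerators of Psi(X) u, over the common denominator det X ^ D. *)
Definition rep_num (u : 'cV[C]_m) i : mpoly (n * n) M :=
  \sum_j iota (u j 0) *: (map_mpoly iota (P i j) * \det (generic_mx M n) ^+ (D - k i j)).

Lemma evm_rep_num X u i : \det X != 0 ->
  evm X (rep_num u i) = \det X ^+ D * (PsiM X *m map_mx iota u) i 0.
Proof.
move=> X0; rewrite mxE mulr_sumr raddf_sum; apply: eq_bigr => j _ /=.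
rewrite evmZ rmorphM rmorphXn /= -(det_map_mx (evm X)) evm_gmx !mxE.
have pw (x : M) a b : (b <= a)%N -> x ^+ a = x ^+ (a - b) * x ^+ b.
  by move=> ba; rewrite -exprD subnK.
rewrite [\det X ^+ D](pw _ _ _ (kD i j)).
by apply: mul_numerator; rewrite expf_neq0.
Qed.

Lemma rep_num_over u i : polyoverK germs_of (rep_num u i).
Proof.
have Ksf := germs_of_subfield.
apply: (pK_sum Ksf) => j _; apply: (pKZ Ksf); first exact: germs_of_cst.
apply: (pKM Ksf); first by move=> l; rewrite mcoeff_map_mpoly; exact: germs_of_cst.
have Kdet : polyoverK germs_of (\det (generic_mx M n)) by apply: (pK_det Ksf) => a b; exact: pK_gmx.
elim: (D - _)%N => [|l IH]; first by rewrite expr0; exact: pK1.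
by rewrite exprS; exact: pKM.
Qed.

Let PM := PsiM FM.
Let PI := PsiM (invmx FM).

Lemma PM_rep : mxrep PM (fun t => Psi (F t)).
Proof. exact: PsiM_rep FMP F_unit. Qed.

Lemma PMI : PM *m PI = 1%:M.
Proof.
have Fi : near0 (fun t => invmx (F t) \in unitmx).
  by apply: near0_imp F_unit => t; rewrite unitmx_inv.
have PIr := PsiM_rep (mxrep_inv FMP F_unit) Fi.
have [P1 PMul _] := rP.
rewrite -(map_mx1 iota); apply: (mxrep_uniq (mxrep_mul PM_rep PIr) (mxrep_cst 1%:M)).
by apply: near0_imp F_unit => t Fu; rewrite -PMul ?unitmx_inv // mulmxV.
Qed.

Lemma PIM : PI *m PM = 1%:M.
Proof. exact: mulmx1C PMI. Qed.

(** Multiplicativity of Psi on germs is deduced from its multiplicativity on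
    functions. *)
Lemma PM_galois (s : 'M[C]_n) : s \in unitmx ->
  PsiM (FM *m map_mx iota s) = PM *m map_mx iota (Psi s).
Proof.
move=> su; have [P1 PMul _] := rP.
have Fs : near0 (fun t => F t *m s \in unitmx).
  by apply: near0_imp F_unit => t Fu; rewrite unitmx_mul Fu.
apply: (mxrep_uniq (PsiM_rep (mxrep_mul FMP (mxrep_cst s)) Fs) (mxrep_mul PM_rep (mxrep_cst _))).
by apply: near0_imp F_unit => t Fu; rewrite PMul.
Qed.

Lemma rep_diff_germs : mxrep (map_mx d PM *m PI) (fun t => grep_diff Psi (A (gchart p t))).
Proof.
have H : mxrep (map_mx d PM) (fun t => grep_diff Psi (A (gchart p t)) *m Psi (F t)).
  apply: (mxrep_eq (f := fun t => gunit p t *: (grep_diff Psi (glocal_system t) *m Psi (F t)))).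
    move=> i j; rewrite mxE; apply: represents_eq (representsM ugermE _) _; last first.
    - by apply: filterE => t; rewrite mxE.
    - apply: (represents_ddt (PM_rep i j)).
      apply: near0_imp (near0_and FD F_unit) => t [Ft Fu].
      exact: (alg_rep_system rP Fu Ft).
  apply: near0_imp (@near0_neq0 C) => t t0.
  by rewrite scalemxAl -(grep_diffZ _ _ rP) glocal_systemE.
have Fi : near0 (fun t => invmx (F t) \in unitmx).
  by apply: near0_imp F_unit => t; rewrite unitmx_inv.
have [P1 PMul _] := rP.
apply: mxrep_eq (mxrep_mul H (PsiM_rep (mxrep_inv FMP F_unit) Fi)) _.
apply: near0_imp F_unit => t Fu.
by rewrite -mulmxA -PMul ?unitmx_inv // mulmxV // P1 mulmx1.
Qed.

(** Variation of constants: if V = Psi(F) Y, then V' - Psi'(A) V is Psi(F) Y'. *)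
Lemma presolution_pullback (V : 'cV[M]_m) b :
  map_mx d V - (map_mx d PM *m PI) *m V = - b *: V ->
  map_mx d (PI *m V) = - b *: (PI *m V).
Proof.
move=> dV; have [Y VE] : exists Y, V = PM *m Y.
  by exists (PI *m V); rewrite mulmxA PMI mul1mx.
have -> : PI *m V = Y by rewrite VE mulmxA PIM mul1mx.
move: dV; rewrite VE (d_mulmx dP) -mulmxA [PI *m _]mulmxA PIM mul1mx addrAC subrr add0r.
by move=> /(congr1 (mulmx PI)); rewrite scalemxAr !mulmxA PIM !mul1mx.
Qed.

Lemma Psi_F_lim : mxholov (fun t => Psi (F t)) 1%:M.
Proof.
have [P1 _ _] := rP; rewrite -P1.
exact: alg_rep_holov rP F1 (unitmx1 _ _).
Qed.

Lemma det_FM_neq0 : \det FM != 0.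
Proof. by rewrite -unitfE -unitmxE. Qed.

Section Galoisian.
Variable s : 'M[C]_n.
Hypothesis sG : differential_galois iota germs_of FM s.

Lemma det_FMs_neq0 : \det (FM *m map_mx iota s) != 0.
Proof.
have [su _] := sG; rewrite det_mulmx mulf_neq0 ?det_FM_neq0 // det_map_mx fmorph_eq0.
by rewrite -unitfE -unitmxE.
Qed.

Definition lim0 (v : C -> 'cV[C]_m) (v0 : 'cV[C]_m) :=
  forall i j, (fun t => v (gchart p t) i j) @ 0^' --> v0 i j.

(** A rational solution is v = Psi(F) u with u constant, and u is the value of v at p
    because Psi(F) is 1 there. Multiplied by det F ^ D, this is a system of
    polynomial relations over K between the entries of F; they hold for F s too,
    so that v = Psi(F) Psi(s) u, and Psi(s) u = u. *)
Theorem galois_rational (v : C -> 'cV[C]_m) (v0 : 'cV[C]_m) : (forall i j, K (fun x => v x i j)) ->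
  near0 (fun t => gmx_ddx v (gchart p t) = grep_diff Psi (A (gchart p t)) *m v (gchart p t)) ->
  lim0 v v0 -> Psi s *m v0 = v0.
Proof.
move=> Kv dv vv0; have [su sF] := sG.
have [V VP VK] := mxrep_over Kv.
have dV : map_mx d V = (map_mx d PM *m PI) *m V.
  exact: (mxrep_uniq (mxrep_ddx VP) (mxrep_mul rep_diff_germs VP)).
have /(mx_const dP)[u uE] : map_mx d (PI *m V) = 0.
  by rewrite (@presolution_pullback V 0) ?oppr0 ?scale0r // dV subrr.
have VE : V = PM *m map_mx iota u by rewrite -uE mulmxA PMI mul1mx.
have v0u : v0 = u.
  have H := mxholov_mul Psi_F_lim (mxholov_cst u); rewrite mul1mx in H.
  apply: (mxholov_cvg_uniq H vv0).
  apply: (mxrep_fun_uniq (X := V)) => //.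
  by rewrite VE; apply: mxrep_mul PM_rep (mxrep_cst u).
have E : V = PM *m map_mx iota (Psi s *m u).
  rewrite map_mxM mulmxA -PM_galois //; apply/colP => i.
  pose q := V i 0 *: \det (generic_mx M n) ^+ D - rep_num u i.
  have qE X : \det X != 0 -> evm X q = \det X ^+ D * (V i 0 - (PsiM X *m map_mx iota u) i 0).
    move=> X0; rewrite /q rmorphB /= evmZ rmorphXn /= -(det_map_mx (evm X)) evm_gmx.
    by rewrite evm_rep_num // mulrBr mulrC.
  have Ksf := germs_of_subfield.
  have qK : polyoverK germs_of q.
    apply: (pKD Ksf); last by apply: (pKN Ksf); exact: rep_num_over.
    apply: (pKZ Ksf) => //.
    have Kdet : polyoverK germs_of (\det (generic_mx M n)) by apply: (pK_det Ksf) => a b; exact: pK_gmx.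
    elim: D => [|l IH]; first by rewrite expr0; exact: pK1.
    by rewrite exprS; exact: pKM.
  have q0 : evm FM q = 0 by rewrite qE ?det_FM_neq0 // -/PM -VE subrr mulr0.
  have := sF q qK q0; rewrite qE ?det_FMs_neq0 // => /eqP.
  by rewrite mulf_eq0 expf_eq0 (negPf det_FMs_neq0) andbF /= subr_eq0 => /eqP.
rewrite v0u; apply: (map_mx_inj (f := iota)).
by rewrite -[LHS]mul1mx -PIM -mulmxA -E VE mulmxA PIM mul1mx.
Qed.

(** By [d_ratio] an exponential presolution is a multiple of Psi(F) u with u constant.
    The proportionality of w and Psi(F) u, expressed by 2 x 2 minors, is a system of
    polynomial relations over K; they hold for F s too, so that Psi(F) Psi(s) u is
    proportional to w, and Psi(s) u to u. Finally the value of w at p is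
    proportional to u, again by minors and a passage to the limit. *)
Theorem galois_exponential (w : C -> 'cV[C]_m) (w0 : 'cV[C]_m) (b : C -> C) : (forall i j, K (fun x => w x i j)) -> K b ->
  near0 (fun t => gmx_ddx w (gchart p t) - grep_diff Psi (A (gchart p t)) *m w (gchart p t)
     = - b (gchart p t) *: w (gchart p t)) ->
  lim0 w w0 -> exists c, Psi s *m w0 = c *: w0.
Proof.
move=> Kw Kb dw ww0; have [su sF] := sG.
have [W WP WK] := mxrep_over Kw.
have [bM bP] := represents_exists (lf_mero Kff Kb).
have dW : map_mx d W - (map_mx d PM *m PI) *m W = - bM *: W.
  apply: (mxrep_uniq (mxrep_sub (mxrep_ddx WP) (mxrep_mul rep_diff_germs WP))) dw.
  exact: mxrep_scale (representsN bP) WP.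
have dY := presolution_pullback dW; set Y := PI *m W in dY.
have WE : W = PM *m Y by rewrite /Y mulmxA PMI mul1mx.
move: Y dY WE => Y dY WE.
have [Y0|] := eqVneq Y 0.
  have W0 : W = 0 by rewrite WE Y0 mulmx0.
  have -> : w0 = 0.
    apply: (mxholov_cvg_uniq (mxholov_cst 0) ww0).
    apply: (mxrep_fun_uniq (X := W)) => //; rewrite W0.
    by have := mxrep_cst (0 : 'cV[C]_m); rewrite map_mx0.
  by exists 0; rewrite mulmx0 scale0r.
move=> /matrix0Pn[j [j0]]; rewrite (ord1 j0) => Yj {j0}.
have dZ : map_mx d ((Y j 0)^-1 *: Y) = 0.
  apply/colP => i; rewrite !mxE.
  have dYi l : d (Y l 0) = - bM * Y l 0 by have /colP/(_ l) := dY; rewrite !mxE.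
  exact: (d_ratio dP Yj (dYi j) (dYi i)).
have [u uE] := mx_const dP dZ.
have YE : Y = Y j 0 *: map_mx iota u by rewrite -uE scalerA mulfV // scale1r.
have uj : u j 0 = 1.
  apply: (fmorph_inj iota); rewrite rmorph1.
  by have /colP/(_ j) := uE; rewrite !mxE mulVf // => <-.
have WPu : W = Y j 0 *: (PM *m map_mx iota u) by rewrite WE {1}YE scalemxAr.
pose U' := PM *m map_mx iota (Psi s *m u).
have minor i l : W i 0 * U' l 0 = W l 0 * U' i 0.
  pose q := W i 0 *: rep_num u l - W l 0 *: rep_num u i.
  have qE X : \det X != 0 -> evm X q = \det X ^+ D *
      (W i 0 * (PsiM X *m map_mx iota u) l 0 - W l 0 * (PsiM X *m map_mx iota u) i 0).
    by move=> X0; rewrite /q rmorphB /= !evmZ !evm_rep_num //; exact: mulr_minor.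
  have Ksf := germs_of_subfield.
  have qK : polyoverK germs_of q.
    apply: (pKD Ksf); last apply: (pKN Ksf); apply: (pKZ Ksf) => //; exact: rep_num_over.
  have q0 : evm FM q = 0.
    rewrite qE ?det_FM_neq0 // -/PM; set N := PM *m _ in WPu *.
    by rewrite WPu !mxE [X in _ - X]mulrAC subrr mulr0.
  have := sF q qK q0; rewrite qE ?det_FMs_neq0 // PM_galois // => /eqP.
  rewrite mulf_eq0 expf_eq0 (negPf det_FMs_neq0) andbF /= subr_eq0 -mulmxA -map_mxM.
  by move=> /eqP.
have : W != 0.
  apply: contraNneq Yj => W0; move: WE; rewrite W0 => /(congr1 (mulmx PI)).
  by rewrite mulmx0 mulmxA PIM mul1mx => <-; rewrite mxE.
move=> /matrix0Pn[i [i0]]; rewrite (ord1 i0) => Wi {i0}.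
have U'E : U' = (U' i 0 / W i 0) *: W.
  by apply/colP => l; rewrite [RHS]mxE mulrAC [U' i 0 * _]mulrC -minor mulrC mulKf.
have su_u : Psi s *m u = (Psi s *m u) j 0 *: u.
  have E : map_mx iota (Psi s *m u) = (U' i 0 / W i 0 * Y j 0) *: map_mx iota u.
    have := congr1 (mulmx PI) U'E; rewrite /U' mulmxA PIM mul1mx WPu.
    by rewrite -!scalemxAr mulmxA PIM mul1mx scalerA.
  have Ej : iota ((Psi s *m u) j 0) = U' i 0 / W i 0 * Y j 0.
    by have /colP/(_ j) := E; rewrite [LHS]mxE => ->; rewrite !mxE uj rmorph1 mulr1.
  apply: (map_mx_inj (f := iota)); apply: etrans E _.
  by rewrite map_mxZ; congr (_ *: _); exact/esym/Ej.
have w0E : w0 = w0 j 0 *: u.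
  have NP := mxrep_mul PM_rep (mxrep_cst u).
  have Nlim := mxholov_mul Psi_F_lim (mxholov_cst u); rewrite mul1mx in Nlim.
  apply/colP => l; rewrite mxE.
  have E : near0 (fun t => w (gchart p t) l 0 * (Psi (F t) *m u) j 0 =
      w (gchart p t) j 0 * (Psi (F t) *m u) l 0).
    apply: (represents_fun_uniq (x := W l 0 * (PM *m map_mx iota u) j 0)).
      exact: representsM (WP _ _) (NP _ _).
    have -> : W l 0 * (PM *m map_mx iota u) j 0 = W j 0 * (PM *m map_mx iota u) l 0.
      by rewrite WPu; set N := PM *m _; rewrite !mxE mulrAC.
    exact: representsM (WP _ _) (NP _ _).
  have L1 : (fun t => w (gchart p t) l 0 * (Psi (F t) *m u) j 0) t @[t --> (0 : C)^']
      --> w0 l 0 * u j 0 by exact: cvgM (ww0 l 0) (holov_cvg (Nlim j 0)).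
  have L2 : (fun t => w (gchart p t) j 0 * (Psi (F t) *m u) l 0) t @[t --> (0 : C)^']
      --> w0 j 0 * u l 0 by exact: cvgM (ww0 j 0) (holov_cvg (Nlim l 0)).
  rewrite uj mulr1 in L1.
  have E' : \forall t \near (0 : C)^', w (gchart p t) j 0 * (Psi (F t) *m u) l 0 =
      w (gchart p t) l 0 * (Psi (F t) *m u) j 0.
    by apply: near0_imp E => t ->.
  have L1' : (fun t => w (gchart p t) l 0 * (Psi (F t) *m u) j 0) t @[t --> (0 : C)^']
      --> w0 j 0 * u l 0 by exact: cvg_trans (near_eq_cvg E') L2.
  by apply: cvg_unique L1 L1'; exact: norm_hausdorff.
exists ((Psi s *m u) j 0).
by rewrite w0E -scalemxAr {1}su_u !scalerA mulrC.
Qed.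

End Galoisian.
End Representation.

End LocalGalois.

(** * Matrices with distinct eigenvalues *)

Section Diagonalization.
Variables (K : fieldType) (n : nat).
Implicit Types (B S P : 'M[K]_n) (l : 'I_n -> K).

Definition distinct_eigenvalues B := exists l, injective l /\ forall i, eigenvalue B (l i).

Lemma eigenvalue_det B a : eigenvalue B a = (\det (B - a%:M) == 0).
Proof. by rewrite /eigenvalue /eigenspace kermx_eq0 row_free_unit unitmxE unitfE negbK. Qed.

Lemma eigenvalue_conj B P a : P \in unitmx ->
  eigenvalue (P *m B *m invmx P) a = eigenvalue B a.
Proof.
move=> Pu; rewrite !eigenvalue_det.
have -> : P *m B *m invmx P - a%:M = P *m (B - a%:M) *m invmx P.
  by rewrite mulmxBr mulmxBl scalar_mxC -[X in _ = _ - X]mulmxA mulmxV // mulmx1.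
rewrite !det_mulmx det_inv mulrAC mulfV ?mul1r //.
by rewrite -unitfE -unitmxE.
Qed.

Lemma eigenvalue_diag l i : eigenvalue (diag_mx (\row_i l i)) (l i).
Proof.
apply/eigenvalueP; exists (delta_mx 0 i); first by rewrite -rowE row_diag_mx mxE.
by apply/eqP => /rowP/(_ i); rewrite !mxE !eqxx; exact/eqP/oner_neq0.
Qed.

Lemma diag_commute S l : is_diag_mx S ->
  S *m diag_mx (\row_i l i) = diag_mx (\row_i l i) *m S.
Proof.
move=> /is_diag_mxP DS; apply/matrixP => i j; rewrite mul_mx_diag mul_diag_mx !mxE.
have [->|ij] := eqVneq i j; first exact: mulrC.
by rewrite DS ?mulr0 ?mul0r.
Qed.

Lemma distinct_eigenvalues_conj B P : P \in unitmx ->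
  distinct_eigenvalues (P *m B *m invmx P) -> distinct_eigenvalues B.
Proof.
by move=> Pu [l [li le]]; exists l; split=> // i; rewrite -(eigenvalue_conj B _ Pu).
Qed.

(** The rows of V are eigenvectors; eigenspaces are in direct sum. *)
Lemma distinct_eigenvalues_diag B : distinct_eigenvalues B ->
  exists2 V, V \in unitmx & exists2 l, injective l & V *m B = diag_mx (\row_i l i) *m V.
Proof.
move=> [l [li le]].
have ev i : exists v : 'rV_n, (v <= eigenspace B (l i))%MS /\ v != 0.
  by have /eigenvalueP[v vB v0] := le i; exists v; split=> //; apply/eigenspaceP.
have [v vP] := choice ev.
pose V := \matrix_(i, j) v i 0 j.
have rV i : row i V = v i by apply/rowP => j; rewrite !mxE.
exists V; last first.
  exists l => //; apply/row_matrixP => i; rewrite row_mul rV.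
  have [/eigenspaceP -> _] := vP i.
  by rewrite row_mul row_diag_mx mxE -scalemxAl -rowE rV.
rewrite -row_free_unit -kermx_eq0; apply: contraT => /rowV0Pn[x /sub_kermxP xV x0].
have dx := mxdirect_sum_eigenspace B (in2W li : {in xpredT &, injective l}).
have x_eq0 i : x 0 i = 0.
  have : x 0 i *: v i = 0.
    move/mxdirect_sumsP: dx => /(_ i isT) cap0.
    apply/eqP; rewrite -submx0 -cap0 sub_capmx.
    have [vi _] := vP i; rewrite scalemx_sub //=.
    have -> : x 0 i *: v i = - \sum_(j < n | j != i) x 0 j *: v j.
      apply/eqP; rewrite -addr_eq0; apply/eqP.
      rewrite -[RHS]xV mulmx_sum_row [RHS](bigD1 i) //= rV; congr (_ + _).
      by apply: eq_bigr => j _; rewrite rV.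
    rewrite eqmx_opp; apply: summx_sub_sums => j ji.
    by have [vj _] := vP j; exact: scalemx_sub.
  by have [_ vi] := vP i; move=> /eqP; rewrite scaler_eq0 (negPf vi) orbF => /eqP.
by case/eqP: x0; apply/rowP => i; rewrite x_eq0 mxE.
Qed.

Lemma commute_diag_is_diag S l : injective l ->
  S *m diag_mx (\row_i l i) = diag_mx (\row_i l i) *m S -> is_diag_mx S.
Proof.
move=> li E; apply/is_diag_mxP => i j ij.
have /matrixP/(_ i j) := E; rewrite mul_mx_diag mul_diag_mx !mxE => /eqP.
rewrite mulrC -subr_eq0 -mulrBl mulf_eq0 subr_eq0 => /orP[/eqP/li ji|/eqP //].
by move: ij; rewrite ji eqxx.
Qed.

Lemma commute_conj_diag S P l : P \in unitmx -> is_diag_mx (invmx P *m S *m P) ->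
  let B := P *m diag_mx (\row_i l i) *m invmx P in S *m B = B *m S.
Proof.
move=> Pu /(@diag_commute _ l); move: (diag_mx _) => D E B.
apply: (can_inj (mulKVmx Pu)); apply: (can_inj (mulmxK Pu)); move: E; rewrite /B !mulmxA.
by rewrite mulVmx // mul1mx mulmxKV.
Qed.

(** The matrix V S V^-1 commutes with a diagonal matrix with distinct entries. *)
Lemma commute_conj_is_diag S B V l : injective l -> V \in unitmx ->
  V *m B = diag_mx (\row_i l i) *m V -> S *m B = B *m S -> is_diag_mx (V *m S *m invmx V).
Proof.
move=> li Vu VB SB; apply: (commute_diag_is_diag li).
have -> : diag_mx (\row_i l i) = V *m B *m invmx V by rewrite VB mulmxK.
by rewrite !mulmxA !mulmxKV // -[V *m S *m B]mulmxA SB !mulmxA.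
Qed.

End Diagonalization.

(** * The adjoint representation *)

Section Adjoint.
Variables (C : completeField) (n : nat).
Implicit Types (g a B : 'M[C]_n).

Definition colvec B : 'cV[C]_(n * n) := (mxvec B)^T.

Lemma colvec_inj : injective colvec.
Proof. by move=> B B' /(can_inj trmxK)/(can_inj mxvecK). Qed.

(** The matrix of B |-> g B g^-1 on column vectors. *)
Definition Ad g : 'M[C]_(n * n) := (lin_mx (mulmxr (invmx g) \o mulmx g))^T.

Lemma AdE g B : Ad g *m colvec B = colvec (g *m B *m invmx g).
Proof. by rewrite /Ad /colvec -trmx_mul mul_vec_lin. Qed.

Lemma colvec_ext (X Y : 'M[C]_(n * n)) : (forall B, X *m colvec B = Y *m colvec B) -> X = Y.
Proof.
move=> XY; apply: (can_inj trmxK); apply/row_matrixP => i.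
have := XY (vec_mx (delta_mx 0 i)); rewrite /colvec vec_mxK.
by move=> /(congr1 trmx); rewrite !trmx_mul trmxK -!rowE.
Qed.

(** The inverse of g is its adjugate divided by its determinant. *)
Lemma Ad_alg_rep : alg_rep Ad.
Proof.
split.
- by apply: colvec_ext => B; rewrite AdE invmx1 mul1mx mulmx1 mul1mx.
- move=> g h gu hu; apply: colvec_ext => B.
  have ghu : g *m h \in unitmx by rewrite unitmx_mul gu.
  have inv_gh : invmx (g *m h) = invmx h *m invmx g.
    by apply: (can_inj (mulKmx ghu)); rewrite mulmxV // -mulmxA mulKVmx // mulmxV.
  by rewrite -mulmxA !AdE inv_gh !mulmxA.
- move=> i j; case/mxvec_indexP: i => i k.
  pose E : 'M[C]_n := vec_mx (delta_mx 0 j).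
  pose N : 'M[mpoly (n * n) C]_n := generic_mx C n *m map_mx (@mpolyC _ C) E *m \adj (generic_mx C n).
  exists (N i k), 1%N => g gu.
  have -> : Ad g (mxvec_index i k) j = (g *m E *m invmx g) i k.
    transitivity ((Ad g *m colvec E) (mxvec_index i k) 0).
      by rewrite /colvec /E vec_mxK trmx_delta -colE [RHS]mxE.
    by rewrite AdE /colvec mxE mxvecE.
  have -> : meval (fun l => mxvec g 0 l) (N i k) = (map_mx (evm g) N) i k by rewrite [RHS]mxE.
  rewrite /N !(map_mxM (evm g)) map_mx_adj evm_gmx evm_map_mpolyC.
  by rewrite /invmx gu -scalemxAr mxE mulrC expr1.
Qed.

(** Let G(s) = (1 + s a) B (1 + s a)^-1. Differentiating G(s) (1 + s a) = (1 + s a) B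
    at s = 0 gives G'(0) + B a = a B. *)
Lemma grep_diff_Ad a B : grep_diff Ad a *m colvec B = colvec (a *m B - B *m a).
Proof.
have line := mxder_line a.
have gE : 1%:M + 0 *: a = 1%:M by rewrite scale0r addr0.
have H := mxder_mulr (colvec B) (alg_rep_der Ad_alg_rep gE line).
set V := grep_diff Ad a *m colvec B in H *.
have VE : V = colvec (vec_mx V^T) by rewrite /colvec vec_mxK trmxK.
rewrite VE; congr colvec; set D := vec_mx _ in VE *.
pose G s := (1%:M + s *: a) *m B *m invmx (1%:M + s *: a).
have GD : mxder G 0 D.
  move=> i j; have := H (mxvec_index i j) 0.
  rewrite VE /colvec [X in der _ _ X]mxE mxvecE; apply: der_ext => s.
  by rewrite AdE /colvec mxE mxvecE.
have gu : \forall s \near (0 : C), 1%:M + s *: a \in unitmx.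
  by apply: (mxder_unit line); rewrite gE unitmx1.
have GM : mxder (fun s => G s *m (1%:M + s *: a)) 0 (D + B *m a).
  move=> i j; rewrite -{1}[D]mulmx1 mxE [(D *m _) i j]mxE [(B *m _) i j]mxE -big_split /=.
  apply: (@der_ext _ (fun s => \sum_k G s i k * (1%:M + s *: a) k j)) => [s|]; first by rewrite [RHS]mxE.
  apply: der_sum => k _; have := derM (GD i k) (line k j).
  by rewrite gE /G gE invmx1 mulmx1 mul1mx.
have BM := mxder_mulr B line.
have key : D + B *m a = a *m B.
  apply/matrixP => i j; apply: (der_uniq (GM i j)); apply: der_near (BM i j).
  by apply: filterS gu => s su; rewrite /G mulmxKV.
by rewrite -key addrK.
Qed.

End Adjoint.

Local Open Scope complex_scope.

(** * The complex numbers and the Riemann sphere *)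

Section ComplexNumbers.
Variable R : realType.

Lemma complex_archi (x : R[i]) : exists n : nat, `|x| <= n%:R.
Proof.
rewrite normc_def; set r := Num.sqrt _.
exists (Num.bound r); rewrite -(rmorph_nat (real_complex R)) lecR ltW //.
by apply: archi_boundP; exact: sqrtr_ge0.
Qed.

Lemma real_series_cvg (v : nat -> R) : (forall k, `|v k| <= 2^-1 ^+ k) ->
  exists l : R, series v @ \oo --> l.
Proof.
move=> vk; suff : cvgn (series v) by move=> /cvg_ex[l vl]; exists l.
apply: normed_cvg.
apply: (series_le_cvg (v_ := geometric 1 2^-1)) => [k|k|k|] /=.
- exact: normr_ge0.
- by rewrite mul1r exprn_ge0.
- by rewrite mul1r.
- by apply: is_cvg_geometric_series; rewrite ger0_norm // invf_lt1 // ltr1n.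
Qed.

Lemma complex_complete (u : nat -> R[i]) : (forall k, `|u k| <= 2^-1 ^+ k) ->
  exists l : R[i], (series u : nat -> R[i]^o) @ \oo --> (l : R[i]^o).
Proof.
move=> uk.
have norm_i : `|'i%C| = 1 :> R[i].
  by rewrite normc_def /= expr0n expr1n add0r sqrtr1.
have half k : 2^-1 ^+ k = (2^-1 ^+ k)%:C :> R[i].
  by rewrite rmorphXn /= fmorphV rmorph_nat.
have reu k : `|complex.Re (u k)| <= 2^-1 ^+ k.
  have := le_trans (normc_ge_Re (u k)) (uk k); by rewrite half lecR.
have imu k : `|complex.Im (u k)| <= 2^-1 ^+ k.
  have H : `|u k * 'i%C| <= 2^-1 ^+ k by rewrite normrM norm_i mulr1.
  by have := le_trans (normc_ge_Re (u k * 'i%C)) H; rewrite ReiNIm normrN half lecR.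
have [a ra] := real_series_cvg reu; have [b ib] := real_series_cvg imu.
exists (a +i* b); apply/cvgrPdist_lt => e e0.
have [re e'0 eE] : exists2 e' : R, 0 < e' & e = e'%:C.
  have := e0; rewrite ltcE => /andP[/eqP ie re]; exists (complex.Re e) => //.
  by rewrite [LHS]complexE ie /= mulr0 addr0.
have h0 : 0 < re / 2 by rewrite divr_gt0.
have [N1 _ A] := (cvgrPdist_lt _ _).1 ra _ h0.
have [N2 _ B] := (cvgrPdist_lt _ _).1 ib _ h0.
exists (maxn N1 N2) => // k; rewrite /= geq_max => /andP[/A Ak /B Bk].
have sE : series u k = (series (fun k => complex.Re (u k)) k) +i* (series (fun k => complex.Im (u k)) k).
  rewrite /series /=; elim: k {Ak Bk} => [|k IHk]; first by rewrite !big_geq.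
  by rewrite !big_nat_recr //= IHk; case: (u k).
rewrite sE eE.
have -> : a +i* b - (series (fun k => complex.Re (u k)) k) +i* (series (fun k => complex.Im (u k)) k) =
  (a - series (fun k => complex.Re (u k)) k)%:C + 'i%C * (b - series (fun k => complex.Im (u k)) k)%:C.
  by rewrite [LHS]complexE.
apply: le_lt_trans (ler_normD _ _) _.
rewrite normrM norm_i mul1r !normc_def /= !expr0n /= !addr0 !sqrtr_sqr -rmorphD ltcR.
by rewrite [re](splitr re) ltrD.
Qed.

Lemma complex_norm_le (z : R[i]) : `|z| <= (`|complex.Re z| + `|complex.Im z|)%:C.
Proof.
rewrite [z in X in X <= _]complexE; apply: le_trans (ler_normD _ _) _.
have norm_i : `|'i%C| = 1 :> R[i] by rewrite normc_def /= expr0n expr1n add0r sqrtr1.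
by rewrite normrM norm_i mul1r !normc_def /= !expr0n /= !addr0 !sqrtr_sqr -rmorphD.
Qed.

Lemma complex_posE (e : R[i]) : 0 < e -> exists2 r : R, 0 < r & e = r%:C.
Proof.
rewrite ltcE => /andP[/eqP ie re]; exists (complex.Re e) => //.
by rewrite [LHS]complexE ie /= mulr0 addr0.
Qed.

(** The interval [0, 1] has nonzero Lebesgue measure. *)
Lemma complex_uncountable : ~ countable [set: R[i]].
Proof.
move=> Cc; have Rc : countable [set: R].
  have -> : [set: R] = @complex.Re R @` [set: R[i]].
    by apply/seteqP; split=> // x _; exists x%:C.
  exact: sub_countable (card_image_le _ _) Cc.
have Ic : countable (`[0, 1]%classic : set R).
  by apply: sub_countable Rc; exact: subset_card_le.
have := countable_lebesgue_measure0 Ic.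
rewrite lebesgue_measure_itv /= lte_fin ltr01 => /eqP.
by rewrite sube0 eqe oner_eq0.
Qed.

End ComplexNumbers.

Section Sphere.
Variable R : realType.

Definition complexField : completeField :=
  CompleteField (@complex_archi R) (@complex_complete R) (@complex_uncountable R).

Local Notation C := complexField.
Local Notation S2 := (CP1 R).

Lemma generically_near0 U (P : R[i] -> Prop) (p : S2) : generically U P -> U p ->
  near0 (fun t : C => P (gchart (p : option C) t)).
Proof. by move=> gP Up; exact: gP. Qed.

Lemma near0_generically U (P : R[i] -> Prop) :
  (forall p : S2, U p -> near0 (fun t : C => P (gchart (p : option C) t))) -> generically U P.
Proof. by move=> H p Up; exact: H. Qed.

Lemma square_compact (r : R) :
  compact ([set z | `|complex.Re z| <= r /\ `|complex.Im z| <= r] : set R[i]^o).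
Proof.
have -> : ([set z | `|complex.Re z| <= r /\ `|complex.Im z| <= r] : set R[i]^o) =
   (fun ab : R * R => (ab.1 +i* ab.2 : R[i]^o)) @` (`[- r, r] `*` `[- r, r]).
  apply/seteqP; split=> [z [zr zi]|_ [[a b] [/= ar br]] <-].
    exists (complex.Re z, complex.Im z); last by case: z {zr zi}.
    by split=> /=; rewrite in_itv /= -ler_norml.
  by move: ar br; rewrite !in_itv /= -!ler_norml.
apply: continuous_compact; last by apply: compact_setX; exact: segment_compact.
apply: continuous_subspaceT => ab.
apply/cvgrPdist_lt => e /complex_posE[re re0 ->].
have h0 : 0 < re / 2 by rewrite divr_gt0.
apply: filterS (nbhsx_ballx ab (re / 2) h0) => cd [/= c d].
apply: le_lt_trans (complex_norm_le _) _; rewrite ltcR [re]splitr.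
by apply: ltrD.
Qed.

Lemma square_closed (r : R) :
  closed ([set z | `|complex.Re z| <= r /\ `|complex.Im z| <= r] : set R[i]^o).
Proof.
apply: compact_closed; last exact: square_compact.
exact: (@norm_hausdorff _ (R[i]^o)).
Qed.

(** A small punctured disc around p contains a punctured disc around each of its
    points; at infinity, the exterior of a large square plays the role of the
    disc. *)
Lemma near0_locally (P : R[i] -> Prop) (p : S2) :
  near0 (fun t : C => P (gchart (p : option C) t)) ->
  \forall q \near p, near0 (fun t : C => P (gchart (q : option C) t)).
Proof.
move=> H; have /near0P[e e0 He] := H; case: p H He => [a|] H He.
- change (nbhs (a : R[i]^o) (fun b => near0 (fun t : C => P (b + t)))).
  apply: filterS (nbhsx_ballx (a : R[i]^o) e e0) => b ab.
  have {}ab : `|b - a| < e by rewrite distrC; exact: ab.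
  have [ba|ba] := eqVneq b a; first by rewrite ba; exact: H.
  have n1 : near0 (fun t : C => `|t| < `|b - a|).
    by apply/near0P; exists `|b - a| => //; rewrite normr_gt0 subr_eq0.
  have n2 : near0 (fun t : C => `|t| < e - `|b - a|).
    by apply/near0P; exists (e - `|b - a|) => //; rewrite subr_gt0.
  apply: near0_imp (near0_and n1 n2) => t [t1 t2].
  have -> : b + t = a + (b - a + t) by ring.
  apply: He.
    apply: contraTneq t1 => E.
    have -> : t = - (b - a) by apply/eqP; rewrite -addr_eq0 addrC E.
    by rewrite normrN ltxx.
  by apply: le_lt_trans (ler_normD _ _) _; rewrite addrC -ltrBrDr.
have [r r0 er] := complex_posE e0.
pose W : set R[i]^o := [set z | `|complex.Re z| <= r^-1 /\ `|complex.Im z| <= r^-1].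
change (filter_from (compact `&` closed) (fun V : set R[i]^o => (Some @` (~` V)) `|` [set None])
  (fun q : S2 => near0 (fun t : C => P (gchart (q : option C) t)))).
exists W; first by split; [exact: square_compact|exact: square_closed].
move=> q [[b Wb <-]|->]; last exact: H.
have rb : (r^-1)%:C < `|b|.
  have [reb|reb] := leP `|complex.Re b| r^-1; last first.
    by apply: lt_le_trans (normc_ge_Re b); rewrite ltcR.
  have [imb|imb] := leP `|complex.Im b| r^-1; first by case: Wb.
  have := normc_ge_Re (b * 'i%C); rewrite ReiNIm normrN normrM.
  have -> : `|'i%C| = 1 :> R[i] by rewrite normc_def /= expr0n expr1n add0r sqrtr1.
  by rewrite mulr1; apply: lt_le_trans; rewrite ltcR.
have n1 : near0 (fun t : C => `|t| < `|b| - (r^-1)%:C).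
  by apply/near0P; exists (`|b| - (r^-1)%:C) => //; rewrite subr_gt0.
apply: near0_imp n1 => t tb /=; rewrite -[b + t]invrK.
have bt : (r^-1)%:C < `|b + t|.
  have := ler_normB (b + t) t; rewrite addrK => bn.
  by move: tb; rewrite ltrBrDr => /lt_le_trans/(_ bn); rewrite [X in X < _]addrC ltrD2r.
have r'0 : 0 < (r^-1)%:C :> R[i] by rewrite -[0]/(0%:C) ltcR invr_gt0.
have bt0 : 0 < `|b + t| by exact: lt_trans bt.
apply: He; first by rewrite invr_eq0 -normr_gt0.
rewrite normfV er -[r]invrK [(r^-1^-1)%:C]fmorphV ltf_pV2 ?posrE //.
Qed.

(** Near each point of U, f either vanishes or does not vanish, except maybe at the
    point; both cases define open sets by [near0_locally], so U meets only one. *)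
Theorem identity_theorem (U : set S2) (f : R[i] -> R[i]) (p : S2) :
  connected U -> meromorphic U f -> U p ->
  near0 (fun t : C => f (gchart (p : option C) t) = 0) ->
  generically U (fun x => f x = 0).
Proof.
move=> Uc fm Up fp.
pose Z (P : R[i] -> Prop) : set S2 := [set q | near0 (fun t : C => P (gchart (q : option C) t))].
have Zopen P : open (Z P).
  by rewrite openE => q Zq; exact: near0_locally.
pose Z0 := Z (fun x => f x = 0); pose Z1 := Z (fun x => f x != 0).
have dich q : U q -> Z0 q \/ Z1 q.
  move=> Uq; have [N [c cf]] := fm q Uq.
  have mf : mero (fun t : C => f (gchart (q : option C) t)).
    by exists N, c; apply: expands_of_cvg; exact: cf.
  exact: mero_eq0_or_neq0 mf.
have disj q : Z0 q -> ~ Z1 q.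
  move=> z0 z1; have [t _ [ft0 ft1]] := near0_ex (near0_and z0 z1).
  by rewrite ft0 eqxx in ft1.
have UZ : U `&` Z0 = U.
  apply: Uc.
  - by exists p; split.
  - by exists Z0 => //; exact: Zopen.
  - exists (~` Z1); first by apply: open_closedC; exact: Zopen.
    apply/seteqP; split=> q [Uq Zq]; split=> //; first exact: disj.
    by case: (dich q Uq).
move=> q Uq; have : (U `&` Z0) q by rewrite UZ.
by move=> [_]; exact.
Qed.

End Sphere.

(** * Function fields and linear symmetries *)

Section FunctionField.
Variables (R : realType) (U : set (CP1 R)) (K : set (R[i] -> R[i])).
Hypothesis K_ff : function_field U K.
Local Notation C := (complexField R).

Lemma mero_of_germ (h : R[i] -> R[i]) : mero_germ h -> mero (h : C -> C).
Proof. by move=> [N [c cf]]; exists N, c; apply: expands_of_cvg; exact: cf. Qed.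

Lemma holo_of_germ (h : R[i] -> R[i]) : holo_germ h -> holo (h : C -> C).
Proof. by move=> [c cf]; exists c; apply: expands_of_cvg; exact: cf. Qed.

Lemma function_field_local (p : CP1 R) : U p ->
  @local_function_field C (p : option C) (K : set (C -> C)).
Proof.
move=> Up; split.
- by move=> f Kf; apply: mero_of_germ; exact: (ff_mero K_ff Kf Up).
- by move=> c; exact: (ff_const K_ff c).
- by move=> f g Kf Kg; exact: (ff_sub K_ff Kf Kg).
- by move=> f g Kf Kg; exact: (ff_mul K_ff Kf Kg).
- by move=> f Kf; exact: (ff_inv K_ff Kf).
- by move=> f Kf; exact: (ff_ddx K_ff Kf).
Qed.

Lemma ff_add f g : K f -> K g -> K (fun x => f x + g x).
Proof.
move=> Kf Kg; have K0 := ff_const K_ff 0.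
have -> : (fun x => f x + g x) = (fun x => f x - ((fun=> 0) x - g x)).
  by apply/funext => x; rewrite sub0r opprK.
exact: (ff_sub K_ff Kf (ff_sub K_ff K0 Kg)).
Qed.

Lemma ff_sum (I : Type) (r : seq I) (P : pred I) (f : I -> R[i] -> R[i]) :
  (forall i, K (f i)) -> K (fun x => \sum_(i <- r | P i) f i x).
Proof.
move=> Kf; elim: r => [|i r IHr].
  have -> : (fun x => \sum_(i <- [::] | P i) f i x) = (fun=> 0).
    by apply/funext => x; rewrite big_nil.
  exact: (ff_const K_ff).
have [Pi|Pi] := boolP (P i).
  have -> : (fun x => \sum_(i <- i :: r | P i) f i x) =
      (fun x => f i x + \sum_(i <- r | P i) f i x).
    by apply/funext => x; rewrite big_cons Pi.
  exact: ff_add.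
have -> : (fun x => \sum_(i <- i :: r | P i) f i x) = (fun x => \sum_(i <- r | P i) f i x).
  by apply/funext => x; rewrite big_cons (negPf Pi).
exact: IHr.
Qed.

Lemma ff_prod (I : Type) (r : seq I) (P : pred I) (f : I -> R[i] -> R[i]) :
  (forall i, K (f i)) -> K (fun x => \prod_(i <- r | P i) f i x).
Proof.
move=> Kf; elim: r => [|i r IHr].
  have -> : (fun x => \prod_(i <- [::] | P i) f i x) = (fun=> 1).
    by apply/funext => x; rewrite big_nil.
  exact: (ff_const K_ff).
have [Pi|Pi] := boolP (P i).
  have -> : (fun x => \prod_(i <- i :: r | P i) f i x) =
      (fun x => f i x * \prod_(i <- r | P i) f i x).
    by apply/funext => x; rewrite big_cons Pi.
  by apply: (ff_mul K_ff).
have -> : (fun x => \prod_(i <- i :: r | P i) f i x) = (fun x => \prod_(i <- r | P i) f i x).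
  by apply/funext => x; rewrite big_cons (negPf Pi).
exact: IHr.
Qed.

Lemma ff_det n (B : R[i] -> 'M[R[i]]_n) : mx_over K B -> K (fun x => \det (B x)).
Proof.
move=> KB; apply: ff_sum => s; apply: (ff_mul K_ff); first exact: (ff_const K_ff).
by apply: ff_prod => i; exact: KB.
Qed.

Lemma ff_mulmx m n p (A : R[i] -> 'M[R[i]]_(m, n)) (B : R[i] -> 'M[R[i]]_(n, p)) :
  mx_over K A -> mx_over K B -> mx_over K (fun x => A x *m B x).
Proof.
move=> KA KB i j.
have -> : (fun x => (A x *m B x) i j) = (fun x => \sum_k A x i k * B x k j).
  by apply/funext => x; rewrite mxE.
by apply: ff_sum => k; apply: (ff_mul K_ff); [exact: KA|exact: KB].
Qed.

Lemma ff_der f : K f -> generically U (fun x => der (f : C -> C) x (ddx f x)).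
Proof.
move=> Kf; apply: near0_generically => p Up.
have lff := function_field_local Up.
have [x xf] := represents_exists (lf_mero lff Kf).
by have [_ H] := ddx_near xf; exact: H.
Qed.

End FunctionField.

Section Bracket.
Variables (R : realType) (n : nat).
Local Notation C := (complexField R).

(** The component of the bracket along d/dy is the matrix B' - [A, B] applied
    to y. *)
Lemma lie_bracketE (A B : R[i] -> 'M[R[i]]_n) x y :
  (forall i j, @der C (fun z => B z i j) x (ddx (fun z => B z i j) x)) ->
  lie_bracket (system_vf A) (linear_vf B) x y =
  (0, (mx_ddx B x - (A x *m B x - B x *m A x)) *m y).
Proof.
move=> dB.
have ddx_eq (f : C -> C) t v : der f t v -> ddx (f : R[i] -> R[i]) t = v by exact: der_ddx.
rewrite /lie_bracket /vf_apply /=; congr (_, _).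
  by rewrite (ddx_eq (fun=> 0) 0 0) ?(ddx_eq (fun=> 1) 0 0) ?subr0 //; exact: der_cst.
apply/colP => i; rewrite [LHS]mxE.
have line (v w c : C) : der (fun s : C => v + s * w) c w.
  have := derD (der_cst v c) (derM (der_id c) (der_cst w c)).
  by rewrite add0r mul1r mulr0 addr0; exact.
rewrite (ddx_eq _ _ ((mx_ddx B x *m y + B x *m (A x *m y)) i 0)); last first.
  have shiftB k l : @der C (fun s => B (x + s) k l) 0 (ddx (fun z => B z k l) x).
    have dsh : @der C (fun s : C => x + s * 1) 0 1 := line x 1 0.
    have dBx : @der C (fun z => B z k l) (x + 0 * 1) (ddx (fun z => B z k l) x).
      by rewrite mul0r addr0.
    have := der_comp dsh dBx; rewrite mulr1.
    by apply: der_ext => s; rewrite mulr1.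
  have -> : (mx_ddx B x *m y + B x *m (A x *m y)) i 0 =
      \sum_k (ddx (fun z => B z i k) x * (y k 0 + 0 * (A x *m y) k 0) + B (x + 0) i k * (A x *m y) k 0).
    rewrite mxE 2!mxE -big_split /=; apply: eq_bigr => k _.
    by rewrite [in LHS]mxE mul0r !addr0.
  apply: (der_ext (f := fun s : C => \sum_k (B (x + s) i k * (y k 0 + s * (A x *m y) k 0) : C))).
    by move=> s; rewrite mulr1 [RHS]mxE; apply: eq_bigr => k _; congr (_ * _); rewrite [RHS]mxE; congr (_ + _); rewrite [RHS]mxE.
  by apply: der_sum => k _; exact: (derM (shiftB i k) (line _ _ _)).
rewrite (ddx_eq _ _ ((A x *m (B x *m y)) i 0)); last first.
  have -> : (A x *m (B x *m y)) i 0 =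
      \sum_k (0 * (y k 0 + 0 * (B x *m y) k 0) + A x i k * (B x *m y) k 0).
    by rewrite mxE; apply: eq_bigr => k _; rewrite mul0r add0r.
  apply: (der_ext (f := fun s : C => \sum_k (A x i k * (y k 0 + s * (B x *m y) k 0) : C))).
    by move=> s; rewrite mulr0 addr0 [RHS]mxE; apply: eq_bigr => k _; congr (_ * _); rewrite [RHS]mxE; congr (_ + _); rewrite [RHS]mxE.
  by apply: der_sum => k _; exact: (derM (der_cst _ _) (line _ _ _)).
rewrite mulmxBl mulmxBl !mulmxA; rewrite !mxE; ring.
Qed.

End Bracket.

Section Generically.
Variables (R : realType) (U : set (CP1 R)).
Local Notation C := (complexField R).

Lemma generically_imp (P Q : R[i] -> Prop) : (forall x, P x -> Q x) -> generically U P -> generically U Q.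
Proof.
move=> PQ gP; apply: near0_generically => p Up.
by apply: near0_imp (generically_near0 gP Up) => t; exact: PQ.
Qed.

Lemma generically_and (P Q : R[i] -> Prop) : generically U P -> generically U Q ->
  generically U (fun x => P x /\ Q x).
Proof.
move=> gP gQ; apply: near0_generically => p Up.
exact: near0_and (generically_near0 gP Up) (generically_near0 gQ Up).
Qed.

Lemma generically_forall (I : finType) (P : I -> R[i] -> Prop) :
  (forall i, generically U (P i)) -> generically U (fun x => forall i, P i x).
Proof.
move=> gP; apply: near0_generically => p Up.
by apply: near0_forall => i; exact: (generically_near0 (gP i) Up).
Qed.

Lemma generically_mx m n (f g : R[i] -> 'M[R[i]]_(m, n)) :
  (forall i j, generically U (fun x => f x i j = g x i j)) -> generically U (fun x => f x = g x).
Proof.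
move=> fg; have H (ij : 'I_m * 'I_n) : generically U (fun x => f x ij.1 ij.2 = g x ij.1 ij.2).
  exact: fg.
by apply: generically_imp (generically_forall H) => x fgx; apply/matrixP => i j; exact: (fgx (i, j)).
Qed.

End Generically.

(** * Complete decomposers and diagonal Galois groups *)

Section Equivalence.
Variables (R : realType) (U : set (CP1 R)) (K : set (R[i] -> R[i])).
Hypotheses (U_connected : connected U) (K_ff : function_field U K).
Variables (n : nat) (A : R[i] -> 'M[R[i]]_n).
Hypothesis A_over_K : mx_over K A.
Local Notation C := (complexField R).

(** A matrix is determined by its values on the basis vectors. *)
Lemma symmetryE B : mx_over K B -> (linear_symmetry U K A B <->
  generically U (fun x => mx_ddx B x = A x *m B x - B x *m A x)).
Proof.
move=> KB.
have dB : generically U (fun x => forall i j, @der C (fun z => B z i j) x (ddx (fun z => B z i j) x)).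
  by apply: generically_forall => i; apply: generically_forall => j; exact: (ff_der K_ff (KB i j)).
split=> [[_ sB]|oB].
  apply: generically_imp (generically_and dB sB) => x [dBx sBx].
  apply/eqP; rewrite -subr_eq0; apply/eqP/matrixP => i j.
  have := sBx (delta_mx j 0); rewrite (lie_bracketE _ _ dBx) => -[].
  by rewrite -colE => /colP/(_ i); rewrite !mxE.
split=> //; apply: generically_imp (generically_and dB oB) => x [dBx oBx] y.
by rewrite (lie_bracketE _ _ dBx) oBx subrr mul0mx.
Qed.

Variable x0 : CP1 R.
Hypothesis x0_nonsingular : nonsingular U A x0.
Local Notation p := (x0 : option C).
Local Notation M := (germ C).
Local Notation iota := (@germ_cst C).
Local Notation d := (germ_deriv (ugerm p)).
Local Notation KM := (@germs_of C p (K : set (C -> C))).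

Lemma x0_in : U x0. Proof. by have [] := x0_nonsingular. Qed.

Lemma K_local : @local_function_field C p (K : set (C -> C)).
Proof. exact (function_field_local K_ff x0_in). Qed.

Lemma fundamental_matrix : exists F : C -> 'M[C]_n, mxholov F 1%:M /\
  near0 (fun t => mxder F t (glocal_system p (A : C -> 'M[C]_n) t *m F t)).
Proof.
have [_ Ah] := x0_nonsingular.
have [i j|F [F1 FD]] := @linear_system_solution C n (glocal_system p (A : C -> 'M[C]_n)).
  by apply: holo_of_germ; exact: Ah.
by exists F; split=> // i j; rewrite mxE; exact: F1.
Qed.

(** The elements of K vanish if their germs at x0 do. *)
Lemma vanishing m k (D : R[i] -> 'M[R[i]]_(m, k)) : mx_over K D ->
  near0 (fun t : C => D (gchart p t) = 0) -> generically U (fun x => D x = 0).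
Proof.
move=> KD D0; apply: generically_mx => i j.
apply: (@generically_imp _ _ (fun x => D x i j = 0)) => [x ->|]; first by rewrite mxE.
apply: identity_theorem U_connected (ff_mero K_ff (KD i j)) x0_in _.
by apply: near0_imp D0 => t ->; rewrite mxE.
Qed.

Variables (F : C -> 'M[C]_n) (AM FM : 'M[M]_n).
Hypotheses (F1 : mxholov F 1%:M)
  (FD : near0 (fun t => mxder F t (glocal_system p (A : C -> 'M[C]_n) t *m F t)))
  (AMP : mxrep AM (fun t => (A : C -> 'M[C]_n) (gchart p t)))
  (FMP : mxrep FM F) (FMu : FM \in unitmx)
  (AMK : forall i j, KM (AM i j)) (dFM : map_mx d FM = AM *m FM).

Lemma differential_galois_Gal s : differential_galois iota KM FM s -> Gal U K A x0 s.
Proof.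
move=> sG; split; first by have [] := sG.
move=> m Psi rP; have {}rP : @alg_rep C n m Psi by exact: rP.
have [P [k PsiP]] := rep_data rP.
have kD i j : (k i j <= \sum_i \sum_j k i j)%N.
  by rewrite (bigD1 i) //= (bigD1 j) //= -addnA leq_addr.
split=> [v v0 [Kv dv] vv0|w w0 [Kw [b [Kb dw]]] ww0].
  apply: (galois_rational K_local F1 FD FMP FMu rP PsiP kD sG Kv _ vv0).
  exact: (generically_near0 dv x0_in).
apply: (galois_exponential K_local F1 FD FMP FMu rP PsiP kD sG Kw Kb _ ww0).
exact: (generically_near0 dw x0_in).
Qed.

(** The entries of F B0 F^-1 are germs of elements of K by the Galois correspondence.
    The corresponding matrix over K is a symmetry near x0, hence everywhere by the
    identity theorem. *)
Lemma symmetry_of_conjugate (B0 : 'M[C]_n) : (forall s, Gal U K A x0 s -> s *m B0 = B0 *m s) ->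
  exists B : R[i] -> 'M[R[i]]_n, linear_symmetry U K A B /\
    near0 (fun t : C => (B : C -> 'M[C]_n) (gchart p t) = F t *m B0 *m invmx (F t)).
Proof.
move=> sB0; have dP := germ_derivation (@ugerm_neq0 C p).
have BMK := fixed_by_galois dP (germ_char0 _) (@cf_uncountable C) (germs_of_subfield K_local)
  (germs_of_cst K_local) (germs_of_deriv K_local) AMK FMu dFM
  (fun s sG => sB0 s (differential_galois_Gal sG)).
have dBM := conjugate_symmetry FMu dFM B0.
set BM := FM *m _ *m _ in BMK dBM.
have BMF : mxrep BM (fun t => F t *m B0 *m invmx (F t)).
  exact (mxrep_mul (mxrep_mul FMP (mxrep_cst B0)) (mxrep_inv FMP (F_unit F1))).
have H (ij : 'I_n * 'I_n) : exists f : C -> C, K f /\ represents (BM ij.1 ij.2) (fun t => f (gchart p t)).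
  by have [f Kf fE] := BMK ij.1 ij.2; exists f.
have [f fP] := choice H.
pose B x : 'M[R[i]]_n := \matrix_(i, j) f (i, j) x.
have BE i j : (fun x => B x i j) = f (i, j) by apply/funext => x; rewrite mxE.
have KB : mx_over K B by move=> i j; rewrite BE; have [] := fP (i, j).
have BMB : mxrep BM (fun t => (B : C -> 'M[C]_n) (gchart p t)).
  by move=> i j; have [_ H'] := fP (i, j); apply: represents_eq H' _; apply: filterE => t; rewrite mxE.
exists B; split; last exact: mxrep_fun_uniq BMB BMF.
apply/(symmetryE KB).
pose D x := mx_ddx B x - (A x *m B x - B x *m A x).
have KD : mx_over K D.
  move=> i j; have -> : (fun x => D x i j) = (fun x => ddx (fun z => B z i j) x -
      ((A x *m B x) i j - (B x *m A x) i j)) by apply/funext => x; rewrite !mxE.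
  apply: (ff_sub K_ff); first exact (ff_ddx K_ff (KB i j)).
  exact (ff_sub K_ff (ff_mulmx K_ff A_over_K KB i j) (ff_mulmx K_ff KB A_over_K i j)).
have E : near0 (fun t : C => mx_ddx B (gchart p t) = A (gchart p t) *m B (gchart p t) -
    B (gchart p t) *m A (gchart p t)).
  apply: (mxrep_fun_uniq (mxrep_ddx BMB)); rewrite dBM.
  exact: mxrep_sub (mxrep_mul AMP BMB) (mxrep_mul BMB AMP).
have D0 : near0 (fun t : C => D (gchart p t) = 0).
  by apply: near0_imp E => t Et; apply/eqP; rewrite subr_eq0; apply/eqP.
apply: generically_imp (vanishing KD D0) => x Dx.
by apply/eqP; rewrite -subr_eq0; apply/eqP.
Qed.

(** Seen as a column vector, the symmetry B = F B0 F^-1 is a rational solution of the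
    system induced by the adjoint representation, and its value at x0 is B0; so
    Galoisian matrices fix B0 under conjugation. *)
Lemma conjugate_of_symmetry B : linear_symmetry U K A B ->
  exists2 B0 : 'M[C]_n,
    near0 (fun t : C => (B : C -> 'M[C]_n) (gchart p t) = F t *m B0 *m invmx (F t)) &
    forall s, Gal U K A x0 s -> s *m B0 = B0 *m s.
Proof.
move=> sB; have [KB _] := sB; have oB := (symmetryE KB).1 sB.
have [BM BMB BMK] := mxrep_over K_local (v := (B : C -> 'M[C]_n)) KB.
have dBM : map_mx d BM = AM *m BM - BM *m AM.
  apply: (mxrep_uniq (mxrep_ddx BMB) (mxrep_sub (mxrep_mul AMP BMB) (mxrep_mul BMB AMP))).
  exact: (generically_near0 oB x0_in).
have [B0 BMF] := symmetry_conjugate FMu dFM dBM.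
have BF : near0 (fun t : C => (B : C -> 'M[C]_n) (gchart p t) = F t *m B0 *m invmx (F t)).
  apply: (mxrep_fun_uniq BMB); rewrite BMF.
  exact (mxrep_mul (mxrep_mul FMP (mxrep_cst B0)) (mxrep_inv FMP (F_unit F1))).
exists B0 => // s [su /(_ _ _ (@Ad_alg_rep C n))[sv _]].
pose v x : 'cV[R[i]]_(n * n) := @colvec C n (B x).
have vE i k j : (fun x => v x (mxvec_index i k) j) = (fun x => B x i k).
  by apply/funext => x; rewrite mxE (ord1 j) mxvecE.
have vsol : rational_solution U K A (@Ad C n) v.
  split; first by move=> l j; case/mxvec_indexP: l => i k; rewrite vE; exact: KB.
  apply: generically_imp oB => x oBx.
  transitivity (@colvec C n (mx_ddx B x)); last by rewrite oBx; exact (esym (@grep_diff_Ad C n (A x) (B x))).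
  apply/matrixP => l j; case/mxvec_indexP: l => i k.
  by rewrite mxE vE /colvec [RHS]mxE (ord1 j) mxvecE mxE.
have vlim : mx_has_value v x0 (colvec B0).
  have H := mxholov_mul (alg_rep_holov (@Ad_alg_rep C n) F1 (unitmx1 _ _)) (mxholov_cst (colvec B0)).
  have [Ad1 _ _] := @Ad_alg_rep C n; rewrite Ad1 mul1mx in H.
  move=> l j; have E : near0 (fun t : C => (Ad (F t) *m colvec B0) l j = v (gchart p t) l j).
    by apply: near0_imp BF => t BFt; rewrite AdE /v; congr (colvec _ l j); exact/esym.
  exact (holov_cvg (holov_eq (H l j) E)).
have E : Ad (s : 'M[C]_n) *m colvec B0 = colvec B0 := sv v (colvec B0) vsol vlim.
have {}E : (s : 'M[C]_n) *m B0 *m invmx s = B0 by apply: colvec_inj; rewrite -AdE.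
have su' : (s : 'M[C]_n) \in unitmx by exact: su.
by have := mulmxKV su' (s *m B0); rewrite E.
Qed.

End Equivalence.

Theorem corollary6p11 (R : realType)
  (U : set (CP1 R)) (U_open : open U) (U_connected : connected U)
  (U_nonempty : U !=set0)
  (K : set (R[i] -> R[i])) (K_ff : function_field U K)
  (n : nat) (n_gt0 : (0 < n)%N)
  (A : R[i] -> 'M[R[i]]_n) (A_over_K : mx_over K A)
  (x0 : CP1 R) (x0_nonsingular : nonsingular U A x0) :
  (exists B : R[i] -> 'M[R[i]]_n,
     linear_symmetry U K A B /\ complete_decomposer U B)
  <->
  (exists2 P : 'M[R[i]]_n, P \in unitmx &
     forall sigma, Gal U K A x0 sigma ->
       is_diag_mx (invmx P *m sigma *m P)).
Proof.
have [F [F1 FD]] := fundamental_matrix x0_nonsingular.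
have Ux0 := x0_in x0_nonsingular.
have [AM [FM [AMP FMP FMu AMK dFM]]] := fundamental_germs (K_local K_ff x0_nonsingular) A_over_K F1 FD.
have Funit := F_unit F1.
split=> [[B [sB cB]]|[P Pu Pdiag]].
  have [B0 BF sB0] := conjugate_of_symmetry K_ff x0_nonsingular F1 AMP FMP FMu dFM sB.
  have [t _ [[BFt Fu] cBt]] := near0_ex (near0_and (near0_and BF Funit) (generically_near0 cB Ux0)).
  have cB0 : distinct_eigenvalues B0.
    by apply: (distinct_eigenvalues_conj Fu); rewrite -BFt; exact: cBt.
  have [V Vu [l li VB0]] := distinct_eigenvalues_diag cB0.
  exists (invmx V); first by rewrite unitmx_inv.
  by move=> s /sB0 sB0s; rewrite invmxK; exact: commute_conj_is_diag li Vu VB0 sB0s.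
(* any n distinct constants would do *)
pose l (i : 'I_n) : complexField R := i%:R.
pose B0 : 'M[complexField R]_n := P *m diag_mx (\row_i l i) *m invmx P.
have sB0 s : Gal U K A x0 s -> s *m B0 = B0 *m s by move=> /Pdiag; exact: commute_conj_diag.
have [B [sB BF]] := symmetry_of_conjugate U_connected K_ff A_over_K x0_nonsingular F1 FD AMP FMP FMu AMK dFM sB0.
exists B; split=> //; have [KB _] := sB.
(* a constant eigenvalue near x0 is an eigenvalue everywhere, as a root of the
   characteristic polynomial *)
have ev i : generically U (fun x => eigenvalue (B x) (l i)).
  have Kdet : K (fun x => \det (B x - (l i)%:M)).
    apply: (ff_det K_ff) => j k.
    have -> : (fun x => (B x - (l i)%:M) j k) = (fun x => B x j k - ((l i)%:M : 'M[R[i]]_n) j k).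
      by apply/funext => x; rewrite !mxE.
    exact (ff_sub K_ff (KB j k) (ff_const K_ff _)).
  have det0 : near0 (fun t : complexField R => \det (B (gchart (x0 : option (complexField R)) t) - (l i)%:M) = 0).
    apply: near0_imp (near0_and BF Funit) => t [BFt Fu]; apply/eqP.
    have : @eigenvalue (complexField R) n (B (gchart (x0 : option (complexField R)) t)) (l i).
      by rewrite BFt eigenvalue_conj // eigenvalue_conj // eigenvalue_diag.
    by rewrite eigenvalue_det.
  apply: generically_imp (identity_theorem U_connected (ff_mero K_ff Kdet) Ux0 det0) => x dx.
  by rewrite eigenvalue_det dx.
apply: generically_imp (generically_forall ev) => x evx; exists l; split=> //.
by move=> i j /eqP; rewrite /l eqr_nat => /eqP/val_inj.
Qed.
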